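(* Let $0<\lambda<e^{-(\log L+L)}$ be such that the following holds: the Julia set $\mathcal{J}(\mathcal{Z}_\lambda)$ consists of uncountably many disjoint hairs, each of the hairs tends to $\infty$ by having its third coordinate go to $\infty$ while the other two coordinates remain bounded, and for each $x\notin\mathcal{J}(\mathcal{Z}_\lambda)$ the sequence $\mathcal{Z}_\lambda^n(x)$ converges to a fixed point. Then $\mathcal{J}(\mathcal{Z}_\lambda)\cup\{\infty\}$ is a Lelek fan with top at $\infty$.
   Context: Zorich maps. Let $Q=\{(x_1,x_2)\in\mathbb{R}^2:|x_1|\le 1,|x_2|\le 1\}$ and let $h=(h_1,h_2,h_3)$ be a sense-preserving $L$-bi-Lipschitz map (i.e. $L^{-1}|u-v|\le|h(u)-h(v)|\le L|u-v|$) from $Q$ onto the upper hemisphere $\{x\in\mathbb{R}^3:|x|=1,\ x_3\ge 0\}$. Define $\mathcal{Z}(x_1,x_2,x_3)=e^{x_3}h(x_1,x_2)$ on $Q\times\mathbb{R}$ and extend $\mathcal{Z}$ to $\mathbb{R}^3$ by repeatedly reflecting across the sides of the square beam in the domain and across the plane $x_3=0$ in the range. Explicitly, if $|x_1-2n|\le1$, $|x_2-2m|\le 1$ with $n,m\in\mathbb{Z}$, and $u=((-1)^n(x_1-2n),(-1)^m(x_2-2m))\in Q$, then $\mathcal{Z}(x)=e^{x_3}(h_1(u),h_2(u),(-1)^{n+m}h_3(u))$. For $\lambda>0$ put $\mathcal{Z}_\lambda=\lambda\mathcal{Z}$; it is a quasiregular map of transcendental type. Julia set. For such a map $f:\mathbb{R}^d\to\mathbb{R}^d$,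 $\mathcal{J}(f)$ is the set of all $x\in\mathbb{R}^d$ such that $\operatorname{cap}\left(\mathbb{R}^d\setminus\bigcup_{k=1}^\infty f^k(U)\right)=0$ for every neighbourhood $U$ of $x$, where $\operatorname{cap}$ is conformal capacity: a compact set $F$ has capacity zero if $\inf\int|\nabla u|^d=0$, the infimum being over $u\in C_0^\infty(A)$ with $u\ge 1$ on $F$, for some (equivalently every) bounded open $A\supset F$; a closed set has capacity zero if all of its compact subsets do. A subset $H\subset\mathbb{R}^3$ is a hair if there is a homeomorphism $\gamma:[0,\infty)\to H$ with $\gamma(t)\to\infty$ as $t\to\infty$. $\mathcal{J}(\mathcal{Z}_\lambda)\cup\{\infty\}$ has the topology of a subspace of the one-point compactification $\mathbb{R}^3\cup\{\infty\}$. Fans. A continuum (compact connected metric space) $X$ is a fan with top $x_0$ if: (i) $X$ is hereditarily unicoherent, meaning $K\cap N$ is connected for every pair of subcontinua $K,N$ of $X$; (ii) $X$ is arcwise connected (with (i), this makes $X$ uniquely arcwise connected); (iii) $x_0$ is the only point that is the common endpoint of at least three different arcs that are otherwise disjoint. For $x,y\in X$, $[x,y]$ is the unique arc connecting $x$ and $y$. A point $x\in X$ is an endpoint of $X$ if it is an endpoint of every arc in $X$ containing it. A fan $X$ with top $x_0$ is a Lelek fan if (a) for any sequence $y_n\in X$ converging to $y\in X$ the arcs $[x_0,y_n]$ converge to $[x_0,y]$ in the Hausdorff metric (smoothness), and (b) the endpoints of $X$ are dense in $X$. *)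

(* Defs.v *)
From mathcomp Require Import all_boot all_order all_algebra.
From mathcomp Require Import all_classical all_reals all_analysis.

Set Implicit Arguments.
Unset Strict Implicit.
Unset Printing Implicit Defensive.

Import Order.TTheory GRing.Theory Num.Theory.
Import numFieldNormedType.Exports.

Local Open Scope classical_set_scope.
Local Open Scope ring_scope.

(* The library norm of ['rV[R]_n] is the sup norm; the topology is the same. *)
Definition enorm (R : realType) (n : nat) (x : 'rV[R]_n) : R :=
  Num.sqrt (\sum_(i < n) x 0 i ^+ 2).

Definition vec2 (R : realType) (a b : R) : 'rV[R]_2 :=
  \row_(i < 2) [:: a; b]`_i.

Definition vec3 (R : realType) (a b c : R) : 'rV[R]_3 :=
  \row_(i < 3) [:: a; b; c]`_i.

Definition square (R : realType) : set 'rV[R]_2 :=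
  [set u | `|u 0 0| <= 1 /\ `|u 0 1| <= 1].

Definition upper_hemisphere (R : realType) : set 'rV[R]_3 :=
  [set x | enorm x = 1 /\ 0 <= x 0 2].

Definition bilipschitz_on (R : realType) (m n : nat) (A : set 'rV[R]_m) (L : R)
    (h : 'rV[R]_m -> 'rV[R]_n) : Prop :=
  forall u v, A u -> A v ->
    L^-1 * enorm (u - v) <= enorm (h u - h v) <= L * enorm (u - v).

(* The sphere is oriented by its outward normal, which at [h u] is [h u]
   itself; so [h], being Lipschitz, is sense-preserving when the frame
   (d_1 h, d_2 h, h) is positively oriented almost everywhere. The determinant
   is that of the derivative of e^{x_3} h(x_1, x_2), up to the factor e^{3 x_3}.
   The values of [h] outside the square are irrelevant, since the boundary of
   the square is a null set. *)
Definition sense_preserving (R : realType) (h : 'rV[R]_2 -> 'rV[R]_3) : Prop :=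
  {ae (@lebesgue_measure R \x @lebesgue_measure R)%E, forall p : R * R,
     let u := vec2 p.1 p.2 in
     square u ->
     differentiable h u /\ 0 < \det (col_mx ('J h u) (h u) : 'M[R]_3)}.

(* [Z] is the extension of e^{x_3} h(x_1, x_2) by reflections. On the common
   faces of two beams the two formulas agree, because h_3 = 0 on the boundary
   of the square; hence [h] determines a unique such [Z]. *)
Definition zorich_map (R : realType) (h : 'rV[R]_2 -> 'rV[R]_3)
    (Z : 'rV[R]_3 -> 'rV[R]_3) : Prop :=
  forall (x : 'rV[R]_3) (n m : int),
    `|x 0 0 - 2 * n%:~R| <= 1 -> `|x 0 1 - 2 * m%:~R| <= 1 ->
    let u := vec2 ((-1) ^ n * (x 0 0 - 2 * n%:~R))
                  ((-1) ^ m * (x 0 1 - 2 * m%:~R)) in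
    Z x = expR (x 0 2) *:
          vec3 (h u 0 0) (h u 0 1) ((-1) ^ (n + m) * h u 0 2).

Definition zorich_scale (R : realType) (lam : R) (Z : 'rV[R]_3 -> 'rV[R]_3) :
    'rV[R]_3 -> 'rV[R]_3 :=
  fun x => lam *: Z x.

Definition partial (R : realType) (n : nat) (i : 'I_n) (u : 'rV[R]_n -> R) :
    'rV[R]_n -> R :=
  fun x => 'D_(delta_mx 0 i) u x.

Definition iter_partial (R : realType) (n : nat) (s : seq 'I_n)
    (u : 'rV[R]_n -> R) : 'rV[R]_n -> R :=
  foldr (@partial R n) u s.

Definition smooth_fun (R : realType) (n : nat) (u : 'rV[R]_n -> R) : Prop :=
  forall s : seq 'I_n,
    continuous (iter_partial s u) /\
    forall (i : 'I_n) (x : 'rV[R]_n), derivable (iter_partial s u) x (delta_mx 0 i).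

Definition test_fun (R : realType) (n : nat) (A : set 'rV[R]_n)
    (u : 'rV[R]_n -> R) : Prop :=
  [/\ smooth_fun u, compact (closure [set x | u x != 0]) &
      closure [set x | u x != 0] `<=` A].

Definition gradient (R : realType) (n : nat) (u : 'rV[R]_n -> R)
    (x : 'rV[R]_n) : 'rV[R]_n :=
  \row_(i < n) partial i u x.

Definition conformal_energy (R : realType) (u : 'rV[R]_3 -> R) : \bar R :=
  (\int[(@lebesgue_measure R \x @lebesgue_measure R) \x @lebesgue_measure R]_p
     (enorm (gradient u (vec3 p.1.1 p.1.2 p.2)) ^+ 3)%:E)%E.

Definition compact_cap_zero (R : realType) (F : set 'rV[R]_3) : Prop :=
  exists A : set 'rV[R]_3,
    [/\ open A, bounded_set A, F `<=` A &
        ereal_inf [set conformal_energy u | u in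
          [set u : 'rV[R]_3 -> R | test_fun A u /\ forall x, F x -> 1 <= u x]]
        = 0%E].

Definition cap_zero (R : realType) (E : set 'rV[R]_3) : Prop :=
  forall F, compact F -> F `<=` E -> compact_cap_zero F.

(* When [U] is not open the complement below need not be closed; it is then
   contained in the one obtained from the interior of [U], so only open
   neighbourhoods matter. *)
Definition julia (R : realType) (f : 'rV[R]_3 -> 'rV[R]_3) : set 'rV[R]_3 :=
  [set x | forall U : set 'rV[R]_3, nbhs x U ->
     cap_zero (~` \bigcup_(k in [set k : nat | (0 < k)%N]) (iter k f @` U))].

Definition homeo_on (S T : topologicalType) (A : set S) (B : set T)
    (f : S -> T) : Prop :=
  [/\ {within A, continuous f}, f @` A = B &
      exists2 g : T -> S, {within B, continuous g} & {in A, cancel f g}].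

Definition hair_param (R : realType) (H : set 'rV[R]_3) (g : R -> 'rV[R]_3) :
    Prop :=
  homeo_on (`[0, +oo[%classic : set R) H g /\ enorm (g t) @[t --> +oo] --> +oo.

Definition tends_up (R : realType) (g : R -> 'rV[R]_3) : Prop :=
  g t 0 2 @[t --> +oo] --> +oo /\
  exists M : R, forall t, 0 <= t -> `|g t 0 0| <= M /\ `|g t 0 1| <= M.

Definition metrizes (R : realType) (T : topologicalType) (X : set T)
    (d : T -> T -> R) : Prop :=
  [/\ forall x y, X x -> X y -> (d x y = 0 <-> x = y),
      forall x y, X x -> X y -> d x y = d y x,
      forall x y z, X x -> X y -> X z -> d x z <= d x y + d y z &
      forall x, X x -> forall A : set T, within X (nbhs x) A <->
        exists2 e : R, 0 < e & forall y, X y -> d x y < e -> A y].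

Definition continuum (R : realType) (T : topologicalType) (X : set T) : Prop :=
  [/\ X !=set0, compact X, connected X & exists d : T -> T -> R, metrizes X d].

Definition is_arc (R : realType) (T : topologicalType) (A : set T) (x y : T) :
    Prop :=
  exists g : R -> T, [/\ homeo_on (`[0, 1]%classic : set R) A g, g 0 = x & g 1 = y].

Definition hereditarily_unicoherent (R : realType) (T : topologicalType)
    (X : set T) : Prop :=
  forall K N : set T, K `<=` X -> N `<=` X ->
    continuum R K -> continuum R N -> connected (K `&` N).

Definition arcwise_connected (R : realType) (T : topologicalType)
    (X : set T) : Prop :=
  forall x y, X x -> X y -> x <> y ->
    exists2 A : set T, A `<=` X & is_arc R A x y.

Definition branch_point (R : realType) (T : topologicalType) (X : set T)
    (p : T) : Prop :=
  exists (a : 'I_3 -> set T) (q : 'I_3 -> T),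
    (forall i, a i `<=` X /\ is_arc R (a i) p (q i)) /\
    (forall i j, i != j -> a i `&` a j = [set p]).

Definition is_fan (R : realType) (T : topologicalType) (X : set T) (x0 : T) :
    Prop :=
  [/\ continuum R X, hereditarily_unicoherent R X, arcwise_connected R X, X x0 &
      forall p, X p -> (branch_point R X p <-> p = x0)].

(* [A] is the set [x, y]; it is degenerate when x = y. *)
Definition segment (R : realType) (T : topologicalType) (X : set T) (x y : T)
    (A : set T) : Prop :=
  A `<=` X /\ ((x = y /\ A = [set x]) \/ is_arc R A x y).

Definition fan_endpoint (R : realType) (T : topologicalType) (X : set T)
    (x : T) : Prop :=
  X x /\ forall (A : set T) (a b : T),
    A `<=` X -> is_arc R A a b -> A x -> x = a \/ x = b.

Definition hausdorff_dist (R : realType) (T : Type) (d : T -> T -> R)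
    (A B : set T) : \bar R :=
  maxe (ereal_sup [set ereal_inf [set (d a b)%:E | b in B] | a in A])
       (ereal_sup [set ereal_inf [set (d a b)%:E | a in A] | b in B]).

(* In a fan the set [x, y] is unique, so quantifying over all of them amounts
   to choosing it; and any two metrics of a compact space give the same notion
   of Hausdorff convergence. *)
Definition smooth_fan (R : realType) (T : topologicalType) (X : set T)
    (x0 : T) : Prop :=
  forall d : T -> T -> R, metrizes X d ->
  forall (y_ : nat -> T) (y : T) (A_ : nat -> set T) (A : set T),
    (forall n, X (y_ n)) -> X y -> y_ @ \oo --> y ->
    (forall n, segment R X x0 (y_ n) (A_ n)) -> segment R X x0 y A ->
    hausdorff_dist d (A_ n) A @[n --> \oo] --> 0%E.

Definition is_lelek_fan (R : realType) (T : topologicalType) (X : set T)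
    (x0 : T) : Prop :=
  [/\ is_fan R X x0, smooth_fan R X x0 &
      X `<=` closure [set x | fan_endpoint R X x]].

(* Main.v *)
From HB Require Import structures.
Require Import Defs.
From mathcomp Require Import all_boot all_order all_algebra.
From mathcomp Require Import all_classical all_reals all_analysis.
From mathcomp Require Import ring lra measurable_realfun.

Set Implicit Arguments.
Unset Strict Implicit.
Unset Printing Implicit Defensive.

Import Order.TTheory GRing.Theory Num.Theory.
Import numFieldNormedType.Exports.

Local Open Scope classical_set_scope.
Local Open Scope ring_scope.

(** Write [f] for the Zorich map times [lam], and [mu = - ln (lam * L)], so that
    [lam * exp mu = 1 / L <= 1] and, by the bound on [lam], [mu > L >= 1].

    Half of the beams, the upright ones, are mapped by [f] above the plane
    [x_3 = 0], and the others below it. As [|f x| = lam * exp x_3], the half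
    space [x_3 < mu] is mapped into the unit ball, which it contains. A point
    whose orbit enters this half space has a neighbourhood with bounded forward
    orbit; as a cube has positive conformal capacity
    ([cube_positive_capacity]), that point is not in the Julia set. So the Julia
    set consists of survivors, whose orbits stay at heights at least [mu]
    ([julia_survivors]). At such heights [f] expands distances inside a beam by
    the factor [kap = mu / L > 1] ([survivors_expand]), and the orbit of a
    survivor visits the interiors of upright beams only, which gives it an
    itinerary. Two survivors with one itinerary are driven apart, necessarily in
    the vertical direction, and once their heights differ by more than [4] the
    exponential growth keeps the higher one on top ([gap_step]). So the
    survivors with a given itinerary are linearly ordered by [below], with open
    initial and final segments. A connected set of survivors has one itinerary
    and is convex for this order. Hence two hairs cannot share an itinerary:
    both would lie above the other, as both reach arbitrarily high
    ([hair_charts]). From here on the topology of the Julia set is read off from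
    itineraries and the order.

    The key lemma is [crossing]: a connected set that joins a point to infinity
    passes close to all points above it in its hair, and even above nearby
    points in other hairs. It gives that a subcontinuum containing infinity
    meets every hair in a tail, so that the space is hereditarily unicoherent
    ([X_unicoherent]), and it gives one half of smoothness ([X_smooth]); the
    other half is that the itinerary and the order are locally determined. A
    finite point is not a branch point, because two of three arcs leaving it
    would leave it on the same side of its hair ([not_branch]).

    The Julia set is backward invariant because [f] is open at the points in
    question, and forward invariant because two points of one hair cannot both
    have convergent orbits ([julia_forward]). So preimages of finite ends of
    hairs are finite ends. One end, its translates by the periods of [f] and
    their preimages in all upright beams are at bounded distance from every
    survivor ([coarse_density]), and pulling back [k] times along an orbit
    improves this bound by [kap ^- k] ([bottoms_dense]); so endpoints are
    dense. *)

(** * Conformal capacity of a cube *)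

Lemma vec3_0 (R : realType) (a b c : R) : vec3 a b c 0 0 = a.
Proof. by rewrite mxE. Qed.

Lemma vec3_1 (R : realType) (a b c : R) : vec3 a b c 0 1 = b.
Proof. by rewrite mxE. Qed.

Lemma vec3_2 (R : realType) (a b c : R) : vec3 a b c 0 2 = c.
Proof. by rewrite mxE. Qed.

Lemma row3P (R : realType) (x y : 'rV[R]_3) :
  x 0 0 = y 0 0 -> x 0 1 = y 0 1 -> x 0 2 = y 0 2 -> x = y.
Proof.
move=> h0 h1 h2; apply/rowP => -[[|[|[|//]]] hi].
- by rewrite (_ : Ordinal hi = 0) //; apply/val_inj.
- by rewrite (_ : Ordinal hi = 1) //; apply/val_inj.
- by rewrite (_ : Ordinal hi = 2) //; apply/val_inj.
Qed.

Lemma ord3P (Q : 'I_3 -> Prop) : Q 0 -> Q 1 -> Q 2 -> forall i, Q i.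
Proof.
move=> h0 h1 h2 [[|[|[|//]]] hi].
- by rewrite (_ : Ordinal hi = 0) //; apply/val_inj.
- by rewrite (_ : Ordinal hi = 1) //; apply/val_inj.
- by rewrite (_ : Ordinal hi = 2) //; apply/val_inj.
Qed.

Lemma norm_row3_lt (R : realType) (x : 'rV[R]_3) (e : R) : 0 < e ->
  `|x 0 0| < e -> `|x 0 1| < e -> `|x 0 2| < e -> `|x| < e.
Proof.
move=> e0 h0 h1 h2; rewrite [ltLHS]/Num.norm /= mx_normrE; apply/bigmax_ltP.
split=> // -[i j] _ /=; rewrite (ord1 i).
by move: j; apply: ord3P.
Qed.

Lemma measurable_continuous_vec3 (R : realType) (g : 'rV[R]_3 -> R) :
  continuous g ->
  measurable_fun [set: (measurableTypeR R * measurableTypeR R) * measurableTypeR R]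
    (fun p => g (vec3 p.1.1 p.1.2 p.2)).
Proof.
move=> cg; apply: (measurability _ (RGenOpens.measurableE R)).
move=> _ [_ [a [b ->] <-]]; rewrite setTI.
set G := fun p : (R * R) * R => _.
pose oi (q : rat * rat) : set R := `](ratr q.1), (ratr q.2)[%classic.
pose box (q : (rat * rat) * (rat * rat) * (rat * rat)) : set ((R * R) * R) :=
  (oi q.1.1 `*` oi q.1.2) `*` oi q.2.
have -> : G @^-1` `]a, b[ =
    \bigcup_(q in [set q | box q `<=` G @^-1` `]a, b[]) box q.
  apply/seteqP; split; last by move=> p [q hq bp]; exact: hq.
  move=> p Gp.
  have : nbhs (vec3 p.1.1 p.1.2 p.2) (g @^-1` `]a, b[).
    apply: open_nbhs_nbhs; split => //.
    by apply: open_comp => [x _|]; [exact: cg|exact: itv_open].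
  move=> /nbhs_ballP[e /= e0 he].
  have rt (t : R) : exists q : rat * rat,
      oi q t /\ forall s, oi q s -> `|t - s| < e.
    have /rat_in_itvoo[q1] : t - e < t by rewrite ltrBlDr ltrDl.
    have /rat_in_itvoo[q2] : t < t + e by rewrite ltrDl.
    rewrite !in_itv /= => /andP[t2 h2] /andP[h1 t1].
    exists (q1, q2); split; first by rewrite /oi /= in_itv /= t1 t2.
    move=> s; rewrite /oi /= in_itv /= => /andP[s1 s2].
    by rewrite ltr_norml; apply/andP; split; lra.
  have [qa [k0 h0]] := rt p.1.1; have [qb [k1 h1]] := rt p.1.2.
  have [qc [k2 h2]] := rt p.2.
  exists (qa, qb, qc); last by split.
  move=> s /= [[s0 s1] s2]; rewrite /G /=; apply: he.
  rewrite -ball_normE /=; apply: norm_row3_lt => //; rewrite !mxE /=.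
  - exact: h0.
  - exact: h1.
  - exact: h2.
rewrite bigcup_mkcond; apply: countable_bigcupT_measurable => [|q].
  exact: countableP.
by case: ifP => // _; apply: measurableX;
  [apply: measurableX|]; exact: measurable_itv.
Qed.

(** Young's inequality in place of Hölder's: [a <= s + a^3 / s^2] turns a lower
    bound on the total variation into one on the integral of the cube. *)
Lemma cube_derivative_lower_bound (R : realType) (F f : R -> R) (a b : R) :
  a < b -> continuous f -> (forall t : R, is_derive t 1 F (f t)) ->
  1 <= F a -> F b = 0 ->
  (((b - a) ^- 2 / 8)%:E <=
     \int[@lebesgue_measure R]_(t in `[a, b]) (`|f t| ^+ 3)%:E)%E.
Proof.
move=> ab cf dF Fa Fb.
(* With this [s] the first term of Young's inequality contributes [1 / 2]. *)
pose s : R := (b - a)^-1 / 2.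
have ba0 : 0 < b - a by lra.
have s0 : 0 < s by rewrite divr_gt0 // invr_gt0.
have contF : continuous F.
  move=> t; apply: differentiable_continuous; apply/derivable1_diffP.
  by have [] := dF t.
have cont3 : continuous (fun t => `|f t| ^+ 3).
  move=> t; apply: (@continuous_comp _ _ _ (fun t => `|f t|) (fun x => x ^+ 3)).
    by apply: continuous_comp; [exact: cf|exact: norm_continuous].
  exact: exprn_continuous.
have ftc : (\int[@lebesgue_measure R]_(t in `[a, b]) (- f t)%:E
             = (- F b)%:E - (- F a)%:E)%E.
  have dmF (t : R) : is_derive t 1 (- F) (- f t) by apply: is_deriveN; exact: dF.
  apply: (@continuous_FTC2 R (fun t => - f t) (- F)) => //.
  - by apply: continuous_subspaceT => t; apply: continuousN; exact: cf.
  - split.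
    + by move=> t _; have [] := dmF t.
    + by apply: cvg_at_right_filter; apply: continuousN; exact: contF.
    + by apply: cvg_at_left_filter; apply: continuousN; exact: contF.
  - by move=> t _; rewrite derive1E; have [_ ->] := dmF t.
have muab : lebesgue_measure `[a, b]%classic = (b - a)%:E.
  by rewrite lebesgue_measure_itv /= lte_fin ab EFinN.
have mI : measurable (`[a, b]%classic : set R) by exact: measurable_itv.
have m3 : measurable_fun `[a, b]%classic (fun t => (`|f t| ^+ 3)%:E).
  apply: measurable_funTS; apply/measurable_EFinP.
  exact: continuous_measurable_fun.
have le1 : (\int[@lebesgue_measure R]_(t in `[a, b]) (- f t)%:E <=
    \int[@lebesgue_measure R]_(t in `[a, b])
       (s%:E + (s ^- 2)%:E * (`|f t| ^+ 3)%:E))%E.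
  have icont (g : R -> R) : continuous g ->
      (@lebesgue_measure R).-integrable `[a, b] (EFin \o g).
    move=> cg; apply: continuous_compact_integrable; first exact: segment_compact.
    exact: continuous_subspaceT.
  apply: le_integral => //.
  - by apply: (icont (fun t => - f t)) => t; apply: continuousN; exact: cf.
  - apply: (icont (fun t => s + s ^- 2 * `|f t| ^+ 3)) => t.
    apply: cvgD; first exact: cvg_cst.
    by apply: cvgM; [exact: cvg_cst|exact: cont3].
  move=> t _; rewrite lee_fin.
  apply: (@le_trans _ _ `|f t|); first by rewrite -normrN ler_norm.
  have [fs|sf] := leP `|f t| s.
    by rewrite (le_trans fs) // lerDl mulr_ge0 // ?invr_ge0 ?exprn_ge0 // ltW.
  apply: (@le_trans _ _ (s ^- 2 * `|f t| ^+ 3)); last by rewrite lerDr ltW.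
  rewrite mulrC ler_pdivlMr ?exprn_gt0 // [_ ^+ 3]exprS ler_wpM2l //.
  by rewrite lerXn2r ?nnegrE // ltW.
move: le1; rewrite ftc Fb oppr0 sub0e -EFinN opprK.
rewrite ge0_integralD //; last 3 first.
  - by move=> t _; rewrite lee_fin ltW.
  - by move=> t _; rewrite lee_fin mulr_ge0 ?exprn_ge0 // invr_ge0 exprn_ge0 // ltW.
  - exact: measurable_funeM.
rewrite integral_cst // ge0_integralZl_EFin //; last first.
  by rewrite invr_ge0 exprn_ge0 // ltW.
rewrite /= muab => le2.
have : (1%:E <= s%:E * (b - a)%:E + (s ^- 2)%:E *
   \int[@lebesgue_measure R]_(x in `[a, b]) (`|f x| ^+ 3)%:E)%E.
  by apply: le_trans le2; rewrite lee_fin.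
have -> : (s%:E * (b - a)%:E = (2^-1)%:E :> \bar R)%E.
  by rewrite -EFinM /s; congr EFin; field; rewrite gt_eqF.
set I := integral _ _ _.
have : (0 <= I)%E by apply: integral_ge0 => t _; rewrite lee_fin exprn_ge0.
case: I => [r| |//]; rewrite ?leey //.
rewrite -EFinM -EFinD !lee_fin => r0.
rewrite -lerBlDl => hr.
have -> : (b - a) ^- 2 / 8 = s ^+ 2 / 2.
  by rewrite /s; field; rewrite gt_eqF.
have : s ^+ 2 * (1 - 2^-1) <= s ^+ 2 * (s ^- 2 * r) by rewrite ler_wpM2l // exprn_ge0 // ltW.
by rewrite mulrA divff ?mul1r ?expf_neq0 ?gt_eqF //; lra.
Qed.

Lemma enorm_ge0 (R : realType) n (x : 'rV[R]_n) : 0 <= enorm x.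
Proof. exact: sqrtr_ge0. Qed.

Lemma sqr_enorm (R : realType) n (x : 'rV[R]_n) :
  enorm x ^+ 2 = \sum_(i < n) x 0 i ^+ 2.
Proof. by rewrite sqr_sqrtr // sumr_ge0 // => i _; exact: sqr_ge0. Qed.

Lemma sqr_enorm3 (R : realType) (x : 'rV[R]_3) :
  enorm x ^+ 2 = x 0 0 ^+ 2 + x 0 1 ^+ 2 + x 0 2 ^+ 2.
Proof.
rewrite sqr_enorm !big_ord_recl big_ord0 addr0 addrA.
by congr (_ ^+ 2 + _ ^+ 2 + _ ^+ 2); congr (x 0 _); apply/val_inj.
Qed.

Lemma coord_le_enorm (R : realType) n (x : 'rV[R]_n) i : `|x 0 i| <= enorm x.
Proof.
rewrite -(@ler_pXn2r _ 2) ?nnegrE ?enorm_ge0 // real_normK ?num_real //.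
rewrite sqr_enorm (bigD1 i) //= lerDl sumr_ge0 // => j _; exact: sqr_ge0.
Qed.

Definition cube (R : realType) (c : R) : set 'rV[R]_3 :=
  [set x | forall i, c <= x 0 i <= c + 1].

Lemma compact_cube (R : realType) (c : R) : compact (cube c).
Proof.
have -> : cube c = [set v : 'rV[R]_3 | forall i, `[c, c + 1]%classic (v ord0 i)].
  by apply/seteqP; split => v hv i; move: (hv i); rewrite /= in_itv.
apply: (@rV_compact _ _ (fun=> `[c, c + 1]%classic)) => _.
exact: segment_compact.
Qed.

Lemma is_derive_vec3_2 (R : realType) (u : 'rV[R]_3 -> R) (a b t : R) :
  derivable u (vec3 a b t) (delta_mx 0 2) ->
  is_derive t 1 (fun s => u (vec3 a b s)) (partial 2 u (vec3 a b t)).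
Proof.
move=> du.
have E : (fun h : R => h^-1 *: (u (vec3 a b (h *: 1 + t)) - u (vec3 a b t))) =
         (fun h : R => h^-1 *: (u (h *: delta_mx 0 2 + vec3 a b t) - u (vec3 a b t))).
  apply/funext => h; congr (_ *: (u _ - _)).
  by apply: row3P; rewrite !mxE /= ?mulr0 ?add0r ?scaler1 ?mulr1.
by apply: DeriveDef; rewrite /partial /derivable /derive /= E.
Qed.

Lemma coord_le_norm (R : realType) n (x : 'rV[R]_n) i : `|x 0 i| <= `|x|.
Proof.
by rewrite [leRHS]/Num.norm /= mx_normrE; apply/bigmax_geP; right; exists (0, i).
Qed.

Lemma cvg_row3 (R : realType) (T : Type) (F : set_system T) {FF : Filter F}
    (f : T -> 'rV[R]_3) (l : 'rV[R]_3) :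
  (forall i, f t 0 i @[t --> F] --> l 0 i) -> f @ F --> l.
Proof.
move=> h; apply/cvgrPdist_lt => e e0.
have hi i : \forall t \near F, `|l 0 i - f t 0 i| < e.
  by move/cvgrPdist_lt: (h i); apply.
near=> t; apply: norm_row3_lt => //; rewrite !mxE; near: t; exact: hi.
Unshelve. all: by end_near. Qed.

Lemma enorm_continuous (R : realType) : continuous (@enorm R 3).
Proof.
have -> : @enorm R 3 = (fun x => Num.sqrt (x 0 0 ^+ 2 + x 0 1 ^+ 2 + x 0 2 ^+ 2)).
  by apply/funext => x; rewrite -sqr_enorm3 sqrtr_sqr ger0_norm ?enorm_ge0.
move=> x; apply: (@continuous_comp _ _ _
  (fun y : 'rV[R]_3 => y 0 0 ^+ 2 + y 0 1 ^+ 2 + y 0 2 ^+ 2) Num.sqrt);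
  last exact: sqrt_continuous.
have c i : {for x, continuous (fun y : 'rV[R]_3 => y 0 i ^+ 2)}.
  apply: (@continuous_comp _ _ _ (fun y : 'rV[R]_3 => y 0 i) (fun y => y ^+ 2)).
    exact: coord_continuous.
  exact: exprn_continuous.
exact: (cvgD (cvgD (c 0) (c 1)) (c 2)).
Qed.

Lemma measure_unit_square (R : realType) (c : R) :
  (@lebesgue_measure R \x @lebesgue_measure R)%E
     (`[c, c + 1]%classic `*` `[c, c + 1]%classic) = 1%E.
Proof.
have mu1 : (@lebesgue_measure R) `[c, c + 1]%classic = 1%E.
  by rewrite lebesgue_measure_itv /= lte_fin ltrDl ltr01 -EFinD addrAC subrr add0r.
by rewrite product_measure1E //= mu1 mule1.
Qed.

(** Lebesgue measure of the plane, under a name of its own so that it can carry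
    the structure of a sigma-finite measure. *)
Definition plane_measure (R : realType) :
    set (measurableTypeR R * measurableTypeR R)%type -> \bar R :=
  (@lebesgue_measure R \x @lebesgue_measure R)%E.

HB.instance Definition _ (R : realType) :=
  Measure.copy (@plane_measure R) (@lebesgue_measure R \x @lebesgue_measure R)%E.

Lemma plane_measure_sigma_finite (R : realType) :
  sigma_finite setT (@plane_measure R).
Proof.
have /sigma_finiteP[F [TF ndF Foo]] := sigma_finiteT (@lebesgue_measure R).
exists (fun n => F n `*` F n).
  rewrite -setXTT TF predeqE => -[x y]; split; last first.
    by move=> [n _ []/= ? ?]; split; exists n.
  move=> [/= [n _ Fnx] [k _ Fky]]; exists (maxn n k) => //; split.
    by move: x Fnx; exact/subsetPset/ndF/leq_maxl.
  by move: y Fky; exact/subsetPset/ndF/leq_maxr.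
move=> k; have [mF Fk] := Foo k; split; first exact: measurableX.
by rewrite /plane_measure product_measure1E// lte_mul_pinfty// ge0_fin_numE.
Qed.

HB.instance Definition _ (R : realType) :=
  Measure_isSigmaFinite.Build _ _ _ (@plane_measure R) (@plane_measure_sigma_finite R).

Lemma tonelli3 (R : realType) (g : (R * R) * R -> \bar R) :
  measurable_fun
    [set: (measurableTypeR R * measurableTypeR R) * measurableTypeR R] g ->
  (forall p, 0 <= g p)%E ->
  (\int[(@lebesgue_measure R \x @lebesgue_measure R) \x @lebesgue_measure R]_p g p =
  \int[@lebesgue_measure R \x @lebesgue_measure R]_q 
     \int[@lebesgue_measure R]_t g (q, t))%E.
Proof.
move=> mg g0.


exact: (@fubini_tonelli1 _ _ _ _ R (@plane_measure R) lebesgue_measure g mg g0).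
Qed.

(** On each vertical line that meets the cube, a test function drops from at
    least [1] to [0] within a length bounded in terms of the bounded set that
    carries its support, so the cube of its vertical derivative has an integral
    bounded below; Tonelli's theorem sums this over the base of the cube. *)
Lemma cube_positive_capacity (R : realType) (c : R) :
  ~ compact_cap_zero (cube c).
Proof.
move=> [A [oA [B [Breal hB]] FA]].
have [b [bB bc]] : exists b, B + 1 < b /\ c + 1 < b.
  exists (Num.max (B + 1) (c + 1) + 1).
  by split; rewrite ltr_pwDr // le_max lexx ?orbT.
pose k : R := (b - c) ^- 2 / 8.
have k0 : 0 < k by rewrite divr_gt0 // invr_gt0 exprn_gt0 //; lra.
move/eqP; apply/negP; rewrite gt_eqF //.
apply: (@lt_le_trans _ _ k%:E); first by rewrite lte_fin.
apply: le_ereal_inf_tmp => _ [u [[su _ suppu] u1] <-].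
have uout p q : u (vec3 p q b) = 0.
  have nA : ~ A (vec3 p q b).
    move=> Ab; have := hB (B + 1); rewrite ltrDl ltr01 => /(_ isT _ Ab) /=.
    have := coord_le_norm (vec3 p q b) 2; rewrite vec3_2.
    by move=> h1 h2; have := ler_norm b; lra.
  apply/eqP; apply: contra_notT nA => ux.
  by apply: suppu; exact: subset_closure.
have cpart i : continuous (partial i u) by have [] := su [:: i].
have cgrad : continuous (fun x => enorm (gradient u x) ^+ 3).
  move=> x; apply: (@continuous_comp _ _ _ (gradient u) (fun y => enorm y ^+ 3)).
    by apply: (@cvg_row3 _ _ (nbhs x)) => i; rewrite mxE; under eq_fun do rewrite mxE; exact: cpart.
  apply: (@continuous_comp _ _ _ (@enorm R 3) (fun y => y ^+ 3)).
    exact: enorm_continuous.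
  exact: exprn_continuous.
have mg := measurable_continuous_vec3 cgrad.
have g0 (p : (R * R) * R) :
    (0 <= (enorm (gradient u (vec3 p.1.1 p.1.2 p.2)) ^+ 3)%:E)%E.
  by rewrite lee_fin exprn_ge0 // enorm_ge0.
have mgE : measurable_fun [set: (measurableTypeR R * measurableTypeR R) * measurableTypeR R]
    (fun p => (enorm (gradient u (vec3 p.1.1 p.1.2 p.2)) ^+ 3)%:E).
  exact/measurable_EFinP.
rewrite /conformal_energy (tonelli3 mgE g0).
pose S : set (R * R) := `[c, c + 1]%classic `*` `[c, c + 1]%classic.
have mS : measurable S by apply: measurableX; exact: measurable_itv.
pose G (q : R * R) := (\int[@lebesgue_measure R]_t
  (enorm (gradient u (vec3 q.1 q.2 t)) ^+ 3)%:E)%E.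
have G0 q : (0 <= G q)%E.
  by apply: integral_ge0 => t _; rewrite lee_fin exprn_ge0 // enorm_ge0.
have mG : measurable_fun [set: measurableTypeR R * measurableTypeR R] G.
  exact: (@measurable_fun_fubini_tonelli_F _ _ _ _ R
    (@lebesgue_measure R) _ mgE g0).
apply: (@le_trans _ _ (\int[(@lebesgue_measure R \x @lebesgue_measure R)%E]_(q in S) G q)%E);
  last by apply: ge0_subset_integral.
apply: (@le_trans _ _ (\int[(@lebesgue_measure R \x @lebesgue_measure R)%E]_(q in S) k%:E)%E).
  by rewrite integral_cst // [X in (_ * X)%E](measure_unit_square c) mule1.
apply: ge0_le_integral => //.
- by move=> q _; rewrite lee_fin ltW.
- exact: measurable_funTS.
move=> q [/= q1 q2].
pose v t := vec3 q.1 q.2 t.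
have mv : measurable_fun setT (fun t => (enorm (gradient u (v t)) ^+ 3)%:E).
  apply/measurable_EFinP.
  exact: (measurableT_comp mg (measurable_pair1 _)).
rewrite /G.
apply: (@le_trans _ _
  (\int[@lebesgue_measure R]_(t in `[c, b]) (enorm (gradient u (v t)) ^+ 3)%:E)%E);
  last first.
  apply: ge0_subset_integral => //.
  by move=> t _; rewrite lee_fin exprn_ge0 // enorm_ge0.
have cv : continuous v.
  move=> t; apply: (@cvg_row3 _ _ (nbhs t)); apply: ord3P; rewrite /v.
  - by rewrite vec3_0; under eq_fun do rewrite vec3_0; exact: cvg_cst.
  - by rewrite vec3_1; under eq_fun do rewrite vec3_1; exact: cvg_cst.
  - by rewrite vec3_2; under eq_fun do rewrite vec3_2; exact: cvg_id.
have cf : continuous (fun t => partial 2 u (v t)).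
  by move=> t; apply: (@continuous_comp _ _ _ v); [exact: cv|exact: cpart].
apply: le_trans (cube_derivative_lower_bound (F := fun t => u (v t)) _ cf _ _ _) _.
- by lra.
- by move=> t; apply: is_derive_vec3_2; have [_] := su [::]; apply.
- apply: u1; apply: ord3P; rewrite ?vec3_0 ?vec3_1 ?vec3_2.
  + by move: q1; rewrite in_itv.
  + by move: q2; rewrite in_itv.
  + by rewrite lexx lerDl ler01.
- exact: uout.
apply: ge0_le_integral => //.
- apply/measurable_EFinP; apply: measurable_funTS.
  apply: continuous_measurable_fun => t.
  apply: (@continuous_comp _ _ _ (fun t => `|partial 2 u (v t)|) (fun x => x ^+ 3)).
    by apply: continuous_comp; [exact: cf|exact: norm_continuous].
  exact: exprn_continuous.
- exact: measurable_funTS.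
move=> t _; rewrite lee_fin lerXn2r ?nnegrE ?enorm_ge0 //.
by have := coord_le_enorm (gradient u (v t)) 2; rewrite mxE.
Qed.

(** * Beams *)

Lemma sqr_enorm2 (R : realType) (x : 'rV[R]_2) :
  enorm x ^+ 2 = x 0 0 ^+ 2 + x 0 1 ^+ 2.
Proof.
rewrite sqr_enorm !big_ord_recl big_ord0 addr0.
by congr (_ ^+ 2 + _ ^+ 2); congr (x 0 _); apply/val_inj.
Qed.

Lemma vec2_0 (R : realType) (a b : R) : vec2 a b 0 0 = a.
Proof. by rewrite mxE. Qed.

Lemma vec2_1 (R : realType) (a b : R) : vec2 a b 0 1 = b.
Proof. by rewrite mxE. Qed.

Lemma sign_sqr (R : realType) (n : int) : ((-1) ^ n) ^+ 2 = 1 :> R.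
Proof. by rewrite expr2 -expfzMl mulrNN mulr1 exp1rz. Qed.

Lemma sign_cases (R : realType) (n : int) :
  (-1) ^ n = 1 :> R \/ (-1) ^ n = -1 :> R.
Proof.
have /eqP := sign_sqr R n; rewrite sqrf_eq1 => /orP[/eqP|/eqP]; tauto.
Qed.

Lemma norm_sign (R : realType) (n : int) : `|(-1) ^ n| = 1 :> R.
Proof. by case: (sign_cases R n) => ->; rewrite ?normrN normr1. Qed.

(** The law of cosines, arranged as the sum of a radial and an angular square:
    the map treats these two parts separately. *)
Lemma polar_distance (R : realType) (p0 p1 p2 q0 q1 q2 a b : R) :
  p0 ^+ 2 + p1 ^+ 2 + p2 ^+ 2 = 1 -> q0 ^+ 2 + q1 ^+ 2 + q2 ^+ 2 = 1 ->
  (a * p0 - b * q0) ^+ 2 + (a * p1 - b * q1) ^+ 2 + (a * p2 - b * q2) ^+ 2 =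
  (a - b) ^+ 2 + a * b * ((p0 - q0) ^+ 2 + (p1 - q1) ^+ 2 + (p2 - q2) ^+ 2).
Proof.
move=> hp hq.
have -> : (a * p0 - b * q0) ^+ 2 + (a * p1 - b * q1) ^+ 2 + (a * p2 - b * q2) ^+ 2
  = a ^+ 2 * (p0 ^+ 2 + p1 ^+ 2 + p2 ^+ 2) + b ^+ 2 * (q0 ^+ 2 + q1 ^+ 2 + q2 ^+ 2)
   - 2 * a * b * (p0 * q0 + p1 * q1 + p2 * q2) by ring.
have -> : (p0 - q0) ^+ 2 + (p1 - q1) ^+ 2 + (p2 - q2) ^+ 2 =
  (p0 ^+ 2 + p1 ^+ 2 + p2 ^+ 2) + (q0 ^+ 2 + q1 ^+ 2 + q2 ^+ 2)
   - 2 * (p0 * q0 + p1 * q1 + p2 * q2) by ring.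
by rewrite hp hq; ring.
Qed.

Lemma expR_increment (R : realType) (s t : R) :
  s <= t -> expR s * (t - s) <= expR t - expR s <= expR t * (t - s).
Proof.
move=> st; apply/andP; split.
  have -> : expR t = expR s * expR (t - s) by rewrite -expRD; congr expR; ring.
  rewrite (_ : expR s * expR (t - s) - expR s = expR s * (expR (t - s) - 1)); last by ring.
  rewrite ler_wpM2l ?expR_ge0 //.
  by have := expR_ge1Dx (t - s); lra.
have -> : expR s = expR t * expR (s - t) by rewrite -expRD; congr expR; ring.
rewrite (_ : expR t - expR t * expR (s - t) = expR t * (1 - expR (s - t))); last by ring.
rewrite ler_wpM2l ?expR_ge0 //.
by have := expR_ge1Dx (s - t); lra.
Qed.

Definition in_beam (R : realType) (n m : int) : set 'rV[R]_3 :=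
  [set x | `|x 0 0 - 2 * n%:~R| <= 1 /\ `|x 0 1 - 2 * m%:~R| <= 1].

Definition open_beam (R : realType) (n m : int) : set 'rV[R]_3 :=
  [set x | `|x 0 0 - 2 * n%:~R| < 1 /\ `|x 0 1 - 2 * m%:~R| < 1].

Definition beam_index (R : realType) (x : 'rV[R]_3) : int * int :=
  (Num.floor ((x 0 0 + 1) / 2), Num.floor ((x 0 1 + 1) / 2)).

Lemma open_beam_sub (R : realType) n m : @open_beam R n m `<=` @in_beam R n m.
Proof. by move=> x [/ltW ? /ltW ?]. Qed.

Lemma floor_half (R : realType) (t : R) (n : int) :
  `|t - 2 * n%:~R| < 1 -> Num.floor ((t + 1) / 2) = n.
Proof.
rewrite ltr_norml => /andP[h1 h2]; apply/floor_def.
by rewrite intrD; apply/andP; split; lra.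
Qed.

Lemma floor_half_le (R : realType) (t : R) :
  `|t - 2 * (Num.floor ((t + 1) / 2))%:~R| <= 1.
Proof.
have /andP[h1 h2] := floor_itv ((t + 1) / 2).
by move: h2; rewrite intrD ler_norml => h2; apply/andP; split; lra.
Qed.

Lemma beam_index_in (R : realType) (x : 'rV[R]_3) :
  in_beam (beam_index x).1 (beam_index x).2 x.
Proof. by split; exact: floor_half_le. Qed.

Lemma beam_indexE (R : realType) n m (x : 'rV[R]_3) :
  open_beam n m x -> beam_index x = (n, m).
Proof. by move=> [h1 h2]; congr (_, _); exact: floor_half. Qed.

Lemma coord_dist_continuous (R : realType) (i : 'I_3) (c : R) :
  continuous (fun x : 'rV[R]_3 => `|x 0 i - c|).
Proof.
move=> x; apply: (@continuous_comp _ _ _ (fun x : 'rV[R]_3 => x 0 i - c)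
  (fun y => `|y|)); last exact: norm_continuous.
by apply: (@cvgB _ _ _ (nbhs x)); [exact: coord_continuous|exact: cvg_cst].
Qed.

Lemma open_open_beam (R : realType) n m : open (@open_beam R n m).
Proof.
rewrite (_ : open_beam n m = [set x : 'rV[R]_3 | `|x 0 0 - 2 * n%:~R| < 1] `&`
   [set x : 'rV[R]_3 | `|x 0 1 - 2 * m%:~R| < 1]) //.
by apply: openI; [apply: (@open_comp _ _ _ [set t : R | t < 1])|
   apply: (@open_comp _ _ _ [set t : R | t < 1])];
   [move=> x _; exact: coord_dist_continuous|exact: open_lt
   |move=> x _; exact: coord_dist_continuous|exact: open_lt].
Qed.

Lemma closed_in_beam (R : realType) n m : closed (@in_beam R n m).
Proof.
rewrite (_ : in_beam n m = [set x : 'rV[R]_3 | `|x 0 0 - 2 * n%:~R| <= 1] `&`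
   [set x : 'rV[R]_3 | `|x 0 1 - 2 * m%:~R| <= 1]) //.
by apply: closedI; [apply: (@closed_comp _ _ _ [set t : R | t <= 1])|
   apply: (@closed_comp _ _ _ [set t : R | t <= 1])];
   [move=> x _; exact: coord_dist_continuous|exact: closed_le
   |move=> x _; exact: coord_dist_continuous|exact: closed_le].
Qed.

(** One coordinate of the fact that nearby points share a closed beam, on which
    a single formula defines the map; hence its continuity across the walls. *)
Lemma common_interval (R : realType) (t : R) :
  exists2 d : R, 0 < d & forall s, `|t - s| < d ->
    exists n : int, `|t - 2 * n%:~R| <= 1 /\ `|s - 2 * n%:~R| <= 1.
Proof.
have /andP[h1 h2] := floor_itv ((t + 1) / 2).
set n := Num.floor _ in h1 h2; move: h2; rewrite intrD => h2.
have [e|ne] := eqVneq t (2 * n%:~R - 1).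
  exists 1 => // s; rewrite ltr_norml => /andP[h3 h4].
  have [ts|st] := leP t s.
    by exists n; rewrite !ler_norml; split; apply/andP; split; lra.
  exists (n - 1); rewrite !ler_norml intrB.
  by split; apply/andP; split; lra.
have lt1 : 2 * n%:~R - 1 < t by rewrite lt_neqAle eq_sym ne /=; lra.
exists (Num.min (t - (2 * n%:~R - 1)) (2 * n%:~R + 1 - t)).
  by rewrite lt_min; apply/andP; split; lra.
move=> s; rewrite lt_min !ltr_norml => /andP[/andP[h3 h4] /andP[h5 h6]].
by exists n; rewrite !ler_norml; split; apply/andP; split; lra.
Qed.

Lemma norm_le_enorm (R : realType) (x : 'rV[R]_3) : `|x| <= enorm x.
Proof.
rewrite [leLHS]/Num.norm /= mx_normrE; apply/bigmax_leP; split.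
  exact: enorm_ge0.
by move=> -[i j] _ /=; rewrite (ord1 i); exact: coord_le_enorm.
Qed.

Lemma enorm_le_norm (R : realType) (x : 'rV[R]_3) : enorm x <= 2 * `|x|.
Proof.
have n0 : 0 <= `|x| by [].
rewrite -(@ler_pXn2r _ 2) ?nnegrE ?enorm_ge0 ?mulr_ge0 // sqr_enorm3.
have c i : x 0 i ^+ 2 <= `|x| ^+ 2.
  by rewrite -[leLHS]real_normK ?num_real // lerXn2r ?nnegrE // coord_le_norm.
by have [c0 c1] := (c 0, c 1); have c2 := c 2; nra.
Qed.

Lemma enorm_eq0 (R : realType) (x : 'rV[R]_3) : enorm x = 0 -> x = 0.
Proof.
by move=> e; apply/eqP; rewrite -normr_le0 -e norm_le_enorm.
Qed.

Lemma enormN (R : realType) (x : 'rV[R]_3) : enorm (- x) = enorm x.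
Proof.
by congr Num.sqrt; apply: eq_bigr => i _; rewrite mxE sqrrN.
Qed.

Lemma norm_row3_le (R : realType) (x : 'rV[R]_3) (e : R) : 0 <= e ->
  `|x 0 0| <= e -> `|x 0 1| <= e -> `|x 0 2| <= e -> `|x| <= e.
Proof.
move=> e0 h0 h1 h2; rewrite [leLHS]/Num.norm /= mx_normrE; apply/bigmax_leP.
split=> // -[i j] _ /=; rewrite (ord1 i).
by move: j; apply: ord3P.
Qed.

(** * The one-point compactification of space *)

Lemma within_continuousP (T U : topologicalType) (A : set T) (g : T -> U) :
  {within A, continuous g} <->
  (forall t, A t -> forall W, nbhs (g t) W -> \forall s \near t, A s -> W (g s)).
Proof.
split=> [cg t At W gW|h].
  have : within A (nbhs t) (g @^-1` W) by rewrite nbhs_subspace_in //; exact: cg.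
  by [].
rewrite continuous_subspace_in => t /set_mem At W gW.
have : within A (nbhs t) (g @^-1` W) by exact: h.
by rewrite nbhs_subspace_in.
Qed.

Lemma within_continuous_eq (T U : topologicalType) (A : set T) (g g' : T -> U) :
  (forall t, A t -> g t = g' t) ->
  {within A, continuous g} -> {within A, continuous g'}.
Proof.
move=> e /within_continuousP cg; apply/within_continuousP => t At W.
rewrite -e // => gW; apply: filterS (cg t At W gW) => s + As.
by rewrite e //; apply.
Qed.

Lemma within_continuous_comp_in (T U V : topologicalType) (A : set V) (B : set T)
    (g : T -> U) (p : V -> T) :
  (forall s, A s -> B (p s)) -> {within A, continuous p} ->
  {within B, continuous g} -> {within A, continuous (g \o p)}.
Proof.
move=> AB /within_continuousP cp /within_continuousP cg.
apply/within_continuousP => s As W gW.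
have := cp s As _ (cg _ (AB s As) W gW).
by apply: filterS => s' h As'; apply: h => //; exact: AB.
Qed.

Section OnePointMetric.
Variable R : realType.
Local Notation opc := (one_point_compactification 'rV[R]_3).

Definition inf_dist (x : 'rV[R]_3) : R := (1 + `|x|)^-1.

(** Either go straight, or through infinity, which lies at distance
    [1 / (1 + |x|)] from [x]; the triangle inequality holds because this last
    function is 1-Lipschitz. *)
Definition opc_dist (p q : opc) : R :=
  match p, q with
  | Some x, Some y => Num.min `|x - y| (inf_dist x + inf_dist y)
  | Some x, None => inf_dist x
  | None, Some y => inf_dist y
  | None, None => 0
  end.

Lemma inf_dist_gt0 x : 0 < inf_dist x.
Proof. by rewrite invr_gt0 ltr_pwDl. Qed.

Lemma inf_dist_lt x (M : R) : 0 < M -> (inf_dist x < M) = (M^-1 < 1 + `|x|).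
Proof.
by move=> M0; rewrite /inf_dist invf_plt ?posrE // ltr_pwDl.
Qed.

Lemma inf_dist_lipschitz x y : inf_dist x <= inf_dist y + `|x - y|.
Proof.
have px : 1 <= 1 + `|x| by rewrite lerDl.
have py : 1 <= 1 + `|y| by rewrite lerDl.
rewrite -lerBlDl /inf_dist.
have -> : (1 + `|x|)^-1 - (1 + `|y|)^-1 =
    (`|y| - `|x|) / ((1 + `|x|) * (1 + `|y|)).
  by field; rewrite !gt_eqF //; lra.
have tr : `|y| - `|x| <= `|x - y|.
  by have := ler_normD (y - x) x; rewrite subrK distrC; lra.
rewrite ler_pdivrMr; last by apply: mulr_gt0; lra.
apply: le_trans tr _; rewrite ler_peMr //; nra.
Qed.

Lemma opc_dist_triangle p q r : opc_dist p r <= opc_dist p q + opc_dist q r.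
Proof.
have w0 x := inf_dist_gt0 x.
case: p q r => [x|] [y|] [z|] /=.
- have := inf_dist_lipschitz x y; have := inf_dist_lipschitz z y.
  have := w0 y; rewrite [`|z - y|]distrC.
  have tr : `|x - z| <= `|x - y| + `|y - z|.
    by have := ler_normD (x - y) (y - z); rewrite addrA subrK.
  rewrite ge_min; case: (leP `|x - y| (inf_dist x + inf_dist y)) => h1;
    case: (leP `|y - z| (inf_dist y + inf_dist z)) => h2; lra.
- have := inf_dist_lipschitz x y; have := w0 y.
  by case: (leP `|x - y| (inf_dist x + inf_dist y)) => h1; lra.
- by rewrite ge_min lexx orbT.
- by rewrite addr0.
- have := inf_dist_lipschitz z y; rewrite distrC; have := w0 y.
  by case: (leP `|y - z| (inf_dist y + inf_dist z)) => h1; lra.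
- by have := w0 y; lra.
- by rewrite add0r.
- by rewrite addr0.
Qed.

Lemma opc_dist_sym p q : opc_dist p q = opc_dist q p.
Proof. by case: p q => [x|] [y|] //=; rewrite distrC (addrC (inf_dist x)). Qed.

Lemma opc_dist_eq0 p q : opc_dist p q = 0 <-> p = q.
Proof.
have w0 x := inf_dist_gt0 x.
split=> [|->]; last first.
  by case: q => //= x; rewrite subrr normr0; apply/min_idPl; rewrite addr_ge0 // ltW.
case: p q => [x|] [y|] //=.
- case: leP => [_ /eqP|_ h]; last by exfalso; have := w0 x; have := w0 y; lra.
  by rewrite normr_eq0 subr_eq0 => /eqP ->.
- by move=> e; have := w0 x; rewrite e ltxx.
- by move=> e; have := w0 y; rewrite e ltxx.
Qed.

Lemma opc_nbhsE p (B : set opc) :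
  nbhs p B <-> exists2 e : R, 0 < e & forall q, opc_dist p q < e -> B q.
Proof.
case: p => [x|]; split.
- move=> /= /nbhs_ballP[r /= r0 rB]; exists (Num.min r (inf_dist x)).
    by rewrite lt_min r0 inf_dist_gt0.
  case=> [y|] /=; rewrite lt_min; last by rewrite ltxx andbF.
  have w0 := inf_dist_gt0 y.
  case: (leP `|x - y| (inf_dist x + inf_dist y)) => [_ /andP[h _]|_ /andP[_ h2]];
    last by exfalso; lra.
  by apply: rB; rewrite -ball_normE.
- move=> [e e0 eB]; apply/nbhs_ballP; exists e => //= y; rewrite -ball_normE /= => xy.
  by apply: eB; rewrite /= gt_min xy.
- move=> [U [cU _] UB]; have [M [_ hM]] := compact_bounded cU.
  pose m := Num.max M 0 + 1.
  have m0 : 0 < m by rewrite ltr_pwDr // le_max lexx orbT.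
  have Mm : M < m by rewrite ltr_pwDr // le_max lexx.
  exists (1 + m)^-1; first by rewrite invr_gt0 ltr_pwDl // ltW.
  case=> [y|] /= h; apply: UB; last by right.
  left; exists y => //= Uy; have := hM m Mm y Uy => /= ym.
  move: h; rewrite inf_dist_lt ?invr_gt0; last by lra.
  by rewrite invrK; lra.
- move=> [e e0 eB]; exists [set y | `|y| <= e^-1].
    have cl : closed [set y : 'rV[R]_3 | `|y| <= e^-1].
      apply: (@closed_comp _ _ (fun y : 'rV[R]_3 => `|y|) [set t | t <= e^-1]).
        by move=> y _; exact: norm_continuous.
      exact: closed_le.
    split => //; apply: bounded_closed_compact => //.
    exists e^-1; split; first exact: num_real.
    by move=> M eM y /= ye; rewrite (le_trans ye) // ltW.
  move=> q [[y /= /negP ye <-]|->]; apply: eB => //=.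
  by rewrite inf_dist_lt //; move: ye; rewrite -ltNge; lra.
Qed.

Lemma opc_metrizes (X : set opc) : metrizes X opc_dist.
Proof.
split.
- by move=> p q _ _; exact: opc_dist_eq0.
- by move=> p q _ _; exact: opc_dist_sym.
- by move=> p q r _ _ _; exact: opc_dist_triangle.
- move=> p Xp A; split.
    move=> /opc_nbhsE[e e0 he]; exists e => // q Xq pq; exact: he.
  by move=> [e e0 he]; apply/opc_nbhsE; exists e => // q pq Xq; exact: he.
Qed.

Lemma opc_hausdorff : hausdorff_space opc.
Proof.
move=> p q cl; apply/opc_dist_eq0/eqP; rewrite eq_le; apply/andP; split.
  rewrite leNgt; apply/negP => pq.
  pose e := opc_dist p q / 2; have e0 : 0 < e by rewrite divr_gt0.
  have [r [/= h1 h2]] : [set r | opc_dist p r < e] `&` [set r | opc_dist q r < e] !=set0.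
    by apply: cl; apply/opc_nbhsE; exists e.
  have := opc_dist_triangle p r q; rewrite (opc_dist_sym r) /e in h1 h2 *; lra.
have := opc_dist_triangle p q p; rewrite (opc_dist_sym q).
by rewrite (opc_dist_eq0 p p).2 //; lra.
Qed.

Lemma opc_compact (J : set 'rV[R]_3) : closed J ->
  compact (Some @` J `|` [set None] : set opc).
Proof.
move=> cJ; apply: subclosed_compact one_point_compactification_compact _ => //.
rewrite -[X in closed X]setCK; apply: open_closedC.
rewrite (_ : ~` _ = Some @` (~` J)).
  exact/one_point_compactification_open_some/closed_openC.
apply/seteqP; split => [[x|]|_ [x nJx <-] [[y Jy [yx]]|//]] /=.
- by move=> h; exists x => // Jx; apply: h; left; exists x.
- by move=> h; exfalso; apply: h; right.
- by apply: nJx; rewrite -yx.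
Qed.

Lemma opc_connected_preimage (K : set opc) :
  connected K -> ~ K None -> connected [set x | K (Some x)].
Proof.
move=> cK nK B [b Bb] [V oV BV] [C cC BC].
have E : (Some @` B : set opc) = K.
  apply: cK; first by exists (Some b); exists b.
  - exists (Some @` V); first exact: one_point_compactification_open_some.
    apply/seteqP; split => [_ [x Bx <-]|y [Ky [x Vx xy]] ].
      by move: Bx; rewrite BV => -[Kx Vx]; split => //; exists x.
    by exists x => //; rewrite BV; split => //=; rewrite xy.
  - exists (~` (Some @` (~` C))).
      exact/open_closedC/one_point_compactification_open_some/closed_openC.
    apply/seteqP; split => [_ [x Bx <-]|[x|] [Kx] /= h] //.
      move: Bx; rewrite BC => -[Kx Cx]; split => // -[y nC [yx]].
      by apply: nC; rewrite yx.
    exists x => //; rewrite BC; split => //.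
    by apply: contrapT => nC; apply: h; exists x.
apply/seteqP; split => [x Bx|x /= Kx]; first by rewrite -E; exists x.
by move: Kx; rewrite -E => -[y By [<-]].
Qed.

Lemma cvg_up_None (T : Type) (F : set_system T) {FF : Filter F} (g : T -> 'rV[R]_3) :
  g t 0 2 @[t --> F] --> +oo -> (Some (g t) : opc) @[t --> F] --> (None : opc).
Proof.
move=> /cvgryPgt up W [U [cU _] UW]; have [M [_ hM]] := compact_bounded cU.
have := up (M + 1); apply: filterS => t Mt; apply: UW; left; exists (g t) => // Ut.
have := hM (M + 1); rewrite ltrDl ltr01 => /(_ isT _ Ut) /= h1.
have := coord_le_norm (g t) 2; have := ler_norm (g t 0 2).
by move=> h2 h3; move: Mt; rewrite ltNge => /negP; apply; lra.
Qed.

End OnePointMetric.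

(** * Arcs *)

Lemma connected_pairs (T : topologicalType) (B : set T) :
  (forall a b, B a -> B b -> exists C, [/\ connected C, C `<=` B, C a & C b]) ->
  connected B.
Proof.
move=> h; have [->|/set0P[a Ba]] := eqVneq B set0; first exact: connected0.
suff <- : connected_component B a = B by exact: component_connected.
apply/seteqP; split; first exact: connected_component_sub.
by move=> b Bb; have [C [cC CB Ca Cb]] := h a b Ba Bb; exists C.
Qed.

Section Arcs.
Variable R : realType.

Lemma unit_itvE (t : R) : (`[0, 1]%classic : set R) t <-> 0 <= t <= 1.
Proof. by rewrite /= in_itv. Qed.

(** In a Hausdorff space an arc is the image of [0, 1] by any injective
    continuous map: the inverse is continuous because images of compact sets
    are closed. *)
Lemma arcP (T : topologicalType) (A : set T) (x y : T) : hausdorff_space T ->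
  is_arc R A x y <-> exists g : R -> T,
   [/\ {within `[0, 1], continuous g},
       forall s t, 0 <= s <= 1 -> 0 <= t <= 1 -> g s = g t -> s = t,
       g @` `[0, 1] = A, g 0 = x & g 1 = y].
Proof.
move=> hT; split.
  move=> [g [[cg gA [g' _ gK]] g0 g1]]; exists g; split => // s t s01 t01 e.
  by rewrite -(gK s) ?inE ?unit_itvE // e gK // inE unit_itvE.
move=> [g [cg ginj gA g0 g1]]; exists g; split => //; split => //.
pose g' y := xget (0 : R) [set t | 0 <= t <= 1 /\ g t = y].
have gK t : 0 <= t <= 1 -> g' (g t) = t.
  move=> t01; rewrite /g'; case: xgetP => [s -> [s01 e]|/(_ t)]; first exact: ginj.
  by move=> nh; exfalso; exact: nh.
exists g'; last by move=> t; rewrite inE unit_itvE => t01; exact: gK.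
apply/continuous_closedP => C cC; apply/closed_subspaceP.
exists (g @` (`[0, 1] `&` C)).
  apply: compact_closed => //; apply: continuous_compact.
    by apply: continuous_subspaceW cg => t [].
  by apply: compact_closedI => //; exact: segment_compact.
rewrite -gA; apply/seteqP; split => y' [+ [t t01 ty]]; rewrite -{}ty => h1.
  case: h1 => s [s01 Cs] e; split; last by exists t.
  rewrite /= /from_subspace -e gK //; exact/unit_itvE.
split; last by exists t.
by exists t => //; split => //; move: h1; rewrite /= /from_subspace gK //; apply/unit_itvE.
Qed.

Lemma within_continuous_affine (T : topologicalType) (A B : set R) (g : R -> T)
    (a b : R) : (forall s, A s -> B (a * s + b)) ->
  {within B, continuous g} -> {within A, continuous (fun s => g (a * s + b))}.
Proof.
move=> AB cg; apply: (@within_continuous_comp_in R T R A B g (fun s => a * s + b)) => //.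
apply: continuous_subspaceT => t; apply: cvgD; last exact: cvg_cst.
by apply: cvgM; [exact: cvg_cst|exact: cvg_id].
Qed.

Lemma arc_rev (T : topologicalType) (A : set T) (x y : T) : hausdorff_space T ->
  is_arc R A x y -> is_arc R A y x.
Proof.
move=> hT /(arcP _ _ _ hT)[g [cg ginj gA g0 g1]]; apply/(arcP _ _ _ hT).
have sub (t : R) : 0 <= t <= 1 -> 0 <= -1 * t + 1 <= 1.
  by move=> /andP[? ?]; apply/andP; split; lra.
exists (fun t => g (-1 * t + 1)); split.
- by apply: within_continuous_affine cg => s /unit_itvE/sub/unit_itvE.
- by move=> s t /sub s01 /sub t01 /(ginj _ _ s01 t01); lra.
- rewrite -gA; apply/seteqP; split => _ [t /unit_itvE/sub t01 <-].
    by exists (-1 * t + 1) => //; exact/unit_itvE.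
  by exists (-1 * t + 1); [exact/unit_itvE|congr g; ring].
- by rewrite mulr0 add0r.
- by rewrite mulr1 addNr.
Qed.

Lemma arc_concat (T : topologicalType) (A B : set T) (x y z : T) :
  hausdorff_space T -> is_arc R A x z -> is_arc R B z y ->
  (forall p, A p -> B p -> p = z) -> is_arc R (A `|` B) x y.
Proof.
move=> hT /(arcP _ _ _ hT)[g [cg ginj gA g0 g1]] /(arcP _ _ _ hT)[g' [cg' ginj' gB g0' g1']].
move=> AB; apply/(arcP _ _ _ hT).
pose k (s : R) := if s <= 2^-1 then g (2 * s + 0) else g' (2 * s + (-1)).
have half : 0 < 2^-1 :> R by [].
have lo (s : R) : 0 <= s <= 2^-1 -> 0 <= 2 * s + 0 <= 1.
  by move=> /andP[? ?]; apply/andP; split; lra.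
have hi (s : R) : 2^-1 <= s <= 1 -> 0 <= 2 * s + (-1) <= 1.
  by move=> /andP[? ?]; apply/andP; split; lra.
have khi (s : R) : 2^-1 <= s -> k s = g' (2 * s + (-1)).
  rewrite /k le_eqVlt => /orP[/eqP <-|]; last by rewrite ltNge => /negPf ->.
  rewrite lexx addr0 mulfV // subrr g1 g0' //.
have gz (t : R) : 0 <= t <= 1 -> A (g t).
  by move=> t01; rewrite -gA; exists t => //; exact/unit_itvE.
have gz' (t : R) : 0 <= t <= 1 -> B (g' t).
  by move=> t01; rewrite -gB; exists t => //; exact/unit_itvE.
have cross (s t : R) : 0 <= s <= 2^-1 -> 2^-1 < t <= 1 -> k s = k t -> s = t.
  move=> s01 /andP[t1 t2]; rewrite {1}/k (andP s01).2 (khi t) ?(ltW t1) // => e.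
  have t01 : 0 <= 2 * t + (-1) <= 1 by apply: hi; rewrite (ltW t1).
  have : g' (2 * t + -1) = z by apply: AB; [rewrite -e; apply: gz; exact: lo|exact: gz'].
  have z01 : 0 <= (0 : R) <= 1 by rewrite lexx ler01.
  by rewrite -g0' => /(ginj' _ _ t01 z01) e1; lra.
exists k; split.
- have -> : `[0, 1]%classic = `[0, 2^-1]%classic `|` `[2^-1, 1]%classic :> set R.
    apply/seteqP; split => t /=; rewrite !in_itv /=.
      by move=> /andP[t0 t1]; case: (leP t 2^-1) => h; [left|right];
        apply/andP; split => //; exact: ltW.
    by move=> [|] /andP[? ?]; apply/andP; split; lra.
  apply: withinU_continuous; try exact: itv_closed.
    apply: (@within_continuous_eq _ _ _ (fun t : R => g (2 * t + 0)) k).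
      by move=> t /=; rewrite in_itv /= => /andP[_ t2]; rewrite /k t2.
    apply: within_continuous_affine cg => s /=.
    by rewrite !in_itv /=; exact: lo.
  apply: (@within_continuous_eq _ _ _ (fun t : R => g' (2 * t + (-1))) k).
    by move=> t /=; rewrite in_itv /= => /andP[t2 _]; rewrite khi.
  apply: within_continuous_affine cg' => s /=.
  by rewrite !in_itv /=; exact: hi.
- move=> s t /andP[s0 s1] /andP[t0 t1].
  have [sh|hs] := leP s 2^-1; have [th|ht] := leP t 2^-1.
  + rewrite /k sh th => /ginj e; have : 2 * s + 0 = 2 * t + 0.
      by apply: e; apply: lo; apply/andP; split.
    by lra.
  + by apply: cross; apply/andP; split.
  + by move/esym => e; apply/esym; move: e; apply: cross; apply/andP; split.
  + rewrite !khi ?(ltW hs) ?(ltW ht) // => /ginj' e.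
    have : 2 * s + (-1) = 2 * t + (-1).
      by apply: e; apply: hi; apply/andP; split => //; exact: ltW.
    by lra.
- apply/seteqP; split.
    move=> _ [s /unit_itvE/andP[s0 s1] <-]; rewrite /k; case: leP => h; [left|right].
      by apply: gz; apply: lo; rewrite s0.
    by apply: gz'; apply: hi; rewrite s1 ltW.
  move=> p [|].
    rewrite -gA => -[t /unit_itvE/andP[t0 t1] <-]; exists (t / 2).
      by apply/unit_itvE/andP; split; lra.
    by rewrite /k (_ : t / 2 <= 2^-1) ?addr0 1?mulrC ?divfK //; lra.
  rewrite -gB => -[t /unit_itvE/andP[t0 t1] <-]; exists ((t + 1) / 2).
    by apply/unit_itvE/andP; split; lra.
  rewrite khi; last by lra.
  by congr g'; field.
- by rewrite /k ltW // mulr0 addr0.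
- by rewrite khi ?mulr1; [rewrite (_ : 2 + -1 = 1) //; ring|lra].
Qed.

Lemma segment_arc (T : topologicalType) (g : R -> T) (a b : R) :
  hausdorff_space T -> a < b -> {within `[a, b], continuous g} ->
  (forall s t, a <= s <= b -> a <= t <= b -> g s = g t -> s = t) ->
  is_arc R (g @` `[a, b]) (g a) (g b).
Proof.
move=> hT ab cg ginj; apply/(arcP _ _ _ hT).
have ba : 0 < b - a by rewrite subr_gt0.
have sub t : 0 <= t <= 1 -> a <= (b - a) * t + a <= b.
  by move=> /andP[? ?]; apply/andP; split; nra.
exists (fun t => g ((b - a) * t + a)); split.
- by apply: within_continuous_affine cg => s /unit_itvE/sub; rewrite /= in_itv.
- move=> s t /sub s01 /sub t01 /(ginj _ _ s01 t01) /addIr e.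
  by apply: (mulfI _ e); rewrite gt_eqF.
- apply/seteqP; split => _ [t t01 <-].
    exists ((b - a) * t + a) => //=; rewrite in_itv /=; exact/sub/unit_itvE.
  move: t01; rewrite /= in_itv /= => /andP[t0 t1].
  exists ((t - a) / (b - a)) => /=.
    rewrite in_itv /= divr_ge0 ?ler_pdivrMr ?subr_ge0 //=; lra.
  by rewrite mulrC divfK ?subrK ?gt_eqF.
- by rewrite mulr0 add0r.
- by rewrite mulr1 subrK.
Qed.

Local Notation opc := (one_point_compactification 'rV[R]_3).

(** After rescaling time to [0, 1], the escape of the ray is the continuity of
    the arc at infinity. *)
Lemma ray_arc (g : R -> 'rV[R]_3) (a : R) :
  {within `[a, +oo[, continuous g} ->
  (forall s t, a <= s -> a <= t -> g s = g t -> s = t) ->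
  g t 0 2 @[t --> +oo] --> +oo ->
  is_arc R ([set None] `|` Some @` (g @` `[a, +oo[) : set opc) None (Some (g a)).
Proof.
move=> cg ginj up; have hT := @opc_hausdorff R.
apply: arc_rev => //; apply/(arcP _ _ _ hT).
(* The parameter [1] corresponds to the time [+oo]. *)
pose p (s : R) := a + (s / (1 - s)).
have p_ge s : 0 <= s -> s < 1 -> a <= p s.
  by move=> s0 s1; rewrite lerDl divr_ge0 // subr_ge0 ltW.
pose k s : opc := if s < 1 then Some (g (p s)) else None.
have k1 : k 1 = None by rewrite /k ltxx.
exists k; split => //.
- apply/within_continuousP => t /unit_itvE/andP[t0 t1] W.
  have [tl|tg] := ltP t 1; last first.
    have -> : t = 1 by apply/eqP; rewrite eq_le t1.
    rewrite k1 => NW; have := cvg_up_None up NW => -[M [_ hM]].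
    pose d := (`|M - a| + 2)^-1.
    have n0 : 0 <= `|M - a| by [].
    have d0 : 0 < d by rewrite invr_gt0; lra.
    apply/nbhs_ballP; exists d => //= s; rewrite -ball_normE /= => sd /unit_itvE/andP[s0 s1].
    rewrite /k; case: ltP => [sl|sg]; last exact: nbhs_singleton NW.
    apply: hM; rewrite /p.
    have -> : s / (1 - s) = (1 - s)^-1 - 1 by field; rewrite gt_eqF ?subr_gt0.
    have : `|M - a| + 2 < (1 - s)^-1.
      rewrite -[ltLHS]invrK -/d ltf_pV2 ?posrE ?subr_gt0 //.
      by apply: le_lt_trans sd; exact: ler_norm.
    by have := ler_norm (M - a); lra.
  rewrite {1}/k tl => GW.
  have cp : {for t, continuous p}.
    apply: cvgD; first exact: cvg_cst.
    apply: cvgM; first exact: cvg_id.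
    apply: cvgV; first by rewrite subr_eq0 gt_eqF.
    by apply: cvgB; [exact: cvg_cst|exact: cvg_id].
  move/within_continuousP: cg => cg.
  have pt : (`[a, +oo[%classic : set R) (p t) by rewrite /= in_itv /= p_ge.
  have near1 : \forall s \near t, (`[a, +oo[%classic : set R) (p s) -> W (Some (g (p s))).
    exact: (cp _ (cg _ pt (Some @^-1` W) GW)).
  have lt1 : \forall s \near t, s < 1 by exact: lt_nbhsl.
  apply: filterS2 near1 lt1 => s h1 sl /unit_itvE/andP[s0 s1].
  by rewrite /k sl; apply: h1; rewrite /= in_itv /= p_ge.
- move=> s t /andP[s0 s1] /andP[t0 t1]; rewrite /k.
  case: (ltP s 1) => sl; case: (ltP t 1) => tl //; last first.
    by move=> _; apply/eqP; rewrite eq_le (le_trans s1) // (le_trans t1).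
  move=> [e]; have := ginj _ _ (p_ge _ s0 sl) (p_ge _ t0 tl) e => /addrI.
  have n1 : 1 - s != 0 by rewrite subr_eq0 gt_eqF.
  have n2 : 1 - t != 0 by rewrite subr_eq0 gt_eqF.
  by move=> /eqP; rewrite eqr_div // => /eqP; lra.
- apply/seteqP; split.
    move=> _ [s /unit_itvE/andP[s0 s1] <-]; rewrite /k; case: ltP => sl; [right|by left].
    by exists (g (p s)) => //; exists (p s) => //=; rewrite in_itv /= p_ge.
  move=> _ [->|[_ [t /= + <-] <-]].
    by exists 1 => //; apply/unit_itvE; rewrite ler01 lexx.
  rewrite in_itv /= andbT => at_.
  have q0 : 0 < 1 + (t - a) by lra.
  exists ((t - a) / (1 + (t - a))).
    apply/unit_itvE; rewrite divr_ge0 ?subr_ge0 //=; last by lra.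
    by rewrite ler_pdivrMr //; lra.
  rewrite /k ltr_pdivrMr // (_ : _ < _) /p; last by lra.
  by congr (Some (g _)); field; rewrite !gt_eqF //; lra.
- by rewrite /k ltr01 /p mul0r addr0.
Qed.

Lemma arc_connected (T : topologicalType) (A : set T) x y :
  is_arc R A x y -> [/\ connected A, compact A, A x & A y].
Proof.
move=> [g [[cg <- _] <- <-]]; split.
- by apply: connected_continuous_connected cg; exact: segment_connected.
- by apply: continuous_compact => //; exact: segment_compact.
- by exists 0 => //=; rewrite in_itv /= lexx ler01.
- by exists 1 => //=; rewrite in_itv /= lexx ler01.
Qed.

End Arcs.

Lemma hausdorff_cvg0 (R : realType) (T : topologicalType) (X : set T)
    (d : T -> T -> R) (A_ : nat -> set T) (A : set T) (p : T) :
  (forall a b, X a -> X b -> 0 <= d a b) ->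
  (forall n, A_ n `<=` X) -> A `<=` X -> (forall n, A_ n p) -> A p ->
  (forall e : R, 0 < e -> \forall n \near \oo,
     (forall a, A_ n a -> exists2 b, A b & d a b < e) /\
     (forall b, A b -> exists2 a, A_ n a & d a b < e)) ->
  hausdorff_dist d (A_ n) A @[n --> \oo] --> 0%E.
Proof.
move=> d0 AX_ AX AN_ AN close.
have ge0 n : (0 <= hausdorff_dist d (A_ n) A)%E.
  rewrite le_max; apply/orP; left.
  apply: (@le_trans _ _ (ereal_inf [set (d p b)%:E | b in A])).
    apply: le_ereal_inf_tmp => _ [b Ab <-]; rewrite lee_fin d0 //; last exact: AX.
    exact: AX.
  by apply: ereal_sup_ubound; exists p.
have small (e : R) : 0 < e -> \forall n \near \oo, (hausdorff_dist d (A_ n) A <= e%:E)%E.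
  move=> e0; apply: filterS (close e e0) => n [h1 h2].
  rewrite ge_max; apply/andP; split; apply: ge_ereal_sup => _ [a Aa <-].
    have [b Ab ab] := h1 a Aa; apply: (@le_trans _ _ (d a b)%:E).
      by apply: ereal_inf_lbound; exists b.
    by rewrite lee_fin ltW.
  have [b Ab ab] := h2 a Aa; apply: (@le_trans _ _ (d b a)%:E).
    by apply: ereal_inf_lbound; exists b.
  by rewrite lee_fin ltW.
have fin : \forall n \near \oo, hausdorff_dist d (A_ n) A \is a fin_num.
  apply: filterS (small 1 ltr01) => n h1; rewrite ge0_fin_numE //.
  by apply: le_lt_trans h1 _; rewrite ltry.
apply/fine_cvgP; split => //; apply/cvgrPdist_le => e e0.
apply: filterS2 fin (small e e0) => n fn h1 /=.
rewrite sub0r normrN ger0_norm ?fine_ge0 //.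
by rewrite -lee_fin fineK.
Qed.

Lemma metrizes_nbhs (R : realType) (T : topologicalType) (X : set T)
    (d : T -> T -> R) p (e : R) : metrizes X d -> X p ->
  0 < e -> \forall q \near p, X q -> d p q < e.
Proof.
move=> [_ _ _ dn] Xp e0.
have : within X (nbhs p) [set q | d p q < e] by apply/dn => //; exists e.
by [].
Qed.

Lemma metrizes_ge0 (R : realType) (T : topologicalType) (X : set T)
    (d : T -> T -> R) p q : metrizes X d -> X p -> X q ->
  0 <= d p q.
Proof.
move=> [d0 ds dt _] Xp Xq; have := dt p q p Xp Xq Xp.
by rewrite ((d0 p p Xp Xp).2 erefl) (ds q p Xq Xp); lra.
Qed.

(** * Distances under a Zorich map *)

Section ZorichMap.
Variables (R : realType) (L lam : R).
Variables (h : 'rV[R]_2 -> 'rV[R]_3) (Z : 'rV[R]_3 -> 'rV[R]_3).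
Hypothesis h_bilip : bilipschitz_on (@square R) L h.
Hypothesis h_onto : h @` (@square R) = @upper_hemisphere R.
Hypothesis Z_zorich : zorich_map h Z.
Hypothesis lam_gt0 : 0 < lam.

Local Notation f := (zorich_scale lam Z).
Implicit Types (x y z : 'rV[R]_3) (n m : int).

(** Coordinates on the base square of the beam [(n, m)], unfolding the
    reflections. *)
Definition unfold (n m : int) (x : 'rV[R]_3) : 'rV[R]_2 :=
  vec2 ((-1) ^ n * (x 0 0 - 2 * n%:~R)) ((-1) ^ m * (x 0 1 - 2 * m%:~R)).

Lemma unfold_square n m x : in_beam n m x -> square (unfold n m x).
Proof.
by move=> [h1 h2]; split; rewrite ?vec2_0 ?vec2_1 normrM norm_sign mul1r.
Qed.

Lemma unfold_dist n m x y :
  enorm (unfold n m x - unfold n m y) ^+ 2 =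
  (x 0 0 - y 0 0) ^+ 2 + (x 0 1 - y 0 1) ^+ 2.
Proof.
rewrite sqr_enorm2 !mxE /= -!mulrBr !exprMn !sign_sqr !mul1r.
by congr (_ ^+ 2 + _ ^+ 2); ring.
Qed.

Lemma hemisphere u : square u ->
  [/\ h u 0 0 ^+ 2 + h u 0 1 ^+ 2 + h u 0 2 ^+ 2 = 1, enorm (h u) = 1 & 0 <= h u 0 2].
Proof.
move=> su; have [e1 e2] : upper_hemisphere (h u) by rewrite -h_onto; exists u.
by split => //; rewrite -sqr_enorm3 e1 expr1n.
Qed.

Lemma L_ge1 : 1 <= L.
Proof.
pose u : 'rV[R]_2 := vec2 0 0; pose v : 'rV[R]_2 := vec2 1 0.
have su : square u by split; rewrite ?vec2_0 ?vec2_1 normr0.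
have sv : square v by split; rewrite ?vec2_0 ?vec2_1 ?normr0 ?normr1.
have e : enorm (u - v) = 1.
  apply/eqP; rewrite -(@eqrXn2 _ 2) ?enorm_ge0 // sqr_enorm2 !mxE /=.
  by apply/eqP; ring.
have /andP[h1 h2] := h_bilip su sv; rewrite e !mulr1 in h1 h2.
have L0 : 0 <= L by apply: le_trans h2; exact: enorm_ge0.
have [L0'|Lgt0] := eqVneq L 0; last first.
  have Lpos : 0 < L by rewrite lt_neqAle eq_sym Lgt0.
  have LL : 1 <= L * L.
    by rewrite -[leLHS](mulfV Lgt0) ler_pM2l //; exact: le_trans h1 h2.
  by rewrite leNgt; apply/negP => L1; nra.
have cst w w' : square w -> square w' -> h w = h w'.
  move=> sw sw'; have /andP[_] := h_bilip sw sw'; rewrite L0' mul0r => le0.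
  have E0 : enorm (h w - h w') ^+ 2 = 0.
    by rewrite (_ : enorm _ = 0) ?expr0n //; apply/eqP; rewrite eq_le le0 enorm_ge0.
  move: E0; rewrite sqr_enorm3 !mxE => E0.
  have p i := sqr_ge0 (h w 0 i - h w' 0 i); have [p0 p1] := (p 0, p 1); have p2 := p 2.
  by apply/row3P; apply/eqP; rewrite -subr_eq0 -sqrf_eq0; apply/eqP; lra.
have hemi (a b c : R) : a ^+ 2 + b ^+ 2 + c ^+ 2 = 1 -> 0 <= c ->
    exists2 w, square w & h w = vec3 a b c.
  move=> abc c0; have : upper_hemisphere (vec3 a b c).
    split; last by rewrite vec3_2.
    by apply/eqP; rewrite -(@eqrXn2 _ 2) ?enorm_ge0 // expr1n sqr_enorm3 !mxE /= abc.
  by rewrite -h_onto => -[w sw <-]; exists w.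
have [w sw hw] := hemi 1 0 0 ltac:(ring) (lexx _).
have [w' sw' hw'] := hemi 0 0 1 ltac:(ring) ler01.
have := cst _ _ sw sw'; rewrite hw hw' => /rowP/(_ 0); rewrite !vec3_0 => /eqP.
by rewrite oner_eq0.
Qed.

Lemma zorichE n m x : in_beam n m x ->
  f x = (lam * expR (x 0 2)) *: vec3 (h (unfold n m x) 0 0) (h (unfold n m x) 0 1)
          ((-1) ^ (n + m) * h (unfold n m x) 0 2).
Proof. by move=> [h1 h2]; rewrite /zorich_scale (Z_zorich h1 h2) scalerA. Qed.

Lemma enorm_zorich x : enorm (f x) = lam * expR (x 0 2).
Proof.
have p0 : 0 <= lam * expR (x 0 2) by rewrite mulr_ge0 ?expR_ge0 // ltW.
have bx := beam_index_in x; have [e _ _] := hemisphere (unfold_square bx).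
apply/eqP; rewrite -(@eqrXn2 _ 2) ?enorm_ge0 //; apply/eqP.
rewrite (zorichE bx) sqr_enorm3 !mxE /=.
set a := lam * _; set s : R := (-1) ^ _.
have ss : s ^+ 2 = 1 by exact: sign_sqr.
move: e; set p := h _ 0 0; set q := h _ 0 1; set r := h _ 0 2 => e.
have -> : (a * p) ^+ 2 + (a * q) ^+ 2 + (a * (s * r)) ^+ 2 =
  a ^+ 2 * (p ^+ 2 + q ^+ 2 + s ^+ 2 * r ^+ 2) by ring.
by rewrite ss mul1r e mulr1.
Qed.

Lemma zorich_dist n m x y : in_beam n m x -> in_beam n m y ->
  enorm (f x - f y) ^+ 2 = (enorm (f x) - enorm (f y)) ^+ 2 +
    enorm (f x) * enorm (f y) * enorm (h (unfold n m x) - h (unfold n m y)) ^+ 2.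
Proof.
move=> bx by'; rewrite !enorm_zorich.
have [e _ _] := hemisphere (unfold_square bx).
have [e' _ _] := hemisphere (unfold_square by').
rewrite (zorichE bx) (zorichE by') !sqr_enorm3 !mxE /=.
set a := lam * expR (x 0 2); set b := lam * expR (y 0 2); set s : R := (-1) ^ _.
have ss : s ^+ 2 = 1 by exact: sign_sqr.
rewrite (@polar_distance _ _ _ (s * h (unfold n m x) 0 2) _ _
  (s * h (unfold n m y) 0 2)); last 2 first.
- by rewrite exprMn ss mul1r.
- by rewrite exprMn ss mul1r.
by rewrite -[s * _ - s * _]mulrBr [(s * _) ^+ 2]exprMn ss mul1r.
Qed.

Lemma h_dist n m x y : in_beam n m x -> in_beam n m y ->
  L^-1 ^+ 2 * ((x 0 0 - y 0 0) ^+ 2 + (x 0 1 - y 0 1) ^+ 2)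
    <= enorm (h (unfold n m x) - h (unfold n m y)) ^+ 2
    <= L ^+ 2 * ((x 0 0 - y 0 0) ^+ 2 + (x 0 1 - y 0 1) ^+ 2).
Proof.
move=> bx by'; have /andP[h1 h2] := h_bilip (unfold_square bx) (unfold_square by').
have L0 : 0 < L by apply: lt_le_trans L_ge1.
rewrite -(unfold_dist n m) -!exprMn !lerXn2r ?nnegrE ?mulr_ge0 ?enorm_ge0 ?invr_ge0 //;
  exact: ltW.
Qed.

(** Radially [exp] is its own derivative, so distances grow at least by the norm
    of the images; along the spheres [h] costs a factor [L]. *)
Lemma zorich_expands n m x y c : in_beam n m x -> in_beam n m y ->
  0 <= c -> c <= enorm (f x) -> c <= enorm (f y) ->
  (c / L) ^+ 2 * enorm (x - y) ^+ 2 <= enorm (f x - f y) ^+ 2.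
Proof.
move=> bx by' c0 cx cy; rewrite (zorich_dist bx by').
have L1 := L_ge1; have L0 : 0 < L by lra.
have /andP[hd _] := h_dist bx by'.
rewrite sqr_enorm3 !mxE exprMn.
set A := (_ ^+ 2 + _ ^+ 2) in hd *.
set B := enorm (h _ - _) ^+ 2 in hd *.
have A0 : 0 <= A by rewrite addr_ge0 ?sqr_ge0.
have Li : L^-1 ^+ 2 <= 1.
  by rewrite expr_le1 ?invr_ge0 ?invf_le1 // ltW.
have ang : c ^+ 2 * (L^-1 ^+ 2 * A) <= enorm (f x) * enorm (f y) * B.
  have cc : c ^+ 2 <= enorm (f x) * enorm (f y) by rewrite expr2 ler_pM.
  have LA : 0 <= L^-1 ^+ 2 * A by apply: mulr_ge0 => //; exact: sqr_ge0.
  by apply: ler_pM => //; exact: sqr_ge0.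
have rad : c ^+ 2 * (x 0 2 - y 0 2) ^+ 2 <= (enorm (f x) - enorm (f y)) ^+ 2.
  move: cx cy; rewrite !enorm_zorich -mulrBr -exprMn.
  have key (s t : R) : s <= t -> c <= lam * expR s ->
      (c * (t - s)) ^+ 2 <= (lam * (expR t - expR s)) ^+ 2.
    move=> st cs; have /andP[k _] := expR_increment st.
    have k' : c * (t - s) <= lam * (expR t - expR s).
      apply: (@le_trans _ _ (lam * (expR s * (t - s)))).
        by rewrite mulrA ler_wpM2r // subr_ge0.
      by rewrite ler_wpM2l // ltW.
    have p : 0 <= c * (t - s) by rewrite mulr_ge0 // subr_ge0.
    by rewrite lerXn2r ?nnegrE // (le_trans p).
  move=> cx cy; have [st|ts] := leP (x 0 2) (y 0 2).
    by have := key _ _ st cx; congr (_ <= _); ring.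
  exact: key (ltW ts) cy.
apply: le_trans _ (lerD rad ang); rewrite -mulrA mulrDr mulrDr [leLHS]addrC lerD2r.
by rewrite ler_wpM2l ?sqr_ge0 // -[leRHS]mul1r ler_wpM2r ?sqr_ge0.
Qed.

(** The upper bound dual to [zorich_expands]; it gives continuity. *)
Lemma zorich_lipschitz n m x y c : in_beam n m x -> in_beam n m y ->
  enorm (f x) <= c -> enorm (f y) <= c ->
  enorm (f x - f y) ^+ 2 <= (c * L) ^+ 2 * enorm (x - y) ^+ 2.
Proof.
move=> bx by' cx cy; rewrite (zorich_dist bx by').
have c0 : 0 <= c by apply: le_trans cx; exact: enorm_ge0.
have L1 := L_ge1; have L0 : 0 < L by lra.
have /andP[_ hd] := h_dist bx by'.
rewrite [enorm (x - y) ^+ 2]sqr_enorm3 !mxE exprMn.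
set A := (_ ^+ 2 + _ ^+ 2) in hd *.
set B := enorm (h _ - _) ^+ 2 in hd *.
have ang : enorm (f x) * enorm (f y) * B <= c ^+ 2 * (L ^+ 2 * A).
  have cc : enorm (f x) * enorm (f y) <= c ^+ 2 by rewrite expr2 ler_pM ?enorm_ge0.
  have p : 0 <= enorm (f x) * enorm (f y) by apply: mulr_ge0; exact: enorm_ge0.
  by apply: ler_pM => //; exact: sqr_ge0.
have rad : (enorm (f x) - enorm (f y)) ^+ 2 <= c ^+ 2 * (x 0 2 - y 0 2) ^+ 2.
  rewrite (_ : c ^+ 2 * _ = (c * (x 0 2 - y 0 2)) ^+ 2); last by rewrite exprMn.
  move: cx cy; rewrite !enorm_zorich -mulrBr.
  have key (s t : R) : s <= t -> lam * expR t <= c ->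
      (lam * (expR t - expR s)) ^+ 2 <= (c * (t - s)) ^+ 2.
    move=> st cs; have /andP[_ k] := expR_increment st.
    have k' : lam * (expR t - expR s) <= c * (t - s).
      apply: (@le_trans _ _ (lam * (expR t * (t - s)))).
        by rewrite ler_wpM2l // ltW.
      by rewrite mulrA ler_wpM2r // subr_ge0.
    have p : 0 <= lam * (expR t - expR s).
      by rewrite mulr_ge0 ?subr_ge0 ?ler_expR // ltW.
    by rewrite lerXn2r ?nnegrE // (le_trans p).
  move=> cx cy; have [st|ts] := leP (x 0 2) (y 0 2).
    by have := key _ _ st cy; congr (_ <= _); ring.
  exact: key (ltW ts) cx.
apply: le_trans (lerD rad ang) _.
set w := (x 0 2 - y 0 2) ^+ 2.
have : c ^+ 2 * w <= c ^+ 2 * (L ^+ 2 * w).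
  by rewrite ler_wpM2l ?sqr_ge0 // -[leLHS]mul1r ler_wpM2r ?sqr_ge0 // exprn_ege1.
by lra.
Qed.

Lemma zorich_continuous : continuous f.
Proof.
move=> x.
have [d0 d0gt h0] := common_interval (x 0 0).
have [d1 d1gt h1] := common_interval (x 0 1).
have L1 := L_ge1.
pose c := lam * expR (x 0 2 + 1); pose K := c * L * 2.
have c0 : 0 < c by rewrite mulr_gt0 // expR_gt0.
have Lgt0 : 0 < L by lra.
have K0 : 0 < K by rewrite mulr_gt0 // mulr_gt0.
have key y : `|x - y| < d0 -> `|x - y| < d1 -> `|x - y| < 1 ->
    `|f x - f y| <= K * `|x - y|.
  move=> y0 y1 y2.
  have co i : `|x 0 i - y 0 i| <= `|x - y|.
    by have := coord_le_norm (x - y) i; rewrite !mxE.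
  have [n [nx ny]] := h0 (y 0 0) (le_lt_trans (co 0) y0).
  have [m [mx my]] := h1 (y 0 1) (le_lt_trans (co 1) y1).
  have bx : in_beam n m x by [].
  have b_y : in_beam n m y by [].
  apply: le_trans (norm_le_enorm _) _.
  have cl : 0 <= c * L by apply: mulr_ge0; [exact: ltW|lra].
  apply: (@le_trans _ _ (c * L * enorm (x - y))); last first.
    by rewrite /K -(mulrA (c * L) 2) ler_wpM2l ?enorm_le_norm.
  have p : 0 <= c * L * enorm (x - y) by apply: mulr_ge0 => //; exact: enorm_ge0.
  rewrite -(@ler_pXn2r _ 2) ?nnegrE ?enorm_ge0 // exprMn.
  apply: (zorich_lipschitz bx b_y); rewrite enorm_zorich ler_pM2l // ler_expR.
    by rewrite lerDl.
  have := le_lt_trans (co 2) y2; rewrite ltr_norml => /andP[]; lra.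
apply/(@cvgrPdist_lt _ _ _ (nbhs x) _ f (f x)) => e e0.
have small (r : R) : 0 < r -> \forall y \near x, `|x - y| < r.
  move=> r0; apply/nbhs_ballP; exists r => //= y.
  by rewrite -ball_normE.
near=> y; apply: (@le_lt_trans _ _ (K * `|x - y|)).
  apply: key; near: y; exact: small.
rewrite mulrC -ltr_pdivlMr //; near: y; apply: small; exact: divr_gt0.
Unshelve. all: by end_near. Qed.

Lemma iter_continuous k : continuous (iter k f).
Proof.
elim: k => [|k IH] x; first exact: cvg_id.
by apply: (@continuous_comp _ _ _ (iter k f) f); [exact: IH|exact: zorich_continuous].
Qed.

(** On a face of the square the formulas of the two adjacent beams agree, and
    they have opposite third coordinates. *)
Lemma h_boundary (u : 'rV[R]_2) :
  square u -> `|u 0 0| = 1 \/ `|u 0 1| = 1 -> h u 0 2 = 0.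
Proof.
move=> [u0 u1] bd; pose x := vec3 (u 0 0) (u 0 1) 0.
have uE a b : a = u 0 0 -> b = u 0 1 -> vec2 a b = u.
  move=> -> ->; apply/rowP => -[[|[|//]] hi]; rewrite !mxE /=.
  - by congr (u 0 _); apply/val_inj.
  - by congr (u 0 _); apply/val_inj.
have B n m : in_beam n m x -> unfold n m x = u -> (-1) ^ (n + m) = -1 :> R ->
    h u 0 2 = 0.
  move=> bx ux s.
  have b0 : in_beam 0 0 x by split; rewrite ?vec3_0 ?vec3_1 mulr0 subr0.
  have u00 : unfold 0 0 x = u.
    by apply: uE; rewrite ?vec3_0 ?vec3_1 expr0z mul1r mulr0 subr0.
  have := zorichE bx; rewrite (zorichE b0) ux u00 s addr0 expr0z.
  rewrite vec3_2 expR0 mulr1 => /rowP/(_ 2); rewrite !mxE /= => /eqP.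
  rewrite -subr_eq0 -mulrBr mulf_eq0 gt_eqF //= => /eqP; lra.
have zE (a : R) : (-1) ^ (0 : int) * (a - 2 * 0%:~R) = a.
  by rewrite expr0z mul1r mulr0 subr0.
have N1 : (-1) ^ (1 : int) = -1 :> R by rewrite expr1z.
have N2 : (-1) ^ (-1 : int) = -1 :> R by rewrite -invr_expz expr1z invrN invr1.
have E1 : `|1 - 2 * 1%:~R| <= 1 :> R.
  by rewrite mulr1z (_ : 1 - 2 * 1 = -1) ?normrN1 //; ring.
have E2 : `|-1 - 2 * (-1)%:~R| <= 1 :> R.
  by rewrite mulrN1z (_ : -1 - 2 * -1 = 1) ?normr1 //; ring.
case: bd => /eqP; rewrite eqr_norml => /andP[/orP[]/eqP e _].
- apply: (B 1 0); rewrite ?addr0 //.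
    by split; rewrite ?vec3_0 ?vec3_1 ?mulr0 ?subr0 // e.
  by apply: uE; rewrite ?vec3_0 ?vec3_1 ?zE // N1 e mulr1z; ring.
- apply: (B (-1) 0); rewrite ?addr0 //.
    by split; rewrite ?vec3_0 ?vec3_1 ?mulr0 ?subr0 // e.
  by apply: uE; rewrite ?vec3_0 ?vec3_1 ?zE // N2 e mulrN1z; ring.
- apply: (B 0 1); rewrite ?add0r //.
    by split; rewrite ?vec3_0 ?vec3_1 ?mulr0 ?subr0 // e.
  by apply: uE; rewrite ?vec3_0 ?vec3_1 ?zE // N1 e mulr1z; ring.
- apply: (B 0 (-1)); rewrite ?add0r //.
    by split; rewrite ?vec3_0 ?vec3_1 ?mulr0 ?subr0 // e.
  by apply: uE; rewrite ?vec3_0 ?vec3_1 ?zE // N2 e mulrN1z; ring.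
Qed.

(** The third coordinate of [h] vanishes on the walls and is nonnegative inside,
    so only the inside of an upright beam is mapped above the plane [x_3 = 0]. *)
Lemma zorich_upper n m x : in_beam n m x -> 0 < f x 0 2 ->
  open_beam n m x /\ (-1) ^ (n + m) = 1 :> R.
Proof.
move=> bx; rewrite (zorichE bx) !mxE /=.
have [_ _ hu] := hemisphere (unfold_square bx).
have p0 : 0 < lam * expR (x 0 2) by rewrite mulr_gt0 // expR_gt0.
rewrite pmulr_rgt0 // => pos.
have hn : h (unfold n m x) 0 2 <> 0 by move=> e; rewrite e mulr0 ltxx in pos.
split; last first.
  case: (sign_cases R (n + m)) => // e; move: pos; rewrite e mulN1r; lra.
have [b0 b1] := bx.
have nb v w : `|v| = `|w| :> R -> `|v| = 1 -> `|w| = 1 by move=> <-.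
split; rewrite lt_neqAle ?b0 ?b1 andbT; apply/eqP => e; apply: hn;
  apply: h_boundary; first exact: unfold_square.
- by left; rewrite vec2_0 normrM norm_sign mul1r.
- exact: unfold_square.
- by right; rewrite vec2_1 normrM norm_sign mul1r.
Qed.

(** The inverse branch into an upright beam: [h] is onto the hemisphere, and
    the logarithm recovers the height. *)
Lemma zorich_inverse n m (y : 'rV[R]_3) : (-1) ^ (n + m) = 1 :> R -> 0 < y 0 2 ->
  exists2 x, open_beam n m x & f x = y.
Proof.
move=> s y2.
have N0 : 0 < enorm y.
  by apply: lt_le_trans (coord_le_enorm y 2); rewrite normr_gt0 gt_eqF.
have hy : upper_hemisphere ((enorm y)^-1 *: y).
  split; last by rewrite mxE mulr_ge0 ?invr_ge0 // ltW.
  apply/eqP; rewrite -(@eqrXn2 _ 2) ?enorm_ge0 // expr1n sqr_enorm3 !mxE !exprMn.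
  by rewrite -!mulrDr -sqr_enorm3 -exprMn mulVf ?expr1n // gt_eqF.
move: hy; rewrite -h_onto => -[u su hu].
pose x := vec3 (2 * n%:~R + (-1) ^ n * u 0 0) (2 * m%:~R + (-1) ^ m * u 0 1)
  (ln (enorm y / lam)).
have bx : in_beam n m x.
  by case: su => u0 u1; split; rewrite ?vec3_0 ?vec3_1 addrAC subrr add0r
    normrM norm_sign mul1r.
have ux : unfold n m x = u.
  have E (k : int) (a : R) : (-1) ^ k * (2 * k%:~R + (-1) ^ k * a - 2 * k%:~R) = a.
    by rewrite addrAC subrr add0r mulrA -expr2 sign_sqr mul1r.
  apply/rowP => -[[|[|//]] hi]; rewrite !mxE /= ?vec3_0 ?vec3_1 E.
  - by congr (u 0 _); apply/val_inj.
  - by congr (u 0 _); apply/val_inj.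
have fx : f x = y.
  rewrite (zorichE bx) ux hu s mul1r vec3_2 lnK ?posrE ?divr_gt0 //.
  rewrite mulrC divfK ?gt_eqF //.
  by apply: row3P; rewrite !mxE /= mulrA divff ?mul1r ?gt_eqF.
by exists x => //; apply: (zorich_upper bx _).1; rewrite fx.
Qed.

Definition shift (k : int) (x : 'rV[R]_3) : 'rV[R]_3 :=
  x + vec3 (4 * k%:~R) 0 0.

Lemma shift_beam n m k x : in_beam n m x -> in_beam (n + 2 * k) m (shift k x).
Proof.
move=> [b0 b1]; split; rewrite mxE ?vec3_0 ?vec3_1 ?addr0 //.
by rewrite (_ : _ + _ - _ = x 0 0 - 2 * n%:~R) // intrD intrM; ring.
Qed.

Lemma zorich_shift k x : f (shift k x) = f x.
Proof.
have bx := beam_index_in x; have b' := shift_beam k bx.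
have e2 : (-1) ^ (2 * k) = 1 :> R.
  by rewrite -exprz_exp -[(-1) ^ 2]exprnP sqrrN expr1n exp1rz.
have N1 : (-1 : R) != 0 by rewrite oppr_eq0 oner_eq0.
rewrite (zorichE bx) (zorichE b') mxE vec3_2 addr0.
set n := (beam_index x).1; set m := (beam_index x).2.
have -> : unfold (n + 2 * k) m (shift k x) = unfold n m x.
  congr vec2; last by rewrite mxE vec3_1 addr0.
  by rewrite expfzDr // e2 mulr1 mxE vec3_0 intrD intrM; congr (_ * _); ring.
by rewrite addrAC expfzDr // e2 mulr1.
Qed.

(** * Survivors and the order along hairs *)

Hypothesis lam_lt : lam < expR (- (ln L + L)).

(** The height below which [f] maps into the unit ball: [lam * exp mu = 1 / L]. *)
Definition mu : R := - ln (lam * L).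

Lemma L_lt_mu : L < mu.
Proof.
have L1 := L_ge1; have L0 : 0 < L by lra.
have : ln lam < - (ln L + L) by rewrite -[ltRHS]expRK ltr_ln ?posrE // expR_gt0.
by rewrite /mu lnM ?posrE //; lra.
Qed.

Lemma mu_gt1 : 1 < mu.
Proof. exact: le_lt_trans L_ge1 L_lt_mu. Qed.

Lemma zorich_low x : x 0 2 < mu -> enorm (f x) < 1.
Proof.
move=> xm; have L1 := L_ge1; have L0 : 0 < L by lra.
have e : lam * expR mu = L^-1.
  rewrite /mu expRN lnK ?posrE ?mulr_gt0 //; field.
  by rewrite !gt_eqF.
rewrite enorm_zorich; apply: (@lt_le_trans _ _ (lam * expR mu)).
  by rewrite ltr_pM2l // ltr_expR.
by rewrite e invf_le1.
Qed.

(** A survivor has an image of norm at least [mu], so this is the factor by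
    which [zorich_expands] expands distances between survivors. *)
Definition kap : R := mu / L.

Lemma kap_gt1 : 1 < kap.
Proof.
have L1 := L_ge1; have L0 : 0 < L by lra.
by rewrite /kap ltr_pdivlMr // mul1r L_lt_mu.
Qed.

(** A substitute for the Julia set, which it contains: unlike that set it is
    given by explicit inequalities, and this is all that the estimates need. *)
Definition survivors : set 'rV[R]_3 := [set x | forall k, mu <= iter k f x 0 2].

Lemma survivors_iter k x : survivors x -> survivors (iter k f x).
Proof. by move=> sx j; rewrite -iterD; exact: sx. Qed.

Lemma survivors_enorm x : survivors x -> mu <= enorm (f x).
Proof.
move=> /(_ 1%N) /= m1; apply: le_trans m1 _.
by apply: le_trans (coord_le_enorm _ 2); exact: ler_norm.
Qed.

Lemma survivors_beam x : survivors x ->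
  open_beam (beam_index x).1 (beam_index x).2 x /\
  (-1) ^ ((beam_index x).1 + (beam_index x).2) = 1 :> R.
Proof.
move=> /(_ 1%N) /= m1; apply: zorich_upper (beam_index_in x) _.
by apply: lt_le_trans m1; have := mu_gt1; lra.
Qed.

Lemma escape_below k x : iter k f x 0 2 < mu ->
  forall i, iter (k + i) f x 0 2 < mu /\ enorm (iter (k + i).+1 f x) < 1.
Proof.
move=> xk; elim=> [|i [IH1 IH2]].
  by rewrite addn0; split => //; exact: zorich_low.
suff lo : iter (k + i.+1) f x 0 2 < mu by split => //; exact: zorich_low.
rewrite addnS; have := coord_le_enorm (iter (k + i).+1 f x) 2.
have := ler_norm (iter (k + i).+1 f x 0 2); have := mu_gt1; lra.
Qed.

Lemma iter_bounded k (x : 'rV[R]_3) : exists b : R, forall y j,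
  `|x - y| < 1 -> (j <= k)%N -> enorm (iter j f y) <= b.
Proof.
elim: k => [|k [b hb]].
  exists (2 * (`|x| + 1)) => y j xy; rewrite leqn0 => /eqP -> /=.
  apply: le_trans (enorm_le_norm y) _; rewrite ler_wpM2l //.
  by have := ler_normD (y - x) x; rewrite subrK distrC; lra.
exists (Num.max b (lam * expR b)) => y [|j] xy; rewrite le_max.
  by move=> _; rewrite hb.
rewrite ltnS => jk; apply/orP; right; rewrite iterS enorm_zorich ler_pM2l //.
rewrite ler_expR; apply: le_trans (hb y j xy jk).
by apply: le_trans (coord_le_enorm _ 2); exact: ler_norm.
Qed.

(** A point that falls below height [mu] has a neighbourhood with a bounded
    forward orbit, and such an orbit omits a cube. *)
Lemma julia_survivors : julia f `<=` survivors.
Proof.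
move=> x jx k; rewrite leNgt; apply/negP => xk.
have [b hb] := iter_bounded k x.
pose U : set 'rV[R]_3 := [set y | iter k f y 0 2 < mu] `&` [set y | `|x - y| < 1].
have nU : nbhs x U.
  apply: filterI.
    apply: open_nbhs_nbhs; split => //.
    apply: (@open_comp _ _ (fun y => iter k f y 0 2) [set t | t < mu]).
      move=> y _; apply: (@continuous_comp _ _ _ (iter k f) (fun z => z 0 2)).
        exact: iter_continuous.
      exact: coord_continuous.
    exact: open_lt.
  by apply/nbhs_ballP; exists 1 => //= y; rewrite -ball_normE.
have b0 : 0 <= b.
  apply: le_trans (hb x 0 _ (leq0n k)); first exact: enorm_ge0.
  by rewrite subrr normr0.
apply: (@cube_positive_capacity R (b + 2)).
apply: (jx U nU (cube (b + 2)) (@compact_cube R _)) => y yc [j /= j0 [z [zk xz] zy]].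
have /andP[y1 _] := yc 0; have := coord_le_enorm y 0.
have := ler_norm (y 0 0) => h1 h2.
suff : enorm y <= b + 1 by lra.
rewrite -zy; have [jk|kj] := leqP j k.
  by apply: le_trans (hb z j xz jk) _; rewrite lerDl.
have [_] := escape_below zk (j - k.+1).
rewrite -addnS subnSK // addnC subnK ?(ltnW kj) // => /ltW; lra.
Qed.

Lemma closed_julia (g : 'rV[R]_3 -> 'rV[R]_3) : closed (julia g).
Proof.
rewrite -[julia g]setCK; apply: open_closedC; rewrite openE => x /existsNP[U].
move=> /not_implyP[nU ncap]; have : \forall y \near x, nbhs y U.
  by move: nU; rewrite {1}nbhsE => -[V [oV Vx] VU]; near=> y;
    apply: filterS VU _; apply: open_nbhs_nbhs; split => //; near: y;
    exact: open_nbhs_nbhs.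
by apply: filterS => y yU jy; apply: ncap; exact: jy.
Unshelve. all: by end_near. Qed.

Definition same_itinerary (x y : 'rV[R]_3) : Prop :=
  forall k, beam_index (iter k f x) = beam_index (iter k f y).

Lemma same_itinerary_sym x y : same_itinerary x y -> same_itinerary y x.
Proof. by move=> xy k. Qed.

Lemma same_itinerary_trans y x z :
  same_itinerary x y -> same_itinerary y z -> same_itinerary x z.
Proof. by move=> xy yz k; rewrite xy. Qed.

Lemma same_itinerary_f x y : same_itinerary x y -> same_itinerary (f x) (f y).
Proof. by move=> xy k; rewrite -!iterSr; exact: xy. Qed.

Lemma survivors_expand x y : survivors x -> survivors y ->
  beam_index x = beam_index y -> kap * enorm (x - y) <= enorm (f x - f y).
Proof.
move=> sx sy xy; have k0 : 0 <= kap by apply: ltW; apply: lt_trans kap_gt1.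
have p : 0 <= kap * enorm (x - y) by apply: mulr_ge0 => //; exact: enorm_ge0.
rewrite -(@ler_pXn2r _ 2) ?nnegrE ?enorm_ge0 // exprMn.
have b_y := beam_index_in y; rewrite -xy in b_y.
apply: zorich_expands (beam_index_in x) b_y _ _ _; last 2 first.
- exact: survivors_enorm.
- exact: survivors_enorm.
by have := mu_gt1; lra.
Qed.

Lemma survivors_expand_iter k x y : survivors x -> survivors y ->
  (forall j, (j < k)%N -> beam_index (iter j f x) = beam_index (iter j f y)) ->
  kap ^+ k * enorm (x - y) <= enorm (iter k f x - iter k f y).
Proof.
move=> sx sy; elim: k => [|k IH] xy; first by rewrite mul1r.
have k0 : 0 <= kap by apply: ltW; apply: lt_trans kap_gt1.
apply: le_trans (survivors_expand (survivors_iter k sx) (survivors_iter k sy) _).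
  by rewrite exprS -mulrA ler_wpM2l // IH // => j jk; apply: xy; exact: ltnW.
exact: xy.
Qed.

Lemma in_beam_dist n m (x y : 'rV[R]_3) : in_beam n m x -> in_beam n m y ->
  `|x 0 0 - y 0 0| <= 2 /\ `|x 0 1 - y 0 1| <= 2.
Proof.
move=> [x0 x1] [y0 y1].
have key (a b c : R) : `|a - c| <= 1 -> `|b - c| <= 1 -> `|a - b| <= 2.
  by rewrite !ler_norml => /andP[? ?] /andP[? ?]; apply/andP; split; lra.
by split; [exact: key x0 y0|exact: key x1 y1].
Qed.

Lemma same_beam_dist (x y : 'rV[R]_3) : beam_index x = beam_index y ->
  enorm (x - y) ^+ 2 <= 8 + (x 0 2 - y 0 2) ^+ 2.
Proof.
move=> xy; have b_y := beam_index_in y; rewrite -xy in b_y.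
have [d0 d1] := in_beam_dist (beam_index_in x) b_y.
rewrite sqr_enorm3 !mxE lerD2r.
have key (a : R) : `|a| <= 2 -> a ^+ 2 <= 4.
  by rewrite ler_norml => /andP[? ?]; nra.
by have := key _ d0; have := key _ d1; lra.
Qed.

(** A height gap of [4] inside one beam multiplies the norms of the images by
    [exp 4 > 9]; since the images again share a beam, their horizontal
    coordinates nearly agree and the gap persists. *)
Lemma gap_step x y : survivors x -> survivors y ->
  beam_index (f x) = beam_index (f y) -> x 0 2 + 4 < y 0 2 ->
  f x 0 2 + 4 < f y 0 2.
Proof.
move=> sx sy xy gap; have m1 := mu_gt1.
have e9 : 9 * enorm (f x) <= enorm (f y).
  rewrite !enorm_zorich mulrCA ler_pM2l //.
  apply: (@le_trans _ _ (expR (x 0 2 + 4))); last by rewrite ler_expR ltW.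
  rewrite expRD mulrC ler_wpM2l ?expR_ge0 //.
  rewrite (_ : (4 : R) = 2 + 2); last by ring.
  by rewrite expRD; have := expR_ge1Dx (2 : R); nra.
have a2 : mu <= f x 0 2 := sx 1%N; have b2 : mu <= f y 0 2 := sy 1%N.
have b_y := beam_index_in (f y); rewrite -xy in b_y.
have [d0 d1] := in_beam_dist (beam_index_in (f x)) b_y.
have sq : 81 * enorm (f x) ^+ 2 <= enorm (f y) ^+ 2.
  by have := enorm_ge0 (f x); nra.
move: sq; rewrite !sqr_enorm3.
set a := f x in a2 d0 d1 *; set b := f y in b2 d0 d1 *.
have key (s t : R) : `|s - t| <= 2 -> t ^+ 2 <= 2 * s ^+ 2 + 8.
  by rewrite ler_norml => /andP[? ?]; have := sqr_ge0 (2 * s - t); nra.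
have k0 := key _ _ d0; have k1 := key _ _ d1 => sq.
rewrite ltNge; apply/negP => ba.
have k2 : b 0 2 ^+ 2 <= 2 * a 0 2 ^+ 2 + 32.
  by have := sqr_ge0 (a 0 2 - 4); nra.
have a21 : 1 <= a 0 2 ^+ 2 by nra.
by have := sqr_ge0 (a 0 0); have := sqr_ge0 (a 0 1); lra.
Qed.

(** The order along a hair. It is read off from heights, since by [gap_step] a
    gap of [4] between orbits with one itinerary never closes again. *)
Definition below (x y : 'rV[R]_3) : Prop :=
  exists k, iter k f x 0 2 + 4 < iter k f y 0 2.

Lemma gap_persists k i x y : survivors x -> survivors y -> same_itinerary x y ->
  iter k f x 0 2 + 4 < iter k f y 0 2 ->
  iter (k + i) f x 0 2 + 4 < iter (k + i) f y 0 2.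
Proof.
move=> sx sy xy; elim: i => [|i IH] g; first by rewrite addn0.
rewrite addnS; apply: gap_step; [exact: survivors_iter|exact: survivors_iter| |exact: IH].
exact: (xy (k + i).+1).
Qed.

Lemma below_asym x y : survivors x -> survivors y -> same_itinerary x y ->
  below x y -> below y x -> False.
Proof.
move=> sx sy xy [k xk] [j yj].
have := gap_persists j sx sy xy xk.
have := gap_persists k sy sx (same_itinerary_sym xy) yj.
by rewrite addnC; lra.
Qed.

Lemma below_irrefl x : ~ below x x.
Proof. by move=> [k]; lra. Qed.

Lemma kap_pow_unbounded (a b : R) : 0 < a -> exists k, b < kap ^+ k * a.
Proof.
move=> a0; have k1 := kap_gt1.
have bern k : 1 + k%:R * (kap - 1) <= kap ^+ k.
  elim: k => [|k IH]; first by rewrite mul0r addr0.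
  have p1 : 0 <= kap * (kap ^+ k - (1 + k%:R * (kap - 1))).
    by rewrite mulr_ge0 ?subr_ge0 //; lra.
  have p2 : 0 <= k%:R * (kap - 1) ^+ 2 by rewrite mulr_ge0 ?sqr_ge0.
  by rewrite exprS -natr1; lra.
pose k := (Num.truncn (`|b| / (a * (kap - 1)))).+1.
exists k; apply: lt_le_trans (ler_wpM2r (ltW a0) (bern k)).
have := truncnS_gt (`|b| / (a * (kap - 1))); rewrite -/k.
rewrite ltr_pdivrMr ?mulr_gt0 ?subr_gt0 // => h1.
have := ler_norm b => h2; rewrite mulrDl mul1r.
by apply: le_lt_trans h2 _; apply: lt_le_trans h1 _; nra.
Qed.

(** Expansion drives two points with the same itinerary apart, and inside
    beams this can only happen vertically. *)
Lemma below_total x y : survivors x -> survivors y -> same_itinerary x y ->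
  x <> y -> below x y \/ below y x.
Proof.
move=> sx sy xy nxy.
have d0 : 0 < enorm (x - y).
  rewrite lt_neqAle enorm_ge0 andbT eq_sym; apply/eqP => /enorm_eq0 e.
  by apply: nxy; apply/eqP; rewrite -subr_eq0 e.
have [k hk] := kap_pow_unbounded 5 d0.
have h1 := survivors_expand_iter (k := k) sx sy (fun j _ => xy j).
have h2 := same_beam_dist (xy k); have h3 := lt_le_trans hk h1.
set a := iter k f x in h2 h3; set b := iter k f y in h2 h3.
have h4 : 16 < (a 0 2 - b 0 2) ^+ 2.
  have h5 : 25 < enorm (a - b) ^+ 2.
    by rewrite (_ : 25 = 5 ^+ 2) ?ltrXn2r ?nnegrE ?enorm_ge0 //; ring.
  by lra.
have gap (s t : R) : s <= t -> 16 < (s - t) ^+ 2 -> s + 4 < t.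
  by move=> st; rewrite ltNge => h5; rewrite ltNge; apply/negP => h6; move/negP: h5; apply; nra.
have [ab|/ltW ba] := leP (a 0 2) (b 0 2); [left|right]; exists k; apply: gap => //.
by rewrite -[ltRHS]sqrrN opprB.
Qed.

(** * Hairs and itineraries *)

(** The inverse branch is Lipschitz, again by [zorich_expands]; so [f] is open
    wherever it takes values high above the plane [x_3 = 0]. *)
Lemma zorich_open x (U : set 'rV[R]_3) :
  1 < f x 0 2 -> nbhs x U -> nbhs (f x) (f @` U).
Proof.
move=> fx /nbhs_ballP[e /= e0 eU]; have L1 := L_ge1.
have L0 : 0 < L by lra.
have bx := beam_index_in x; have f0 : 0 < f x 0 2 by lra.
have [ox s] := zorich_upper bx f0.
pose d := Num.min (f x 0 2 - 1) (e / (2 * L)).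
have d0 : 0 < d by rewrite lt_min subr_gt0 fx divr_gt0 // mulr_gt0.
apply/nbhs_ballP; exists d => //= y; rewrite -ball_normE /= lt_min => /andP[y1 y2].
have c2 := le_lt_trans (coord_le_norm (f x - y) 2) y1.
have y3 : 1 < y 0 2.
  by move: c2; rewrite !mxE ltr_norml => /andP[_]; lra.
have [x' ox' fx'] := zorich_inverse s (lt_trans ltr01 y3).
exists x' => //; apply: eU; rewrite -ball_normE /=.
have big z : 1 < z 0 2 -> 1 <= enorm z.
  by move=> z1; have := coord_le_enorm z 2; have := ler_norm (z 0 2); lra.
have := zorich_expands bx (open_beam_sub ox') ler01 (big _ fx).
rewrite fx' => /(_ (big _ y3)); rewrite -exprMn ler_pXn2r ?nnegrE ?enorm_ge0 //; last first.
  by rewrite mulr_ge0 ?enorm_ge0 // divr_ge0 // ltW.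
move=> h1; apply: le_lt_trans (norm_le_enorm _) _.
have h2 := enorm_le_norm (f x - y).
have h3 : enorm (x - x') <= L * enorm (f x - y).
  by rewrite -ler_pdivrMl // -[_^-1]mul1r.
move: y2; rewrite ltr_pdivlMr ?mulr_gt0 // => y2; nra.
Qed.

Lemma cap_zero_sub (A B : set 'rV[R]_3) : A `<=` B -> cap_zero B -> cap_zero A.
Proof. by move=> AB cB F cF FA; apply: cB => //; exact: subset_trans FA AB. Qed.

Hypothesis julia_hairs : exists HH : set (set 'rV[R]_3),
  [/\ ~ countable HH, trivIset HH id, \bigcup_(H in HH) H = julia f &
      forall H, HH H -> exists2 g : R -> 'rV[R]_3, hair_param H g & tends_up g].
Hypothesis fatou_cvg : forall x, ~ julia f x ->
  exists2 p : 'rV[R]_3, f p = p & iter n f x @[n --> \oo] --> p.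

Local Notation J := (julia f).

(** The forward orbit of a neighbourhood [U] of [x] contains that of [f @` U],
    which is a neighbourhood of [f x]. *)
Lemma julia_preimage x : J (f x) -> J x.
Proof.
move=> jfx U nU; have fx : 1 < f x 0 2.
  by apply: lt_le_trans mu_gt1 _; exact: (julia_survivors jfx 0%N).
apply: cap_zero_sub (jfx _ (zorich_open fx nU)).
apply: subsetC => y [k k0 [_ [z Uz <-] <-]].
by exists k.+1 => //; exists z => //; rewrite iterSr.
Qed.

Lemma iter_coord_continuous k i : continuous (fun x => iter k f x 0 i).
Proof.
move=> y; apply: (@continuous_comp _ _ _ (iter k f) (fun z => z 0 i)).
  exact: iter_continuous.
exact: coord_continuous.
Qed.

Lemma open_below_l z : open [set w | below w z].
Proof.
rewrite (_ : mkset _ = \bigcup_k [set w | iter k f w 0 2 < iter k f z 0 2 - 4]); last first.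
  apply/seteqP; split => [w [k wk]|w [k _ /= wk]]; exists k => //=; lra.
apply: bigcup_open => k _.
apply: (@open_comp _ _ (fun y => iter k f y 0 2) [set t | t < _]).
  by move=> y _; exact: iter_coord_continuous.
exact: open_lt.
Qed.

Lemma open_below_r z : open [set w | below z w].
Proof.
rewrite (_ : mkset _ = \bigcup_k [set w | iter k f w 0 2 > iter k f z 0 2 + 4]); last first.
  by apply/seteqP; split => [w [k wk]|w [k _ /= wk]]; exists k.
apply: bigcup_open => k _.
apply: (@open_comp _ _ (fun y => iter k f y 0 2) [set t | t > _]).
  by move=> y _; exact: iter_coord_continuous.
exact: open_gt.
Qed.

Lemma survivors_in_beam n m x : survivors x -> in_beam n m x ->
  beam_index x = (n, m).
Proof.
move=> sx bx; apply: beam_indexE; apply: (zorich_upper bx _).1.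
by apply: lt_le_trans (sx 1%N); have := mu_gt1; lra.
Qed.

(** A survivor in a closed beam lies in the open one, so each condition on the
    itinerary is both open and closed among survivors. *)
Lemma connected_same_itinerary (K : set 'rV[R]_3) x y :
  connected K -> K `<=` survivors -> K x -> K y -> same_itinerary x y.
Proof.
move=> cK sK Kx Ky k; pose n := (beam_index (iter k f x)).1.
pose m := (beam_index (iter k f x)).2.
pose B := K `&` [set w | beam_index (iter k f w) = (n, m)].
have nm : beam_index (iter k f x) = (n, m) by rewrite -surjective_pairing.
suff BK : B = K by rewrite nm; have [_ ->] : B y by rewrite BK.
apply: cK.
- by exists x.
- exists (iter k f @^-1` open_beam n m).
    by apply: open_comp => [w _|]; [exact: iter_continuous|exact: open_open_beam].
  apply/seteqP; split => w [Kw /= wb]; split => //=; last exact: beam_indexE.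
  by have [ow _] := survivors_beam (survivors_iter k (sK _ Kw)); rewrite wb in ow.
- exists (iter k f @^-1` in_beam n m).
    by apply: closed_comp => [w _|]; [exact: iter_continuous|exact: closed_in_beam].
  apply/seteqP; split => w [Kw /= wb]; split => //=.
    by have := beam_index_in (iter k f w); rewrite wb.
  by apply: survivors_in_beam => //; apply: survivors_iter; exact: sK.
Qed.

(** If [z] were missing, the points below [z] would form a nonempty, proper,
    open and closed part of [K]. *)
Lemma connected_between (K : set 'rV[R]_3) x y z :
  connected K -> K `<=` survivors -> K x -> K y ->
  survivors z -> same_itinerary x z -> below x z -> below z y -> K z.
Proof.
move=> cK sK Kx Ky sz xz bxz bzy; apply: contrapT => nKz.
have wz w : K w -> same_itinerary w z.
  move=> Kw; apply: same_itinerary_trans xz.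
  exact: (connected_same_itinerary cK sK).
suff BK : K `&` [set w | below w z] = K.
  have [_ yz] : (K `&` [set w | below w z]) y by rewrite BK.
  exact: (below_asym (sK _ Ky) sz (wz _ Ky) yz bzy).
apply: cK.
- by exists x.
- by exists [set w | below w z] => //; exact: open_below_l.
- exists (~` [set w | below z w]); first exact/open_closedC/open_below_r.
  apply/seteqP; split => w [Kw] /= h1; split => //=.
    by move=> h2; exact: (below_asym (sK _ Kw) sz (wz _ Kw) h1 h2).
  have nwz : w <> z by move=> e; apply: nKz; rewrite -e.
  by have [] := below_total (sK _ Kw) sz (wz _ Kw) nwz.
Qed.

(** Otherwise [p] would lie between [x] and some point of [K] high above [p], and
    so in [K]. Applied to two disjoint hairs with the same itinerary, this would
    put each of them above the other. *)
Lemma connected_unbounded_above (K : set 'rV[R]_3) p x :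
  connected K -> K `<=` survivors -> (forall M, exists2 w, K w & M < w 0 2) ->
  survivors p -> ~ K p -> K x -> same_itinerary x p -> below p x.
Proof.
move=> cK sK up sp nKp Kx xp.
have nxp : x <> p by move=> e; apply: nKp; rewrite -e.
have [] // := below_total (sK _ Kx) sp xp nxp => bxp.
have [w Kw wp] := up (p 0 2 + 4); exfalso; apply: nKp.
by apply: (connected_between cK sK Kx Kw) => //; exists 0%N.
Qed.

(** The points of the Julia set that share the itinerary of [x] turn out to form
    exactly one hair, and its parametrization is increasing for [below]. *)
Definition hair_chart x (g : R -> 'rV[R]_3) : Prop :=
  [/\ {within `[0, +oo[, continuous g},
      forall t, 0 <= t -> J (g t) /\ same_itinerary x (g t),
      forall y, J y -> same_itinerary x y -> exists2 t, 0 <= t & g t = y,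
      forall s t, 0 <= s -> s < t -> below (g s) (g t) &
      g t 0 2 @[t --> +oo] --> +oo].

Lemma up_unbounded (g : R -> 'rV[R]_3) (a M : R) :
  g t 0 2 @[t --> +oo] --> +oo -> exists2 t, a < t & M < g t 0 2.
Proof.
move=> /cvgryPgt/(_ M) h2; have : \forall t \near +oo, a < t /\ M < g t 0 2.
  near=> t; split; near: t; last exact: h2.
  by apply: nbhs_pinfty_gt; exact: num_real.
by move=> /filter_ex[t [? ?]]; exists t.
Unshelve. all: by end_near. Qed.

Lemma hair_charts x : J x -> exists g, hair_chart x g.
Proof.
have [HH [_ tHH cov hairs]] := julia_hairs.
have HJ H : HH H -> H `<=` J by move=> HHH w Hw; rewrite -cov; exists H.
have HS H : HH H -> H `<=` survivors.
  by move=> HHH w /(HJ _ HHH); exact: julia_survivors.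
have facts H : HH H -> connected H /\ (forall M, exists2 w, H w & M < w 0 2).
  move=> HHH; have [g [[cg gH _] _] [up _]] := hairs H HHH; split.
    rewrite -gH; apply: connected_continuous_connected cg.
    exact/connected_intervalP/interval_is_interval.
  move=> M; have [t t0 Mt] := up_unbounded 0 M up; exists (g t) => //.
  by rewrite -gH; exists t => //=; rewrite in_itv /= ltW.
move=> Jx; have := Jx; rewrite -cov => -[H HHH Hx].
have [g [[cg gH [g' _ gK]] _] [up _]] := hairs H HHH.
have Hg t : 0 <= t -> H (g t).
  by move=> t0; rewrite -gH; exists t => //=; rewrite in_itv /= t0.
have ginj s t : 0 <= s -> 0 <= t -> g s = g t -> s = t.
  move=> s0 t0 e; rewrite -(gK s) ?inE /= ?in_itv /= ?s0 // e gK //.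
  by rewrite inE /= in_itv /= t0.
have [cH uH] := facts H HHH.
have sameH y : H y -> same_itinerary x y.
  by move=> Hy; apply: (connected_same_itinerary cH (HS _ HHH)).
exists g; split => //.
- by move=> t t0; split; [exact/(HJ _ HHH)/Hg|exact/sameH/Hg].
- move=> y Jy xy; have := Jy; rewrite -cov => -[H' HHH' H'y].
  have [eHH|neq] := eqVneq H H'.
    move: H'y; rewrite -eHH -gH => -[t /= ] .
    by rewrite in_itv /= andbT => t0 <-; exists t.
  have [cH' uH'] := facts H' HHH'.
  have disj w : H w -> H' w -> False.
    move=> Hw H'w; move/eqP: neq; apply; apply: (tHH H H') => //.
    by exists w.
  exfalso; apply: (below_asym (HS _ HHH _ Hx) (HS _ HHH' _ H'y) xy).
  + apply: (connected_unbounded_above cH' (HS _ HHH') uH') => //.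
    * exact: HS Hx.
    * by move=> /(disj _ Hx).
  + apply: (connected_unbounded_above cH (HS _ HHH) uH) => //.
    * exact: HS H'y.
    * by move=> Hy; exact: disj H'y.
- move=> s t s0 st; pose K := g @` `]s, +oo[.
  have sub : `]s, +oo[%classic `<=` `[0, +oo[%classic.
    by move=> u /=; rewrite !in_itv /= !andbT => su; apply: le_trans s0 (ltW su).
  have KH : K `<=` H.
    by move=> _ [u /sub /= us <-]; apply: Hg; move: us; rewrite in_itv /= andbT.
  have cK : connected K.
    apply: connected_continuous_connected.
      exact/connected_intervalP/interval_is_interval.
    exact: continuous_subspaceW cg.
  have Kt : K (g t) by exists t => //=; rewrite in_itv /= st.
  have t0 : 0 <= t by rewrite (le_trans s0) // ltW.
  apply: (connected_unbounded_above cK _ _ _ _ Kt).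
  + exact: subset_trans KH (HS _ HHH).
  + move=> M; have [u su Mu] := up_unbounded s M up.
    by exists (g u) => //; exists u => //=; rewrite in_itv /= su.
  + exact/(HS _ HHH)/Hg.
  + move=> [u /= ]; rewrite in_itv /= andbT => su gus.
    have u0 : 0 <= u by rewrite (le_trans s0) // ltW.
    by move: su; rewrite (ginj _ _ u0 s0 gus) ltxx.
  + by apply: same_itinerary_trans (sameH _ (Hg _ s0)); apply/same_itinerary_sym/sameH/Hg.
Qed.

(** * Invariance of the Julia set and density of endpoints *)

Lemma kap_powS i k : (i <= k)%N -> kap ^+ i <= kap ^+ k.
Proof. by move=> ik; rewrite ler_eXn2l // kap_gt1. Qed.

(** Two points with the same itinerary cannot both have convergent orbits, since
    the expansion drives these orbits apart. If [f x] were not in the Julia set,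
    then neither would be the images of the points of the hair near [x]. *)
Lemma julia_forward x : J x -> J (f x).
Proof.
move=> Jx; apply: contrapT => nJ.
have [g [cg gJ gS gB _]] := hair_charts Jx.
have [t t0 gt] := gS _ Jx (fun k => erefl).
have nV : nbhs (g t) (f @^-1` ~` J).
  rewrite gt; apply: zorich_continuous; apply: open_nbhs_nbhs; split => //.
  exact/closed_openC/closed_julia.
have : \forall s \near t, 0 <= s -> ~ J (f (g s)).
  have At : (`[0, +oo[%classic : set R) t by rewrite /= in_itv /= t0.
  apply: filterS ((within_continuousP _ _).1 cg t At _ nV) => s + s0.
  by apply; rewrite /= in_itv /= s0.
move=> /nbhs_ballP[e /= e0 he].
pose s := t + e / 2.
have ts : t < s by rewrite ltrDl divr_gt0.
have s0 : 0 <= s by rewrite (le_trans t0) // ltW.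
have nJs : ~ J (f (g s)).
  apply: he => //; rewrite -ball_normE /= /s opprD addrA subrr add0r normrN gtr0_norm ?divr_gt0 //.
  by rewrite ltr_pdivrMr // ltr_pMr // ltr1n.
have [p _ cp] := fatou_cvg nJ; have [p' _ cp'] := fatou_cvg nJs.
have sx := julia_survivors Jx; have [Jy xy] := gJ s s0.
have sy := julia_survivors Jy.
have cvg_dist : enorm (iter n f (f x) - iter n f (f (g s))) @[n --> \oo] --> enorm (p - p').
  apply: (@cvg_comp _ _ _ _ (@enorm R 3) _ (nbhs (p - p'))).
    exact: (cvgB cp cp').
  exact: enorm_continuous.
have d0 : 0 < enorm (x - g s).
  rewrite lt_neqAle enorm_ge0 andbT eq_sym; apply/eqP => /enorm_eq0 e1.
  apply: (@below_irrefl x); rewrite -{1}gt.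
  have -> : x = g s by apply/eqP; rewrite -subr_eq0 e1.
  exact: gB.
have [k hk] := kap_pow_unbounded (enorm (p - p') + 1) d0.
have : \forall n \near \oo, (k <= n)%N /\
    enorm (iter n f (f x) - iter n f (f (g s))) < enorm (p - p') + 1.
  near=> n; split; near: n; first by exists k.
  by apply: (cvgr_lt (enorm (p - p'))) => //; rewrite ltrDl.
move=> /filter_ex[n [kn nd]].
have := survivors_expand_iter (k := n.+1) sx sy (fun j _ => xy j).
rewrite !iterSr => h1.
have h2 : kap ^+ k * enorm (x - g s) <= kap ^+ n.+1 * enorm (x - g s).
  by rewrite ler_wpM2r ?enorm_ge0 // kap_powS // ltnW.
by lra.
Unshelve. all: by end_near. Qed.

(** A minimal point for [below] among the Julia points of its itinerary: the
    finite end of a hair. *)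
Definition bottom e : Prop :=
  J e /\ forall x, J x -> same_itinerary x e -> ~ below x e.

Lemma bottom_exists x : J x -> exists e, bottom e.
Proof.
move=> Jx; have [g [_ gJ gS gB _]] := hair_charts Jx.
have [Je xe] := gJ 0 (lexx _); exists (g 0); split => // y Jy ye bye.
have [t t0 gt] := gS _ Jy (same_itinerary_trans xe (same_itinerary_sym ye)).
have [t00|tn0] := eqVneq t 0.
  by apply: (@below_irrefl (g 0)); rewrite -{1}t00 gt.
apply: (below_asym _ _ ye bye); try exact: julia_survivors.
by rewrite -gt; apply: gB => //; rewrite lt_neqAle eq_sym tn0.
Qed.

Lemma bottom_preimage x : bottom (f x) -> bottom x.
Proof.
move=> [Jfx bfx]; have Jx := julia_preimage Jfx; split => // y Jy yx [k yk].
apply: (bfx (f y)); [exact: julia_forward|exact: same_itinerary_f|].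
have [sy sx] := (julia_survivors Jy, julia_survivors Jx).
by have := gap_persists 1 sy sx yx yk; rewrite addn1 !iterSr; exists k.
Qed.

Lemma shiftK k x : shift (- k) (shift k x) = x.
Proof.
by apply: row3P; rewrite !mxE /= ?addr0 // intrN mulrN addrK.
Qed.

Lemma shift_continuous k : continuous (shift k).
Proof.
by move=> x; apply: (@cvgD _ _ _ (nbhs x)); [exact: cvg_id|exact: cvg_cst].
Qed.

Lemma iter_shift k j x : (0 < j)%N -> iter j f (shift k x) = iter j f x.
Proof. by case: j => // j _; rewrite !iterSr zorich_shift. Qed.

Lemma iter_shift_height k j x : iter j f (shift k x) 0 2 = iter j f x 0 2.
Proof.
by case: j => [|j]; [rewrite /= mxE vec3_2 addr0|rewrite iter_shift].
Qed.

Lemma shift_beam_index k x :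
  beam_index (shift k x) = ((beam_index x).1 + 2 * k, (beam_index x).2).
Proof.
rewrite /beam_index !mxE /= addr0; congr (_, _).
rewrite (_ : (x 0 0 + 4 * k%:~R + 1) / 2 = (x 0 0 + 1) / 2 + (2 * k)%:~R).
  by rewrite floorDrz ?intr_int // intrKfloor.
by rewrite intrM; field.
Qed.

Lemma same_itinerary_shift k x y :
  same_itinerary x y -> same_itinerary (shift k x) (shift k y).
Proof.
move=> xy [|j]; last by rewrite !iter_shift //; exact: xy.
by rewrite !shift_beam_index (xy 0%N).
Qed.

Lemma below_shift k x y : below x y -> below (shift k x) (shift k y).
Proof. by move=> [j xy]; exists j; rewrite !iter_shift_height. Qed.

(** A set and its translate by a period have the same images under [f]. *)
Lemma julia_shift k x : J x -> J (shift k x).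
Proof.
move=> Jx U nU; apply: cap_zero_sub (Jx _ (shift_continuous nU)).
apply: subsetC => y [j j0 [z /= Uz <-]]; exists j => //.
by exists (shift k z) => //; rewrite iter_shift.
Qed.

Lemma bottom_shift k e : bottom e -> bottom (shift k e).
Proof.
move=> [Je be]; split; first exact: julia_shift.
move=> x Jx xe bx; apply: (be (shift (- k) x)); first exact: julia_shift.
  by rewrite -(shiftK k e); exact: same_itinerary_shift.
by rewrite -(shiftK k e); exact: below_shift.
Qed.

Lemma expR4_ge5 : 5 <= expR (4 : R).
Proof. by have := expR_ge1Dx (4 : R); lra. Qed.

(** The first translate whose norm reaches [w] overshoots by at most the period
    [4], which is less than [4 * w]. *)
Lemma enorm_shift_grow (e : 'rV[R]_3) (w : R) : 1 <= enorm e -> enorm e < w ->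
  exists n : int, w <= enorm (shift n e) /\ enorm (shift n e) <= 5 * w.
Proof.
move=> e1 ew; pose P (k : nat) := w <= enorm (shift (Posz k) e).
have [k Pk] : exists k, P k.
  pose k := (Num.truncn (w + enorm e)).+1; exists k.
  have := truncnS_gt (w + enorm e); rewrite -/k => hk.
  have := coord_le_enorm (shift k e) 0; have := ler_norm (shift k e 0 0).
  have := coord_le_enorm e 0; rewrite ler_norml => /andP[h1 _].
  have k0 : 0 <= k%:R :> R by [].
  by rewrite /P mxE vec3_0 -pmulrn; lra.
have exP : exists k, P k by exists k.
case: (ex_minnP exP) => n Pn nmin; exists (Posz n); split => //.
case: n Pn nmin => [|n] Pn nmin.
  by move: Pn; rewrite /P /shift mulr0 (_ : vec3 0 0 0 = 0) ?addr0; [lra|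
    apply: row3P; rewrite !mxE].
have lt_n : enorm (shift (Posz n) e) < w.
  by rewrite ltNge; apply/negP => /nmin; rewrite ltnn.
set a := shift (Posz n) e in lt_n.
have step : shift (Posz n.+1) e = a + vec3 4 0 0.
  by apply: row3P; rewrite !mxE /= ?addr0 // -addrA -!pmulrn -natr1; congr (_ + _); ring.
have w1 : 1 < w by lra.
clearbody a.
rewrite step -(@ler_pXn2r _ 2) ?nnegrE ?enorm_ge0 //; last by lra.
have := enorm_ge0 a => a0.
have aw : enorm a ^+ 2 <= w ^+ 2 by rewrite ler_pXn2r ?nnegrE //; lra.
have := coord_le_enorm a 0; rewrite ler_norml => /andP[h1 h2].
move: aw; rewrite !sqr_enorm3 !mxE /= !addr0 => aw.
have h3 : (a 0 0 + 4) ^+ 2 <= a 0 0 ^+ 2 + 8 * w + 16.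
  rewrite (_ : (a 0 0 + 4) ^+ 2 = a 0 0 ^+ 2 + 8 * a 0 0 + 16); last by ring.
  by rewrite lerD2r lerD2l ler_wpM2l //; lra.
have h4 : w <= w ^+ 2 by rewrite expr2 -{1}[w]mulr1 ler_wpM2l //; lra.
rewrite exprMn (_ : 5 ^+ 2 = 25); last by ring.
by lra.
Qed.

(** The preimages of the translates of one endpoint form a coarse net in each
    upright beam: the norms of the translates grow in bounded steps, and the
    heights of the preimages like their logarithms. *)
Lemma coarse_density x : J x -> exists C, forall q, survivors q ->
  exists e, [/\ bottom e, beam_index e = beam_index q & enorm (e - q) <= C].
Proof.
move=> /bottom_exists[e0 be0]; have m1 := mu_gt1.
have se0 : survivors e0 by apply: julia_survivors; exact: be0.1.
have e01 : 1 < enorm e0.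
  have := se0 0%N => /= h1; have := coord_le_enorm e0 2; have := ler_norm (e0 0 2); lra.
pose C1 := Num.max 4 (ln (enorm e0 / lam)).
have C14 : 4 <= C1 by rewrite le_max lexx.
have C1e : ln (enorm e0 / lam) <= C1 by rewrite le_max lexx orbT.
clearbody C1.
exists (3 + C1) => q sq; have [oq s] := survivors_beam sq.
set w := lam * expR (q 0 2).
have w0 : 0 < w by rewrite mulr_gt0 // expR_gt0.
(* The preimage of the translate should be as high as [q] up to [C1]: its height
   is [ln (norm / lam)], and [w] is the norm that corresponds to the height of [q]. *)
have [k [wk hk]] : exists k : int, w <= enorm (shift k e0) /\
    ln (enorm (shift k e0) / lam) <= q 0 2 + C1.
  have lnw : ln (w / lam) = q 0 2 by rewrite /w mulrAC divff ?gt_eqF // mul1r expRK.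
  have [we|ew] := leP w (enorm e0).
    exists 0; rewrite (_ : shift 0 e0 = e0); last first.
      by apply: row3P; rewrite !mxE /= ?mulr0 addr0.
    split => //; apply: (le_trans C1e).
    by rewrite lerDr; have := sq 0%N => /=; lra.
  have [n [n1 n2]] := enorm_shift_grow (ltW e01) ew; exists n; split => //.
  have p1 : 0 < enorm (shift n e0) by lra.
  apply: (@le_trans _ _ (q 0 2 + 4)); last by rewrite lerD2l.
  rewrite -[leRHS]expRK ler_ln ?posrE ?divr_gt0 ?expR_gt0 //.
  rewrite ler_pdivrMr // expRD mulrAC [_ * lam]mulrC -/w.
  by apply: (le_trans n2); rewrite mulrC ler_wpM2l ?expR4_ge5 // ltW.
have bk := bottom_shift k be0.
have y0 : 0 < shift k e0 0 2.
  by rewrite mxE vec3_2 addr0; have := se0 0%N => /=; lra.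
have [e oe fe] := zorich_inverse s y0.
have be : bottom e by apply: bottom_preimage; rewrite fe.
have ie : beam_index e = beam_index q.
  by rewrite (beam_indexE oe) -surjective_pairing.
exists e; split => //.
have he : lam * expR (e 0 2) = enorm (shift k e0) by rewrite -enorm_zorich fe.
have h1 : q 0 2 <= e 0 2 by rewrite -ler_expR -(ler_pM2l lam_gt0) he.
have h2 : e 0 2 <= q 0 2 + C1.
  apply: le_trans hk; rewrite -he mulrAC divff ?gt_eqF // mul1r expRK //.
have p : 0 <= 3 + C1 by rewrite addr_ge0 // (le_trans _ C14).
rewrite -(@ler_pXn2r _ 2) ?nnegrE ?enorm_ge0 //.
apply: le_trans (same_beam_dist ie) _.
have d0 : 0 <= e 0 2 - q 0 2 by rewrite subr_ge0.
have d1 : e 0 2 - q 0 2 <= C1 by rewrite lerBlDl.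
have C0 : 0 <= C1 by exact: le_trans C14.
have h3 : (e 0 2 - q 0 2) ^+ 2 <= C1 ^+ 2 by rewrite lerXn2r ?nnegrE.
rewrite (_ : (3 + C1) ^+ 2 = 9 + 6 * C1 + C1 ^+ 2); last by ring.
apply: lerD => //; apply: (@le_trans _ _ 9); first by rewrite ler_nat.
by rewrite lerDl mulr_ge0.
Qed.

(** The inverse branches along the orbit of [z] carry an endpoint at bounded
    distance from the [k]-th image of [z] to one that is closer to [z] by the
    factor [kap ^- k]. *)
Lemma bottoms_dense x : J x -> exists C, forall k z, J z ->
  exists e, [/\ bottom e, beam_index e = beam_index z &
                kap ^+ k * enorm (e - z) <= C].
Proof.
move=> /coarse_density[C hC]; exists C; elim=> [|k IH] z Jz.
  by have [e [h1 h2 h3]] := hC _ (julia_survivors Jz); exists e; rewrite mul1r.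
have [e [be _ ez]] := IH _ (julia_forward Jz).
have sz := julia_survivors Jz; have [oz s] := survivors_beam sz.
have e0 : 0 < e 0 2.
  by have := julia_survivors be.1 0%N => /=; have := mu_gt1; lra.
have [x' ox' fx'] := zorich_inverse s e0.
have bx' : bottom x' by apply: bottom_preimage; rewrite fx'.
have ix' : beam_index x' = beam_index z.
  by rewrite (beam_indexE ox') -surjective_pairing.
exists x'; split => //; apply: le_trans ez.
rewrite exprSr -mulrA ler_wpM2l ?exprn_ge0 //.
  by have := kap_gt1; lra.
rewrite -fx'; apply: survivors_expand => //; exact: julia_survivors bx'.1.
Qed.

(** * Connected sets that reach infinity *)

Local Notation opc := (one_point_compactification 'rV[R]_3).
Local Notation X := (Some @` J `|` [set None] : set opc).

Lemma X_Some x : X (Some x) <-> J x.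
Proof.
split=> [[[y Jy [<-]]|//]|Jx]; first exact: Jy.
by left; exists x.
Qed.

Lemma X_None : X None.
Proof. by right. Qed.

Lemma julia_connected_same (K : set 'rV[R]_3) x y :
  connected K -> K `<=` J -> K x -> K y -> same_itinerary x y.
Proof.
by move=> cK KJ; apply: connected_same_itinerary => // w /KJ; exact: julia_survivors.
Qed.

Lemma julia_connected_between (K : set 'rV[R]_3) x y z :
  connected K -> K `<=` J -> K x -> K y -> J z -> same_itinerary x z ->
  below x z -> below z y -> K z.
Proof.
move=> cK KJ Kx Ky Jz; apply: (connected_between cK) => //.
  by move=> w /KJ; exact: julia_survivors.
exact: julia_survivors.
Qed.

Lemma julia_below_asym x y : J x -> J y -> same_itinerary x y ->
  below x y -> below y x -> False.
Proof. by move=> Jx Jy; apply: below_asym; exact: julia_survivors. Qed.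

Lemma julia_below_total x y : J x -> J y -> same_itinerary x y -> x <> y ->
  below x y \/ below y x.
Proof. by move=> Jx Jy; apply: below_total; exact: julia_survivors. Qed.

(** Together with infinity, this is the arc from infinity to [y]. *)
Definition tail y : set 'rV[R]_3 :=
  [set z | [/\ J z, same_itinerary y z & ~ below z y]].

Lemma tail_refl y : J y -> tail y y.
Proof. by move=> Jy; split => //; exact: below_irrefl. Qed.

Lemma tail_cases y z : J y -> tail y z -> z = y \/ below y z.
Proof.
move=> Jy [Jz yz nzy]; have [->|/eqP ne] := eqVneq z y; first by left.
right; have [] // := julia_below_total Jy Jz yz _.
by move=> e; apply: ne.
Qed.

Lemma hair_at y : J y -> exists g (t0 : R),
  [/\ 0 <= t0, g t0 = y, hair_chart y g & tail y = g @` `[t0, +oo[].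
Proof.
move=> Jy; have [g ch] := hair_charts Jy; have [cg gJ gS gB up] := ch.
have [t0 t00 gt0] := gS _ Jy (fun k => erefl).
exists g, t0; split => //; apply/seteqP; split => z.
  move=> tz; have [Jz yz _] := tz; have [t tt gt] := gS _ Jz yz.
  exists t => //=; rewrite in_itv /= andbT leNgt; apply/negP => tlt.
  have [_ _] := tz; apply; rewrite -gt -gt0; exact: gB.
move=> [t /= + <-]; rewrite in_itv /= andbT => tt.
have t_ge0 := le_trans t00 tt; have [Jt yt] := gJ _ t_ge0; split => //.
move: tt; rewrite le_eqVlt => /orP[/eqP <-|tt].
  by rewrite gt0; exact: below_irrefl.
move=> bty; apply: (julia_below_asym Jy Jt yt) => //.
by rewrite -gt0; exact: gB.
Qed.

Lemma chart_inj y g : hair_chart y g ->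
  forall s t, 0 <= s -> 0 <= t -> g s = g t -> s = t.
Proof.
move=> [_ _ _ gB _] s t s0 t0 e; apply/eqP; rewrite eq_le !leNgt.
by apply/andP; split; apply/negP => /gB; rewrite e => h1;
  apply: (@below_irrefl (g t)); apply: h1.
Qed.

Lemma tail_arc y : J y ->
  is_arc R ([set None] `|` Some @` tail y : set opc) None (Some y).
Proof.
move=> Jy; have [g [t0 [t00 gt0 ch ->]]] := hair_at Jy.
have [cg _ _ _ up] := ch; rewrite -{1}gt0; apply: ray_arc => //.
  apply: continuous_subspaceW cg => t /=; rewrite !in_itv /= !andbT.
  exact: le_trans.
by move=> s t s0 t0'; apply: (chart_inj ch); exact: le_trans t00 _.
Qed.

Lemma tail_connected y : J y ->
  connected ([set None] `|` Some @` tail y : set opc).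
Proof. by move=> /tail_arc/arc_connected[]. Qed.

(** Agreement of itineraries up to time [k]. Among survivors it is an open and
    a closed condition, which full agreement is not. *)
Definition prefix k x y : Prop :=
  forall j, (j <= k)%N -> beam_index (iter j f x) = beam_index (iter j f y).

Lemma open_prefix k z : exists V : set 'rV[R]_3,
  [/\ open V, (forall w, V w -> prefix k w z) &
      forall w, survivors w -> prefix k w z -> V w].
Proof.
pose I j := beam_index (iter j f z).
exists (\bigcap_(j in [set j | (j <= k)%N]) (iter j f @^-1` open_beam (I j).1 (I j).2)).
split.
- elim: k => [|k IH].
    rewrite (_ : [set j | (j <= 0)%N] = [set 0%N]); last first.
      by apply/seteqP; split => j /=; rewrite leqn0 => /eqP.
    rewrite bigcap_set1; apply: open_comp => [w _|]; last exact: open_open_beam.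
    exact: iter_continuous.
  rewrite (_ : [set j | (j <= k.+1)%N] = k.+1 |` [set j | (j <= k)%N]); last first.
    apply/seteqP; split => j /=; last by case=> [->|jk] //; exact: leqW.
    by rewrite leq_eqVlt ltnS => /orP[/eqP|]; [left|right].
  rewrite bigcap_setU1; apply: openI => //.
  apply: open_comp => [w _|]; last exact: open_open_beam.
  exact: iter_continuous.
- by move=> w Vw j jk; rewrite (beam_indexE (Vw j jk)) -surjective_pairing.
- move=> w sw wz j jk; have [+ _] := survivors_beam (survivors_iter j sw).
  by rewrite (wz j jk).
Qed.

Lemma closed_prefix k z : exists C : set 'rV[R]_3,
  [/\ closed C, (forall w, prefix k w z -> C w) &
      forall w, survivors w -> C w -> prefix k w z].
Proof.
pose I j := beam_index (iter j f z).
exists (\bigcap_(j in [set j | (j <= k)%N]) (iter j f @^-1` in_beam (I j).1 (I j).2)).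
split.
- apply: closed_bigI => j _; apply: closed_comp => [w _|]; last exact: closed_in_beam.
  exact: iter_continuous.
- move=> w wz j jk; have := beam_index_in (iter j f w).
  by rewrite (wz j jk).
- move=> w sw Cw j jk; have := survivors_in_beam (survivors_iter j sw) (Cw j jk).
  by rewrite -surjective_pairing.
Qed.

Lemma kap_pow_ge1 k : 1 <= kap ^+ k.
Proof. by rewrite exprn_ege1 // ltW // kap_gt1. Qed.

(** Otherwise the points of [K] that follow [z] up to time [k], and then have a
    [k]-th image below that of [z], would form a bounded, open and closed part of
    [K]. Indeed, if two [k]-th images are at equal height in one beam, then their
    distance is at most [sqrt 8 <= 3], and the expansion bounds that of the points
    themselves. *)
Lemma crossing (K : set opc) k y z : connected K -> K `<=` X -> K None ->
  K (Some y) -> J z -> prefix k y z -> iter k f y 0 2 < iter k f z 0 2 ->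
  exists2 w, K (Some w) & kap ^+ k * enorm (w - z) <= 3.
Proof.
move=> cK KX KN Ky Jz yz hy; apply: contrapT => none.
have KJ w : K (Some w) -> J w by move=> /KX/X_Some.
have KS w : K (Some w) -> survivors w by move=> /KJ; exact: julia_survivors.
have sz := julia_survivors Jz.
have [V [oV Vp pV]] := open_prefix k z; have [C [cC pC Cp]] := closed_prefix k z.
have near_z w : survivors w -> prefix k w z ->
    kap ^+ k * enorm (w - z) <= enorm (iter k f w - iter k f z).
  by move=> sw wz; apply: survivors_expand_iter => // j jk; apply: wz; exact: ltnW.
pose D : set opc := [set p | exists w,
  [/\ p = Some w, K p, prefix k w z & iter k f w 0 2 < iter k f z 0 2]].
pose B : set 'rV[R]_3 := J `&` C `&` [set w | iter k f w 0 2 <= iter k f z 0 2].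
have closedB : closed B.
  apply: closedI; first by apply: closedI => //; exact: closed_julia.
  apply: (@closed_comp _ _ (fun w => iter k f w 0 2) [set t | t <= _]).
    by move=> w _; exact: iter_coord_continuous.
  exact: closed_le.
have compB : compact B.
  apply: bounded_closed_compact => //; exists (`|z| + (3 + iter k f z 0 2)).
  split; first exact: num_real.
  move=> M hM w [[Jw Cw] /= hw]; have sw := julia_survivors Jw.
  have wz := Cp w sw Cw; have h1 := near_z w sw wz.
  have h2 := same_beam_dist (wz k (leqnn k)).
  have w0 : mu <= iter k f w 0 2 := sw k; have m1 := mu_gt1.
  set a := iter k f w in hw h1 h2 w0; set b := iter k f z in hM hw h1 h2.
  have h3 : enorm (a - b) <= 3 + b 0 2.
    have p0 : 0 <= 3 + b 0 2 by lra.
    rewrite -(@ler_pXn2r _ 2) ?nnegrE ?enorm_ge0 //; apply: le_trans h2 _; nra.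
  have h4 : enorm (w - z) <= kap ^+ k * enorm (w - z).
    by rewrite ler_peMl ?enorm_ge0 // kap_pow_ge1.
  have h5 := norm_le_enorm (w - z).
  by have := ler_normD (w - z) z; rewrite subrK; lra.
have DK : D = K.
  apply: cK.
  - by exists (Some y), y.
  - exists (Some @` (V `&` [set w | iter k f w 0 2 < iter k f z 0 2])).
      apply: one_point_compactification_open_some; apply: openI => //.
      apply: (@open_comp _ _ (fun w => iter k f w 0 2) [set t | t < _]).
        by move=> w _; exact: iter_coord_continuous.
      exact: open_lt.
    apply/seteqP; split => p.
      move=> [w [-> Kw wz hw]]; split => //; exists w => //; split => //.
      by apply: pV => //; exact: KS.
    by move=> [Kp [w [Vw hw] e]]; exists w; rewrite -e; split => //; [rewrite e|exact: Vp].
  - exists (Some @` B).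
      apply: compact_closed; first exact: opc_hausdorff.
      apply: continuous_compact => //; apply: continuous_subspaceT.
      exact: one_point_compactification_some_continuous.
    apply/seteqP; split => p.
      move=> [w [-> Kw wz hw]]; split => //; exists w => //; split; last exact: ltW.
      by split; [exact: KJ|exact: pC].
    move=> [Kp [w [[Jw Cw] /= hw] e]]; rewrite -e in Kp *.
    have sw := julia_survivors Jw; have wz := Cp w sw Cw.
    exists w; split => //; rewrite lt_neqAle hw andbT; apply/eqP => eq_h.
    apply: none; exists w => //; apply: le_trans (near_z w sw wz) _.
    have := same_beam_dist (wz k (leqnn k)).
    rewrite eq_h subrr expr0n addr0 => h8.
    by rewrite -(@ler_pXn2r _ 2) ?nnegrE ?enorm_ge0 //; lra.
by move: KN; rewrite -DK => -[w []].
Qed.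

Lemma below_late k x y : survivors x -> survivors y -> same_itinerary x y ->
  below x y -> exists2 j, (k <= j)%N & iter j f x 0 2 + 4 < iter j f y 0 2.
Proof.
move=> sx sy xy [i hi]; exists (i + k)%N; first exact: leq_addl.
exact: gap_persists.
Qed.

(** By [crossing] at later and later times, the closed set [K] comes arbitrarily
    close to each point above [y] in its hair. *)
Lemma tail_sub (K : set opc) y : connected K -> compact K -> K `<=` X ->
  K None -> K (Some y) -> forall z, tail y z -> K (Some z).
Proof.
move=> cK pK KX KN Ky z tz; have Jy : J y by apply/X_Some; exact: KX.
have [Jz yz _] := tz; have [-> //|byz] := tail_cases Jy tz.
have clK : closed K by apply: compact_closed => //; exact: opc_hausdorff.
apply: clK => W /= /nbhs_ballP[e /= e0 eW].
have [k hk] := kap_pow_unbounded 3 e0.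
have [j kj hj] := below_late k (julia_survivors Jy) (julia_survivors Jz) yz byz.
have hj' : iter j f y 0 2 < iter j f z 0 2 by lra.
have [w Kw hw] := crossing cK KX KN Ky Jz (fun i _ => yz i) hj'.
exists (Some w); split => //; apply: eW; rewrite -ball_normE /= distrC.
apply: le_lt_trans (norm_le_enorm _) _.
have p1 := kap_pow_ge1 j; have p2 := kap_powS kj.
by rewrite ltNge; apply/negP => ew; have := enorm_ge0 (w - z); nra.
Qed.

(** * The fan of hairs *)

Lemma opc_connected_julia (K : set opc) : connected K -> K `<=` X -> ~ K None ->
  exists K0 : set 'rV[R]_3,
    [/\ connected K0, K0 `<=` J & forall x, K0 x <-> K (Some x)].
Proof.
move=> cK KX nK; exists [set x | K (Some x)]; split => //.
- exact: opc_connected_preimage.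
- by move=> x /KX/X_Some.
Qed.

(** If [z] were below [y], then the part of [A] from infinity to [z] would already
    contain the tail of [z], by [tail_sub], and so [y]. *)
Lemma arc_sub_tail (A : set opc) y z : A `<=` X -> is_arc R A None (Some y) ->
  A (Some z) -> tail y z.
Proof.
move=> AX /(arcP _ _ _ _ (@opc_hausdorff R))[g [cg ginj gA g0 g1]].
rewrite -gA => -[a /unit_itvE a01 ga].
have i0 : 0 <= (0 : R) <= 1 by rewrite lexx ler01.
have i1 : 0 <= (1 : R) <= 1 by rewrite lexx ler01.
have a_gt0 : 0 < a.
  rewrite lt_neqAle (andP a01).1 andbT; apply/eqP => a0.
  by move: ga; rewrite -a0 g0.
have gX t : 0 <= t <= 1 -> X (g t).
  by move=> t01; apply: AX; rewrite -gA; exists t => //; exact/unit_itvE.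
have Jz : J z by apply/X_Some; rewrite -ga; exact: gX.
have Jy : J y by apply/X_Some; rewrite -g1; exact: gX.
have yz : same_itinerary y z.
  pose K := g @` `]0, 1].
  have sub : `]0, 1]%classic `<=` (`[0, 1]%classic : set R).
    by move=> t /=; rewrite !in_itv /= => /andP[/ltW -> ->].
  have cK : connected K.
    apply: connected_continuous_connected; last exact: continuous_subspaceW cg.
    exact/connected_intervalP/interval_is_interval.
  have KX : K `<=` X by move=> _ [t /sub/unit_itvE t01 <-]; exact: gX.
  have nK : ~ K None.
    move=> [t t01]; have t01' : 0 <= t <= 1 by apply/unit_itvE; exact: sub.
    rewrite -g0 => /(ginj _ _ t01' i0) t0.
    by move: t01; rewrite /= t0 in_itv /= ltxx.
  have [K0 [cK0 K0J K0K]] := opc_connected_julia cK KX nK.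
  apply: (julia_connected_same cK0 K0J); apply/K0K.
    by exists 1 => //=; rewrite in_itv /= ltr01 lexx.
  by exists a => //=; rewrite in_itv /= a_gt0 (andP a01).2.
split => // bzy.
pose K := g @` `[0, a].
have sub : `[0, a]%classic `<=` (`[0, 1]%classic : set R).
  move=> t /=; rewrite !in_itv /= => /andP[-> ta] /=.
  by apply: le_trans ta _; case/andP: a01.
have cg' := continuous_subspaceW sub cg.
have : K (Some y).
  apply: (@tail_sub _ z); last first.
  - split => //; exact: (julia_below_asym Jz Jy (same_itinerary_sym yz) bzy).
  - by exists a => //=; rewrite in_itv /= lexx ltW.
  - by exists 0 => //=; rewrite in_itv /= lexx ltW.
  - by move=> _ [t /sub/unit_itvE t01 <-]; exact: gX.
  - by apply: continuous_compact => //; exact: segment_compact.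
  - by apply: connected_continuous_connected => //; exact: segment_connected.
move=> [t ta]; rewrite -g1 => gt1.
have t1 : t = 1 by apply: ginj => //; apply/unit_itvE; exact: sub.
have a1 : a = 1.
  by move: ta; rewrite /= t1 in_itv /= => /andP[_ ?]; apply/eqP; rewrite eq_le (andP a01).2.
by move: ga; rewrite a1 g1 => -[e]; move: bzy; rewrite e; exact: below_irrefl.
Qed.

Lemma segmentP (A : set opc) p : X p -> segment R X None p A ->
  [/\ connected A, compact A, A None, A p & forall z, A (Some z) ->
      exists2 y, p = Some y & tail y z].
Proof.
move=> Xp [AX [[<- ->]|arcA]].
  by split => //; [exact: connected1|exact: compact_set1].
have [cA pA AN Ap] := arc_connected arcA.
split => // z Az; case: p arcA Ap Xp => [y|] arcA Ap Xp.
  by exists y => //; exact: arc_sub_tail arcA Az.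
move: arcA => /(arcP _ _ _ _ (@opc_hausdorff R))[g [_ ginj _ g0 g1]].
have e01 : (0 : R) = 1 by apply: ginj; rewrite ?lexx ?ler01 // g0 g1.
by move/eqP: e01; rewrite eq_sym oner_eq0.
Qed.

(** An arc avoids infinity for a short while after leaving a finite point, and
    so begins with a nondegenerate connected part of a single hair. *)
Lemma arc_start (A : set opc) x q : A `<=` X -> is_arc R A (Some x) q ->
  exists (K : set 'rV[R]_3) y,
    [/\ connected K, K `<=` J, K x, K y & y <> x /\ Some @` K `<=` A].
Proof.
move=> AX /(arcP _ _ _ _ (@opc_hausdorff R))[g [cg ginj gA g0 g1]].
have i0 : 0 <= (0 : R) <= 1 by rewrite lexx ler01.
have : \forall t \near (0 : R), (`[0, 1]%classic : set R) t -> exists w, g t = Some w.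
  move/within_continuousP: cg => cg.
  have nb : nbhs (g 0) [set p : opc | exists w, p = Some w].
    have nT : nbhs x [set: 'rV[R]_3] by exact: filterT.
    rewrite g0; apply: (@filterS _ (nbhs (Some x : opc)) _ (Some @` setT)).
      by move=> _ [w _ <-]; exists w.
    exact: one_point_compactification_some_nbhs.
  by apply: (cg 0 _ _ nb); exact/unit_itvE.
move=> /nbhs_ballP[d /= d0 hd].
pose e := Num.min (d / 2) 1.
have e0 : 0 < e by rewrite lt_min ltr01 divr_gt0.
have e1 : e <= 1 by rewrite ge_min lexx orbT.
have ed : e < d.
  apply: (@le_lt_trans _ _ (d / 2)); first by rewrite ge_min lexx.
  by rewrite ltr_pdivrMr // ltr_pMr // ltr1n.
have sub : `[0, e]%classic `<=` (`[0, 1]%classic : set R).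
  by move=> t /=; rewrite !in_itv /= => /andP[-> te] /=; exact: le_trans te e1.
have hw t : 0 <= t <= e -> exists w, g t = Some w.
  move=> /andP[t0 te]; apply: hd.
    by rewrite -ball_normE /= sub0r normrN ger0_norm //; exact: le_lt_trans ed.
  by apply/unit_itvE; rewrite t0 (le_trans te).
have e0e : 0 <= e <= e by rewrite ltW ?lexx.
have [y gy] := hw e e0e.
have cK : connected (g @` `[0, e]).
  apply: connected_continuous_connected; first exact: segment_connected.
  exact: continuous_subspaceW cg.
have KA : g @` `[0, e] `<=` A by rewrite -gA; apply: image_subset.
have nK : ~ (g @` `[0, e]) None.
  by move=> [t /=]; rewrite in_itv /= => /hw[w ->].
have [K0 [cK0 K0J K0K]] := opc_connected_julia cK (subset_trans KA AX) nK.
exists K0, y; split => //.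
- by apply/K0K; exists 0 => //=; rewrite in_itv /= lexx ltW.
- by apply/K0K; exists e => //=; rewrite in_itv /=.
- split; last by move=> _ [w /K0K Kw <-]; exact: KA.
  move=> yx; have : g e = g 0 by rewrite gy g0 yx.
  have i_e : 0 <= e <= 1 by rewrite ltW.
  by move=> /(ginj _ _ i_e i0) ee; rewrite ee ltxx in e0.
Qed.

(** Two connected pieces of a hair that leave [x] on the same side are nested
    near [x], by [connected_between]. *)
Lemma same_side (K K' : set 'rV[R]_3) x y y' :
  connected K -> K `<=` J -> connected K' -> K' `<=` J ->
  K x -> K y -> K' x -> K' y' -> y <> x -> y' <> x ->
  (below x y /\ below x y') \/ (below y x /\ below y' x) ->
  exists w, [/\ w <> x, K w & K' w].
Proof.
move=> cK KJ cK' K'J Kx Ky K'x K'y' nyx ny'x side.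
have [eyy|/eqP ne] := eqVneq y y'; first by exists y; rewrite {3}eyy.
have xy := julia_connected_same cK KJ Kx Ky.
have xy' := julia_connected_same cK' K'J K'x K'y'.
have yy' := same_itinerary_trans (same_itinerary_sym xy) xy'.
have Jx := KJ _ Kx; have Jy := KJ _ Ky; have Jy' := K'J _ K'y'.
have [bb|bb] := julia_below_total Jy Jy' yy' ne; case: side => -[b1 b2].
- by exists y; split => //; apply: (julia_connected_between cK' K'J K'x K'y').
- by exists y'; split => //; apply: (julia_connected_between cK KJ Ky Kx).
- by exists y'; split => //; apply: (julia_connected_between cK KJ Kx Ky).
- by exists y; split => //; apply: (julia_connected_between cK' K'J K'y' K'x).
Qed.

(** Of three arcs leaving a finite point two leave it on the same side of the
    hair, and these overlap. *)
Lemma not_branch x : J x -> ~ branch_point R X (Some x).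
Proof.
move=> Jx [a [q [arcs disj]]].
have st i : exists Ky : set 'rV[R]_3 * 'rV[R]_3,
    [/\ connected Ky.1, Ky.1 `<=` J, Ky.1 x, Ky.1 Ky.2 &
        Ky.2 <> x /\ Some @` Ky.1 `<=` a i].
  have [aX arci] := arcs i; have [K [y hK]] := arc_start aX arci.
  by exists (K, y).
have side i : exists b : bool, exists Ky : set 'rV[R]_3 * 'rV[R]_3,
    [/\ connected Ky.1, Ky.1 `<=` J, Ky.1 x, Ky.1 Ky.2 &
        [/\ Ky.2 <> x, Some @` Ky.1 `<=` a i &
            if b then below x Ky.2 else below Ky.2 x]].
  have [Ky [cK KJ Kx Kz [ne Ka]]] := st i.
  have := julia_below_total Jx (KJ _ Kz) (julia_connected_same cK KJ Kx Kz) _.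
  case=> [e|b|b]; first by apply: ne.
  - by exists true, Ky.
  - by exists false, Ky.
have clash b i j : i != j ->
    (exists Ky : set 'rV[R]_3 * 'rV[R]_3,
    [/\ connected Ky.1, Ky.1 `<=` J, Ky.1 x, Ky.1 Ky.2 &
        [/\ Ky.2 <> x, Some @` Ky.1 `<=` a i &
            if b then below x Ky.2 else below Ky.2 x]]) ->
    (exists Ky : set 'rV[R]_3 * 'rV[R]_3,
    [/\ connected Ky.1, Ky.1 `<=` J, Ky.1 x, Ky.1 Ky.2 &
        [/\ Ky.2 <> x, Some @` Ky.1 `<=` a j &
            if b then below x Ky.2 else below Ky.2 x]]) -> False.
  move=> ij [Ky [cK KJ Kx Kz [ne Ka bb]]] [Ky' [cK' KJ' Kx' Kz' [ne' Ka' bb']]].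
  have [w [wx Kw Kw']] : exists w, [/\ w <> x, Ky.1 w & Ky'.1 w].
    apply: (same_side cK KJ cK' KJ' Kx Kz Kx' Kz' ne ne').
    by case: b bb bb' => *; [left|right].
  have : (a i `&` a j) (Some w) by split; [apply: Ka|apply: Ka']; exists w.
  by rewrite disj // => -[].
have [b0 h0] := side 0; have [b1 h1] := side 1; have [b2 h2] := side 2.
have [e|[e|e]] : b0 = b1 \/ b0 = b2 \/ b1 = b2.
  by case: b0 b1 b2 {h0 h1 h2} => [] [] []; auto.
- by rewrite -e in h1; apply: clash h0 h1.
- by rewrite -e in h2; apply: clash h0 h2.
- by rewrite -e in h2; apply: clash h1 h2.
Qed.

(** If [e] were in the interior of an arc, then both halves of this arc would
    leave [e] upwards, and would overlap. *)
Lemma bottom_endpoint e : bottom e -> fan_endpoint R X (Some e).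
Proof.
move=> [Je be]; split; first exact/X_Some.
move=> A p q AX /(arcP _ _ _ _ (@opc_hausdorff R))[g [cg ginj gA g0 g1]].
rewrite -gA => -[c /unit_itvE/andP[c0 c1] gc].
have [c00|cn0] := eqVneq c 0; first by left; rewrite -gc c00.
have [c11|cn1] := eqVneq c 1; first by right; rewrite -gc c11.
have {}c0 : 0 < c by rewrite lt_neqAle eq_sym cn0.
have {}c1 : c < 1 by rewrite lt_neqAle cn1.
have hT := @opc_hausdorff R.
have sub1 : `[0, c]%classic `<=` (`[0, 1]%classic : set R).
  by move=> t /=; rewrite !in_itv /= => /andP[-> tc] /=; rewrite (le_trans tc) // ltW.
have sub2 : `[c, 1]%classic `<=` (`[0, 1]%classic : set R).
  by move=> t /=; rewrite !in_itv /= => /andP[tc ->]; rewrite (le_trans _ tc) // ltW.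
have arc1 : is_arc R (g @` `[0, c]) (Some e) (g 0).
  rewrite -gc; apply: arc_rev => //; apply: segment_arc => //.
    exact: continuous_subspaceW cg.
  move=> s t s0 t0; apply: ginj.
    by apply/unit_itvE/sub1; rewrite /= in_itv.
  by apply/unit_itvE/sub1; rewrite /= in_itv.
have arc2 : is_arc R (g @` `[c, 1]) (Some e) (g 1).
  rewrite -gc; apply: segment_arc => //; first exact: continuous_subspaceW cg.
  move=> s t s0 t0; apply: ginj.
    by apply/unit_itvE/sub2; rewrite /= in_itv.
  by apply/unit_itvE/sub2; rewrite /= in_itv.
have A1 : g @` `[0, c] `<=` X.
  by apply: subset_trans AX; rewrite -gA; exact: image_subset.
have A2 : g @` `[c, 1] `<=` X.
  by apply: subset_trans AX; rewrite -gA; exact: image_subset.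
have [K [y [cK KJ Ke Ky [ny Kg]]]] := arc_start A1 arc1.
have [K' [y' [cK' KJ' Ke' Ky' [ny' Kg']]]] := arc_start A2 arc2.
have up (K1 : set 'rV[R]_3) v : connected K1 -> K1 `<=` J -> K1 e -> K1 v -> v <> e ->
    below e v.
  move=> cK1 KJ1 Ke1 Kv nv; have ve := julia_connected_same cK1 KJ1 Kv Ke1.
  have [] // := julia_below_total (KJ1 _ Kv) Je ve nv.
  by move=> b; exfalso; exact: (be v (KJ1 _ Kv) ve b).
have [w [we Kw Kw']] : exists w, [/\ w <> e, K w & K' w].
  apply: (same_side cK KJ cK' KJ' Ke Ky Ke' Ky' ny ny'); left.
  by split; [apply: up Ky ny|apply: up Ky' ny'].
exfalso; apply: we.
have [s /= + gs] : (g @` `[0, c]) (Some w) by apply: Kg; exists w.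
have [t /= + gt] : (g @` `[c, 1]) (Some w) by apply: Kg'; exists w.
rewrite !in_itv /= => /andP[tc t1] /andP[s0 sc].
have st : s = t.
  apply: ginj; rewrite ?gs ?gt //.
    by rewrite s0 (le_trans sc) // ltW.
  by rewrite t1 (le_trans _ tc) // ltW.
have sc' : s = c by apply/eqP; rewrite eq_le sc st tc.
by move: gs; rewrite sc' gc => -[].
Qed.

Lemma julia_nonempty : exists x, J x.
Proof.
have [HH [ncount _ cov hairs]] := julia_hairs.
have [HH0|/set0P[H HHH]] := eqVneq HH set0.
  by exfalso; apply: ncount; rewrite HH0; exact: countable0.
have [g [[_ gH _] _] _] := hairs H HHH; exists (g 0).
rewrite -cov; exists H => //; rewrite -gH; exists 0 => //=.
by rewrite in_itv /= lexx.
Qed.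

(** Translates of one hair lie in different beams, and so have different
    itineraries. *)
Lemma branch_None : branch_point R X None.
Proof.
have [x Jx] := julia_nonempty.
pose s (i : 'I_3) := shift (Posz i) x.
have Js i : J (s i) by exact: julia_shift.
exists (fun i => [set None] `|` Some @` tail (s i)), (fun i => Some (s i)); split.
  move=> i; split; last exact: tail_arc.
  by move=> p [->|[z [Jz _ _] <-]]; [exact: X_None|exact/X_Some].
move=> i j ij; apply/seteqP; split => p; last by move=> ->; split; left.
move=> [[-> //|[z [_ iz _] <-]] [//|[z' [_ jz' _] [zz']]]]; exfalso.
rewrite zz' in jz'; move/eqP: ij; apply; apply/val_inj => /=.
have := iz 0%N; rewrite -(jz' 0%N) /= !shift_beam_index => -[] /addrI.
by move=> /(mulfI (_ : (2 : int) != 0)) => /(_ isT) [].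
Qed.

Lemma X_connected : connected X.
Proof.
have [x Jx] := julia_nonempty.
have -> : X = \bigcup_(y in J) ([set None] `|` Some @` tail y).
  apply/seteqP; split => p.
    move=> [[y Jy <-]|->]; last by exists x => //; left.
    by exists y => //; right; exists y => //; exact: tail_refl.
  by move=> [y Jy [->|[z [Jz _ _] <-]]]; [right|left; exists z].
apply: bigcup_connected; first by exists None => y Jy; left.
by move=> y Jy; exact: tail_connected.
Qed.

Lemma X_compact : compact X.
Proof. by apply: opc_compact; exact: closed_julia. Qed.

Lemma hair_segment y z : J y -> J z -> same_itinerary y z -> below y z ->
  exists C : set opc, [/\ is_arc R C (Some y) (Some z), C `<=` X &
    forall p, C p -> p = Some y \/ p = Some z \/ exists u,
      [/\ p = Some u, J u, same_itinerary y u, below y u & below u z]].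
Proof.
move=> Jy Jz yz byz; have [g [a [a0 ga ch ty]]] := hair_at Jy.
have [cg gJ gS gB _] := ch.
have : tail y z by split => //; exact: julia_below_asym byz.
rewrite ty => -[b /= ]; rewrite in_itv /= andbT => ab gb.
have {}ab : a < b.
  rewrite lt_neqAle ab andbT; apply/eqP => e.
  by apply: (@below_irrefl y); move: byz; rewrite -gb -e ga.
have ge0 t : a <= t -> 0 <= t by exact: le_trans.
have sub : `[a, b]%classic `<=` (`[0, +oo[%classic : set R).
  by move=> t /=; rewrite !in_itv /= andbT => /andP[/ge0].
exists (((Some : _ -> opc) \o g) @` `[a, b]); split.
- rewrite -gb -ga; apply: (@segment_arc R opc (Some \o g)) => //.
  + exact: opc_hausdorff.
  + apply/within_continuousP => t tab W GW.
    have := continuous_subspaceW sub cg => /within_continuousP cg'.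
    exact: (cg' t tab (Some @^-1` W) GW).
  + move=> s t /andP[s1 _] /andP[t1 _] [].
    by apply: (chart_inj ch); exact: ge0.
- by move=> _ [t /= + <-]; rewrite in_itv /= => /andP[/ge0 t0 _]; apply/X_Some; exact: (gJ t t0).1.
- move=> _ [t /= + <-]; rewrite in_itv /= => /andP[ta tb].
  have [<-|an] := eqVneq a t; first by left; rewrite ga.
  have [->|bn] := eqVneq t b; first by right; left; rewrite gb.
  right; right; exists (g t); have [Jt yt] := gJ t (ge0 _ ta); split => //.
    by rewrite -{1}ga; apply: gB => //; rewrite lt_neqAle an.
  by rewrite -gb; apply: gB; [exact: ge0|rewrite lt_neqAle bn].
Qed.

Lemma X_arcwise : arcwise_connected R X.
Proof.
have hT := @opc_hausdorff R.
have tX y : J y -> [set None] `|` Some @` tail y `<=` X.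
  by move=> Jy p [->|[z [Jz _ _] <-]]; [right|left; exists z].
case=> [y|] [z|] // Xy Xz ne.
- have Jy := (X_Some y).1 Xy; have Jz := (X_Some z).1 Xz.
  have [yz|nyz] := pselect (same_itinerary y z).
    have nyz : y <> z by move=> e; apply: ne; rewrite e.
    have [b|b] := julia_below_total Jy Jz yz nyz.
      by have [C [aC CX _]] := hair_segment Jy Jz yz b; exists C.
    have [C [aC CX _]] := hair_segment Jz Jy (same_itinerary_sym yz) b.
    by exists C => //; exact: arc_rev.
  exists (([set None] `|` Some @` tail y) `|` ([set None] `|` Some @` tail z)).
    by move=> p [/(tX _ Jy)|/(tX _ Jz)].
  apply: (arc_concat hT (arc_rev hT (tail_arc Jy)) (tail_arc Jz)).
  move=> p [-> //|[u [_ yu _] <-]] [//|[v [_ zv _] [vu]]]; exfalso; apply: nyz.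
  by apply: same_itinerary_trans yu _; rewrite -vu; exact: same_itinerary_sym.
- have Jy := (X_Some y).1 Xy; exists ([set None] `|` Some @` tail y); first exact: tX.
  exact/arc_rev/tail_arc.
- have Jz := (X_Some z).1 Xz; exists ([set None] `|` Some @` tail z); first exact: tX.
  exact: tail_arc.
Qed.

(** A subcontinuum that contains infinity meets each hair in a tail, by
    [tail_sub]; one that does not is an interval of a single hair. In all cases
    two points of an intersection are joined inside it. *)
Lemma X_unicoherent : hereditarily_unicoherent R X.
Proof.
move=> K N KX NX [_ pK cK _] [_ pN cN _].
have inter (M : set opc) y z u : M `<=` X -> connected M -> compact M ->
    M (Some y) -> M (Some z) -> J u -> same_itinerary y u -> below y u -> below u z ->
    M (Some u).
  move=> MX cM pM My Mz Ju yu byu buz; have Jy : J y by exact/X_Some/MX.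
  have [MN|nMN] := pselect (M None).
    apply: (@tail_sub M y) => //; split => //; exact: julia_below_asym byu.
  have [K0 [cK0 K0J K0M]] := opc_connected_julia cM MX nMN.
  by apply/K0M; apply: (@julia_connected_between K0 y z) => //; exact/K0M.
have [[KN NN]|no] := pselect (K None /\ N None).
  have toN a : (K `&` N) a -> exists C,
      [/\ connected C, C `<=` K `&` N, C a & C None].
    case: a => [y|] [Ka Na]; last first.
      by exists [set None]; split => //; [exact: connected1|move=> _ ->].
    have Jy : J y by exact/X_Some/KX.
    exists ([set None] `|` Some @` tail y); split; [exact: tail_connected| |
      by right; exists y => //; exact: tail_refl|by left].
    move=> p [->|[z tz <-]]; split => //.
      exact: (tail_sub cK pK KX KN Ka).
    exact: (tail_sub cN pN NX NN Na).
  apply: connected_pairs => a b /toN[C [cC CK Ca CN]] /toN[D [cD DK Db DN]].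
  exists (C `|` D); split; [|by move=> p [/CK|/DK]|by left|by right].
  by apply: connectedU => //; exists None.
have nNone p : (K `&` N) p -> exists x, p = Some x.
  by case: p => [x|] [Kp Np]; [exists x|exfalso; apply: no].
apply: connected_pairs => a b Ba Bb.
have [y ey] := nNone a Ba; have [z ez] := nNone b Bb; rewrite ey ez in Ba Bb *.
have Jy : J y by exact/X_Some/KX/Ba.1.
have Jz : J z by exact/X_Some/KX/Bb.1.
have yz : same_itinerary y z.
  have sm (M : set opc) : M `<=` X -> connected M -> ~ M None ->
      M (Some y) -> M (Some z) -> same_itinerary y z.
    move=> MX cM nM My Mz; have [K0 [cK0 K0J K0M]] := opc_connected_julia cM MX nM.
    by apply: (julia_connected_same cK0 K0J); exact/K0M.
  have [KN|nKN] := pselect (K None).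
    by apply: (sm N) => //; [move=> NN; apply: no|exact: Ba.2|exact: Bb.2].
  by apply: (sm K) => //; [exact: Ba.1|exact: Bb.1].
have [->|/eqP nyz] := eqVneq y z.
  by exists [set Some z]; split => //; [exact: connected1|move=> _ ->].
have seg u v : (K `&` N) (Some u) -> (K `&` N) (Some v) -> J u -> J v ->
    same_itinerary u v -> below u v -> exists C,
    [/\ connected C, C `<=` K `&` N, C (Some u) & C (Some v)].
  move=> [Ku Nu] [Kv Nv] Ju Jv uv buv.
  have [C [aC CX hC]] := hair_segment Ju Jv uv buv.
  have [cC _ Cu Cv] := arc_connected aC; exists C; split => // p.
  move=> /hC[->|[->|[w [-> Jw uw buw bwv]]]] //.
  by split; apply: (@inter _ u v w).
have [b1|b1] := julia_below_total Jy Jz yz nyz; first exact: seg.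
have [C [? ? ? ?]] := seg z y Bb Ba Jz Jy (same_itinerary_sym yz) b1.
by exists C.
Qed.

(** * Endpoints and smoothness *)

Lemma X_fan : is_fan R X None.
Proof.
split.
- split; [by exists None; exact: X_None|exact: X_compact|exact: X_connected|].
  by exists (@opc_dist R); exact: opc_metrizes.
- exact: X_unicoherent.
- exact: X_arcwise.
- exact: X_None.
- move=> [x|] Xp; split => //; last by move=> _; exact: branch_None.
  by move=> /not_branch; move/X_Some: Xp.
Qed.

(** Infinity is a limit of Julia points, and these are limits of endpoints. *)
Lemma X_closure_endpoints : X `<=` closure [set p | fan_endpoint R X p].
Proof.
have [x0 Jx0] := julia_nonempty; have [C hC] := bottoms_dense Jx0.
have dense z (W : set opc) : J z -> nbhs (Some z : opc) W ->
    exists p, fan_endpoint R X p /\ W p.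
  move=> Jz /= /nbhs_ballP[e /= e0 eW].
  have [k hk] := kap_pow_unbounded C e0.
  have [b [bb _ bz]] := hC k z Jz; exists (Some b); split; first exact: bottom_endpoint.
  apply: eW; rewrite -ball_normE /= distrC; apply: le_lt_trans (norm_le_enorm _) _.
  have k0 : 0 < kap ^+ k by apply: lt_le_trans (kap_pow_ge1 k).
  by rewrite -(ltr_pM2l k0); exact: le_lt_trans bz hk.
move=> [z|] Xp W nW; first exact: (dense z W ((X_Some z).1 Xp) nW).
have [g [_ gJ _ _ up]] := hair_charts Jx0.
have NW : nbhs (None : opc) (W°) by apply: nbhs_interior.
have [M [_ hM]] := cvg_up_None up NW.
pose t := Num.max 0 (M + 1).
have Mt : M < t by rewrite lt_max ltrDl ltr01 orbT.
have t0 : 0 <= t by rewrite le_max lexx.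
exact: (dense (g t) W (gJ t t0).1 (hM t Mt)).
Qed.

(** A point above [y] in its hair can be lower than [y] by at most [4]; so when
    [y] tends to infinity, its whole tail does. *)
Lemma tail_bound y z : J y -> tail y z -> `|y| <= `|z| + 4.
Proof.
move=> Jy [Jz yz nb]; have m1 := mu_gt1.
have y2 := julia_survivors Jy 0%N; have z2 := julia_survivors Jz 0%N.
rewrite /= in y2 z2.
have hz : y 0 2 <= z 0 2 + 4.
  by rewrite leNgt; apply/negP => h1; apply: nb; exists 0%N.
have bz := beam_index_in z; have /= yz0 := yz 0%N; rewrite -yz0 in bz.
have [d0 d1] := in_beam_dist (beam_index_in y) bz.
have c i := coord_le_norm z i.
apply: norm_row3_le.
- by have := normr_ge0 z; lra.
- by have := ler_normD (y 0 0 - z 0 0) (z 0 0); rewrite subrK; have := c 0; lra.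
- by have := ler_normD (y 0 1 - z 0 1) (z 0 1); rewrite subrK; have := c 1; lra.
- by rewrite ger0_norm; [have := c 2; have := ler_norm (z 0 2); lra|lra].
Qed.

(** Both halves of Hausdorff convergence are local by compactness. A point [z]
    outside the arc to [y] has another itinerary than [y] or lies below [y], and
    either property holds for all points near [z] and [y]; so the arcs to the
    points near [y] stay away from [z]. Conversely, a point [z] above [y] is
    approached by these arcs because of [crossing]: only finitely many terms of
    the itinerary matter there, and these are the same for the points near [y]. *)
Lemma X_smooth : smooth_fan R X None.
Proof.
move=> d dm y_ y A_ A Xy_ Xy cvgy segs seg.
have [d0 ds dt dn] := dm.
have AX_ (n : nat) : A_ n `<=` X by have [] := segs n.
have AX : A `<=` X by have [] := seg.
have [cA pA AN Ay tA] := segmentP Xy seg.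
have S_ (n : nat) := segmentP (Xy_ n) (segs n).
have AN_ (n : nat) : A_ n None by have [] := S_ n.
have eventually (V : set 'rV[R]_3) y0 : y = Some y0 -> nbhs y0 V ->
    \forall n \near \oo, exists2 yn, y_ n = Some yn & V yn.
  move=> ey nV; have nW : nbhs y (Some @` V : set opc).
    by rewrite ey; exact: one_point_compactification_some_nbhs.
  have h1 : \forall n \near \oo, (Some @` V) (y_ n) := cvgy _ nW.
  by apply: filterS h1 => n [yn Vyn e]; exists yn.
apply: (hausdorff_cvg0 (p := None) (X := X)) => //.
  by move=> a b Xa Xb; exact: metrizes_ge0 dm Xa Xb.
move=> e e0.
have e20 : 0 < e / 2 by rewrite divr_gt0.
have S1 : \forall n \near \oo,
    X `<=` [set a | A_ n a -> exists2 b, A b & d a b < e].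
  have /compact_near_coveringP cov := X_compact.
  apply: (cov nat \oo (fun (n : nat) a => A_ n a -> exists2 b, A b & d a b < e)).
  move=> z Xz; have [Az|nAz] := pselect (A z).
    have nz := metrizes_nbhs dm Xz e0.
    near=> a n => /= An; exists z => //; rewrite ds //; last exact: (AX_ n).
    by have -> // : d z a < e; have : X a -> d z a < e; [near: a|apply; exact: (AX_ n)].
  suff : \forall a \near z & n \near \oo, ~ A_ n a.
    by apply: filterS => -[a n] /= nA /nA.
  case: z Xz nAz => [z0|] Xz nAz; last by [].
  have Jz := (X_Some z0).1 Xz.
  have clash (V W : set 'rV[R]_3) : nbhs z0 V ->
      (\forall n \near \oo, forall yn, y_ n = Some yn -> W yn) ->
      (forall a yn, V a -> W yn -> J a -> J yn -> ~ tail yn a) ->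
      \forall a \near (Some z0 : opc) & n \near \oo, ~ A_ n a.
    move=> nV nW VW; have nV' : nbhs (Some z0 : opc) (Some @` V).
      exact: one_point_compactification_some_nbhs.
    exists (Some @` V, [set n : nat | forall yn, y_ n = Some yn -> W yn]) => //.
    move=> [a n] /= [[a' Va <-] hn] Aa.
    have [_ _ _ _ /(_ a' Aa)[yn eyn tyn]] := S_ n.
    apply: (VW a' yn Va (hn yn eyn)) => //.
      by have [] := tyn.
    by apply/X_Some; rewrite -eyn; exact: Xy_.
  case: y Xy cvgy seg tA eventually {Ay} => [y0|] Xy cvgy seg tA eventually.
    have Jy := (X_Some y0).1 Xy.
    have nt : ~ tail y0 z0.
      move=> tz; apply: nAz; apply: (tail_sub cA pA AX AN _ tz).
      by have [_ _ _ Ay _] := segmentP Xy seg.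
    have evt (V : set 'rV[R]_3) : nbhs y0 V ->
        \forall n \near \oo, forall yn, y_ n = Some yn -> V yn.
      move=> nV; apply: filterS (eventually V y0 erefl nV) => n [yn e1 Vyn] yn'.
      by rewrite e1 => -[<-].
    have [yz|nyz] := pselect (same_itinerary y0 z0).
      have bzy : below z0 y0 by apply: contrapT => nb; apply: nt.
      have [k hk] := bzy.
      (* The gap of more than [4] between the [k]-th images is shared out at its
         midpoint, so that it persists for the points near [z0] and [y0]. *)
      pose m := (iter k f y0 0 2 + iter k f z0 0 2) / 2.
      apply: (clash [set a | iter k f a 0 2 < m - 2] [set b | iter k f b 0 2 > m + 2]).
      - apply: open_nbhs_nbhs; split; last by rewrite /= /m; lra.
        apply: (@open_comp _ _ (fun a => iter k f a 0 2) [set t | t < m - 2]).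
          by move=> w _; exact: iter_coord_continuous.
        exact: open_lt.
      - apply: evt; apply: open_nbhs_nbhs; split; last by rewrite /= /m; lra.
        apply: (@open_comp _ _ (fun a => iter k f a 0 2) [set t | t > m + 2]).
          by move=> w _; exact: iter_coord_continuous.
        exact: open_gt.
      - by move=> a b /= ha hb _ _ [_ _ nab]; apply: nab; exists k; lra.
    have [k hk] : exists k, beam_index (iter k f y0) <> beam_index (iter k f z0).
      by apply: contrapT => no; apply: nyz => k; apply: contrapT => ne; apply: no; exists k.
    have [V [oV Vp pV]] := open_prefix k z0; have [W [oW Wp pW]] := open_prefix k y0.
    apply: (clash V W).
    - by apply: open_nbhs_nbhs; split => //; apply: pV => //; exact: julia_survivors.
    - apply: evt; apply: open_nbhs_nbhs; split => //; apply: pW => //.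
      exact: julia_survivors.
    - move=> a b Va Wb _ _ [_ ba _]; apply: hk.
      by rewrite -(Vp a Va k (leqnn k)) -(Wp b Wb k (leqnn k)); exact: ba.
  (* Here [y] is infinity: the tails that start beyond norm [M] miss the ball of
     radius [|z0| + 1], by [tail_bound]. *)
  pose M := `|z0| + 5.
  apply: (clash [set a | `|a| < `|z0| + 1] [set b | M < `|b|]).
  - apply: open_nbhs_nbhs; split; last by rewrite /= ltrDl.
    apply: (@open_comp _ _ (fun a : 'rV[R]_3 => `|a|) [set t | t < `|z0| + 1]).
      by move=> w _; exact: norm_continuous.
    exact: open_lt.
  - have clM : closed [set b : 'rV[R]_3 | `|b| <= M].
      apply: (@closed_comp _ _ (fun a : 'rV[R]_3 => `|a|) [set t | t <= M]).
        by move=> w _; exact: norm_continuous.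
      exact: closed_le.
    have cM : compact [set b : 'rV[R]_3 | `|b| <= M].
      apply: bounded_closed_compact => //; exists M; split; first exact: num_real.
      by move=> M' MM' b /= bM; rewrite (le_trans bM) // ltW.
    have nW : nbhs (None : opc)
        (Some @` (~` [set b : 'rV[R]_3 | `|b| <= M]) `|` [set None]).
      by exists [set b : 'rV[R]_3 | `|b| <= M].
    have h1 : \forall n \near \oo,
        (Some @` (~` [set b : 'rV[R]_3 | `|b| <= M]) `|` [set None]) (y_ n).
      exact: (cvgy _ nW).
    apply: filterS h1 => n [[b /= nb eb]|e1] yn e2; last by rewrite e1 in e2.
    by move: e2; rewrite -eb => -[<-]; rewrite ltNge; exact/negP.
  - move=> a b /= ha hb Ja Jb /(tail_bound Jb); rewrite /M in hb; lra.
have S2 : \forall n \near \oo,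
    A `<=` [set b | A b -> exists2 a, A_ n a & d a b < e].
  move/compact_near_coveringP: pA => cov.
  apply: (cov nat \oo (fun (n : nat) b => A b -> exists2 a, A_ n a & d a b < e)).
  move=> a Aa; have Xa := AX a Aa.
  have na := metrizes_nbhs dm Xa e20.
  suff key : \forall n \near \oo, exists2 b, A_ n b & d a b < e / 2.
    near=> a' n => /= Aa'; have Xa' := AX _ Aa'.
    have [b Ab ab] : exists2 b, A_ n b & d a b < e / 2 by near: n.
    exists b => //; have Xb := AX_ n _ Ab.
    have h1 : d a a' < e / 2 by have : X a' -> d a a' < e / 2; [near: a'|apply].
    by have := dt b a a' Xb Xa Xa'; rewrite (ds b a) //; lra.
  case: a Aa Xa na => [z|] Aa Xa na; last first.
    near=> n; exists None => //.
    by rewrite ((d0 None None Xa Xa).2 erefl).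
  have [y0 ey tz] := tA z Aa.
  have Jy : J y0 by apply/X_Some; rewrite -ey.
  have [Jz yz nb] := tz; have [zy|byz] := tail_cases Jy tz.
    move: na; rewrite zy -ey => na.
    have h1 : \forall n \near \oo, X (y_ n) -> d y (y_ n) < e / 2 := cvgy _ na.
    apply: filterS h1 => n hn; exists (y_ n); last exact: hn.
    by have [] := S_ n.
  have /nbhs_ballP[r /= r0 hr] : nbhs z [set w | X (Some w) -> d (Some z) (Some w) < e / 2].
    exact: na.
  have [k0 hk0] := kap_pow_unbounded 3 r0.
  have [k kk hk] := below_late k0 (julia_survivors Jy) (julia_survivors Jz) yz byz.
  have [V [oV Vp pV]] := open_prefix k y0.
  have nV : nbhs y0 (V `&` [set w | iter k f w 0 2 < iter k f z 0 2]).
    apply: open_nbhs_nbhs; split.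
      apply: openI => //.
      apply: (@open_comp _ _ (fun a => iter k f a 0 2) [set t | t < _]).
        by move=> w _; exact: iter_coord_continuous.
      exact: open_lt.
    split; last by rewrite /=; lra.
    by apply: pV => //; exact: julia_survivors.
  apply: filterS (eventually _ y0 ey nV) => n [yn eyn [Vyn /= hyn]].
  have [cAn _ ANn Ayn _] := S_ n; rewrite eyn in Ayn.
  have pre : prefix k yn z by move=> j jk; rewrite (Vp yn Vyn j jk); exact: yz.
  have [w Aw hw] := crossing cAn (AX_ n) ANn Ayn Jz pre hyn.
  exists (Some w) => //; apply: hr; last exact: AX_ Aw.
  rewrite -ball_normE /= distrC; apply: le_lt_trans (norm_le_enorm _) _.
  have p2 := kap_powS kk; have k1 := kap_pow_ge1 k0.
  by rewrite ltNge; apply/negP => rw; have := enorm_ge0 (w - z); nra.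
apply: filterS2 S1 S2 => n h1 h2; split=> [a Aa|b Ab]; last exact: h2.
by apply: h1 => //; exact: (AX_ n).
Unshelve. all: by end_near. Qed.

Lemma X_lelek : is_lelek_fan R X None.
Proof.
by split; [exact: X_fan|exact: X_smooth|exact: X_closure_endpoints].
Qed.

End ZorichMap.

Theorem theorem6 (R : realType) (L lam : R)
    (h : 'rV[R]_2 -> 'rV[R]_3) (Z : 'rV[R]_3 -> 'rV[R]_3)
    (h_bilip : bilipschitz_on (@square R) L h)
    (h_onto : h @` (@square R) = @upper_hemisphere R)
    (h_sense : sense_preserving h)
    (Z_zorich : zorich_map h Z)
    (lam_gt0 : 0 < lam) (lam_lt : lam < expR (- (ln L + L)))
    (julia_hairs : exists HH : set (set 'rV[R]_3),
       [/\ ~ countable HH, trivIset HH id,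
           \bigcup_(H in HH) H = julia (zorich_scale lam Z) &
           forall H, HH H ->
             exists2 g : R -> 'rV[R]_3, hair_param H g & tends_up g])
    (fatou_cvg : forall x : 'rV[R]_3, ~ julia (zorich_scale lam Z) x ->
       exists2 p : 'rV[R]_3, zorich_scale lam Z p = p &
         iter n (zorich_scale lam Z) x @[n --> \oo] --> p) :
  @is_lelek_fan R (one_point_compactification 'rV[R]_3)
    (Some @` julia (zorich_scale lam Z) `|` [set None]) None.
Proof.
exact: (X_lelek h_bilip h_onto Z_zorich lam_gt0 lam_lt julia_hairs fatou_cvg).
Qed.
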